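(* Let $G$ be a Lie group with Lie algebra $\mathfrak g$, and let $G\circledS\mathfrak g_2$ act on $TT^*G\simeq(G\circledS\mathfrak g_1^* )\circledS(\mathfrak g_2\circledS\mathfrak g_3^* )$, equipped with the Tulczyjew symplectic two-form $\Omega_{TT^*G}$, by $$\big((g,\mu,\xi,\nu);(h,\eta)\big)\mapsto\big(gh,\ \mu,\ \xi+\mathrm{Ad}_g\eta,\ \nu-\mathrm{ad}^*_{\mathrm{Ad}_g\eta}\mu\big).$$ The symplectic reduction of $TT^*G$ under this action results in the coadjoint orbit $\mathcal O_{(\lambda,\mu)}$ in $\mathfrak g^*\times\mathfrak g^*$ through the point $(\lambda,\mu)$, under the coadjoint action $$\mathrm{Ad}^*_{(g,\xi)}(\lambda,\mu)=\big(\mathrm{Ad}_g^*(\lambda+\mathrm{ad}_\xi^*\mu),\ \mathrm{Ad}_g^*\mu\big)$$ of $G\circledS\mathfrak g_2$, as the total space, and the symplectic two-form $\Omega_{\mathcal O_{(\lambda,\mu)}}$ given by $$\langle\Omega_{\mathcal O_{(\lambda,\mu)}};(\eta,\zeta),(\bar\eta,\bar\zeta)\rangle(\lambda,\mu)=\langle\lambda,[\bar\eta,\eta]\rangle+\langle\mu,[\bar\eta,\zeta]-[\eta,\bar\zeta]\rangle$$ on two vectors $(\eta,\zeta)$ and $(\bar\eta,\bar\zeta)$ in $T_{(\lambda,\mu)}\mathcal O_{(\lambda,\mu)}$.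
   Context: $G$ is a Lie group with identity $e$, $\mathfrak g=T_eG$ its Lie algebra, $\mathfrak g^*$ the dual; $\mathfrak g_i$ and $\mathfrak g_i^*$ denote copies of $\mathfrak g$ and $\mathfrak g^*$, and $\circledS$ denotes semidirect product. $L_g,R_g$ are left and right multiplication. Conventions: $I_g=L_{g^{-1}}\circ R_g$, $\mathrm{Ad}_g=T_eI_g$ (right adjoint action), $\mathrm{ad}_\xi\eta=[\xi,\eta]$ is the derivative of $\mathrm{Ad}_g$ over the identity, $\langle\mathrm{Ad}_g^*\mu,\xi\rangle=\langle\mu,\mathrm{Ad}_{g^{-1}}\xi\rangle$, and $\mathrm{ad}_\xi^*$ is the linear algebraic dual of $\mathrm{ad}_\xi$. $T^*G$ is identified with $G\circledS\mathfrak g^*$ by $\alpha_g\mapsto(g,T_e^*R_g\alpha_g)$. $TT^*G\simeq T(G\circledS\mathfrak g^* )$ is identified with $(G\circledS\mathfrak g_1^* )\circledS(\mathfrak g_2\circledS\mathfrak g_3^* )$ by sending $(V_g,V_\mu)\in T_{(g,\mu)}(G\circledS\mathfrak g^* )$ to $(g,\mu,TR_{g^{-1}}V_g,V_\mu-\mathrm{ad}^*_{TR_{g^{-1}}V_g}\mu)$. The right invariant vector field generated by $(\xi_2,\nu_2,\xi_3,\nu_3)\in(\mathfrak g\circledS\mathfrak g^* )\circledS(\mathfrak g\circledS\mathfrak g^* )$ is $$X_{(\xi_2,\nu_2,\xi_3,\nu_3)}(g,\mu,\xi,\nu)=(TR_g\xi_2,\ \nu_2+\mathrm{ad}^*_{\xi_2}\mu,\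 \xi_3+\mathrm{ad}_{\xi_2}\xi,\ \nu_3+\mathrm{ad}^*_{\xi_2}\nu-\mathrm{ad}^*_\xi\nu_2).$$ The Tulczyjew symplectic two-form is given by $$\langle\Omega_{TT^*G};(X_{(\xi_2,\nu_2,\xi_3,\nu_3)},X_{(\bar\xi_2,\bar\nu_2,\bar\xi_3,\bar\nu_3)})\rangle(g,\mu,\xi,\nu)=\langle\nu_3,\bar\xi_2\rangle-\langle\nu_2,\bar\xi_3\rangle+\langle\bar\nu_2,\xi_3\rangle-\langle\bar\nu_3,\xi_2\rangle-\langle\nu,[\xi_2,\bar\xi_2]\rangle+\langle\xi,\mathrm{ad}^*_{\bar\xi_2}\nu_2-\mathrm{ad}^*_{\xi_2}\bar\nu_2\rangle,$$ and its potential one-form $\theta_2$ ($d\theta_2=\Omega_{TT^*G}$) by $\langle\theta_2,X_{(\xi_2,\nu_2,\xi_3,\nu_3)}\rangle=\langle\mu,\xi_3\rangle+\langle\nu,\xi_2\rangle+\langle\mu,[\xi,\xi_2]\rangle$. $G\circledS\mathfrak g$ has group law $(g,\xi)(h,\eta)=(gh,\xi+\mathrm{Ad}_g\eta)$ and Lie algebra $\mathfrak g\circledS\mathfrak g$ with bracket $[(\xi_1,\xi_2),(\eta_1,\eta_2)]=([\xi_1,\eta_1],[\xi_1,\eta_2]-[\eta_1,\xi_2])$. The right invariant vector field generating the action and associated to $(\xi_2,\xi_3)$ in this Lie algebra is $X_{(\xi_2,0,\xi_3,0)}(g,\mu,\xi,\nu)=(TR_g\xi_2,\mathrm{ad}^*_{\xi_2}\mu,\xi_3+[\xi,\xi_2],\mathrm{ad}^*_{\xi_2}\nu)$.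 The momentum map $\mathbf J:TT^*G\to\mathfrak g^*\times\mathfrak g^*$ used for the reduction is defined by $$\langle\mathbf J(g,\mu,\xi,\nu),(\xi_2,\xi_3)\rangle=\langle\theta_2,X_{(\xi_2,0,\xi_3,0)}\rangle=\langle\mu,\xi_3\rangle+\langle\nu+\mathrm{ad}^*_\xi\mu,\xi_2\rangle,$$ that is, $\mathbf J(g,\mu,\xi,\nu)=(\nu+\mathrm{ad}^*_\xi\mu,\mu)$. Its preimage of a fixed $(\lambda,\mu)$ is $\{(g,\mu,\xi,\nu):\nu=\lambda-\mathrm{ad}^*_\xi\mu\}$, identified with $G\circledS\mathfrak g_2$. The isotropy subgroup $(G\circledS\mathfrak g_2)_{(\lambda,\mu)}=\{(g,\xi):\mathrm{Ad}^*_{(g,\xi)}(\lambda,\mu)=(\lambda,\mu)\}$ acts on this preimage, and the reduced space is the quotient $\mathbf J^{-1}(\lambda,\mu)/(G\circledS\mathfrak g_2)_{(\lambda,\mu)}$. Tangent vectors to the orbit are labelled by the elements $(\eta,\zeta)\in\mathfrak g\circledS\mathfrak g$ that generate them through the coadjoint action.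
   Formalization: Ad_g is T(L_g R_{g^-1}), so that the group law is associative; Ω is dθ2, not the displayed formula, which contradicts it; J pairs θ2 with the generators of the stated (right) action, as the form on level sets of (ν+ad*_ξ μ, μ) need not descend to the quotient. *)

(* Defs.v *)
From HB Require Import structures.
From mathcomp Require Import all_boot all_order all_algebra.
From mathcomp Require Import all_classical all_reals all_analysis.
Set Implicit Arguments.
Unset Strict Implicit.
Unset Printing Implicit Defensive.
Import Order.TTheory GRing.Theory Num.Theory.
Import numFieldNormedType.Exports.
Local Open Scope classical_set_scope.
Local Open Scope ring_scope.

Section Smooth.
Context {R : realType} {E F : normedModType R}.

(* Meant for an open set U of a finite-dimensional space: f is C^(k+1) on U iff
   it is differentiable there and all its directional derivatives are C^k. *)
Fixpoint Ck_on (k : nat) (U : set E) (f : E -> F) : Prop :=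
  match k with
  | 0%N => forall x, U x -> {for x, continuous f}
  | k'.+1 => (forall x, U x -> differentiable f x) /\
             (forall v : E, Ck_on k' U (fun x => 'D_v f x))
  end.

Definition smooth_on (U : set E) (f : E -> F) := forall k, Ck_on k U f.

End Smooth.

(* A chosen chart around every point p : its domain [adom p], the chart
   [acoord p] and its inverse [apoint p] (junk outside [adom p], resp. outside
   the image of [adom p]).  The tangent space at p is E, a vector being written
   in coordinates in the chart chosen at p. *)
Record atlas (R : realType) (E : normedModType R) (M : topologicalType) := Atlas {
  adom : M -> set M;
  acoord : M -> M -> E;
  apoint : M -> E -> M
}.

Definition acodom (R : realType) (E : normedModType R) (M : topologicalType)
  (A : atlas E M) (p : M) : set E := acoord A p @` adom A p.

Definition is_manifold (R : realType) (E : normedModType R) (M : topologicalType)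
    (A : atlas E M) : Prop :=
  [/\ hausdorff_space M, @second_countable M,
      forall p, [/\ open (adom A p), adom A p p, open (acodom A p) &
                    forall x, adom A p x -> apoint A p (acoord A p x) = x],
      forall p, (forall x, adom A p x -> {for x, continuous (acoord A p)}) /\
                (forall y, acodom A p y -> {for y, continuous (apoint A p)}) &
      forall p q, smooth_on (acoord A p @` (adom A p `&` adom A q))
                            (acoord A q \o apoint A p)].

Definition vec_atlas (R : realType) (V : normedModType R) : atlas V V :=
  Atlas (fun=> setT) (fun=> id) (fun=> id).

Definition prod_atlas (R : realType) (E F : normedModType R)
    (M N : topologicalType) (A : atlas E M) (B : atlas F N) :
    atlas (E * F)%type (M * N)%type :=
  Atlas (fun p => adom A p.1 `*` adom B p.2)
        (fun p x => (acoord A p.1 x.1, acoord B p.2 x.2))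
        (fun p y => (apoint A p.1 y.1, apoint B p.2 y.2)).

Section Maps.
Context {R : realType} {E F : normedModType R} {M N : topologicalType}.
Variables (A : atlas E M) (B : atlas F N).

Definition mrep (f : M -> N) (p : M) : E -> F :=
  acoord B (f p) \o f \o apoint A p.

Definition msmooth (f : M -> N) : Prop :=
  continuous f /\
  forall p, smooth_on (acoord A p @` (adom A p `&` f @^-1` adom B (f p)))
                      (mrep f p).

(* T_p f : T_p M -> T_(f p) N, in the charts chosen at p and at f p *)
Definition mdiff (f : M -> N) (p : M) : E -> F := 'd (mrep f p) (acoord A p p).

Definition submersion (f : M -> N) : Prop :=
  msmooth f /\ forall p v, exists u, mdiff f p u = v.

Definition immersion (f : M -> N) : Prop :=
  msmooth f /\ forall p, injective (mdiff f p).

Definition embedding (f : M -> N) : Prop :=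
  [/\ immersion f, injective f &
      forall U : set M, open U -> exists2 W : set N, open W & U = f @^-1` W].

End Maps.

Section Forms.
Context {R : realType} {E : normedModType R} {M : topologicalType}.
Variable A : atlas E M.

(* pullbacks of al and om along the inverse of the chart at p *)
Definition rep1 (al : M -> E -> R) (p : M) (y u : E) : R :=
  al (apoint A p y) (mdiff (vec_atlas E) A (apoint A p) y u).

Definition rep2 (om : M -> E -> E -> R) (p : M) (y u v : E) : R :=
  om (apoint A p y) (mdiff (vec_atlas E) A (apoint A p) y u)
                    (mdiff (vec_atlas E) A (apoint A p) y v).

(* d al (u, v) = D_u (al v) - D_v (al u) for constant u, v in the chart at p,
   without a factor 1/2; similarly for two-forms *)
Definition dform1 (al : M -> E -> R) (p : M) (u v : E) : R :=
  'D_u (fun y => rep1 al p y v : R^o) (acoord A p p)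
  - 'D_v (fun y => rep1 al p y u : R^o) (acoord A p p).

Definition dform2 (om : M -> E -> E -> R) (p : M) (u v w : E) : R :=
  'D_u (fun y => rep2 om p y v w : R^o) (acoord A p p)
  - 'D_v (fun y => rep2 om p y u w : R^o) (acoord A p p)
  + 'D_w (fun y => rep2 om p y u v : R^o) (acoord A p p).

Definition is_two_form (om : M -> E -> E -> R) : Prop :=
  [/\ forall p u, linear (om p u : E -> R^o),
      forall p u v, om p u v = - om p v u &
      forall p u v, smooth_on (acodom A p) (fun y => rep2 om p y u v : R^o)].

Definition is_symplectic (om : M -> E -> E -> R) : Prop :=
  [/\ is_two_form om,
      forall p u v w, dform2 om p u v w = 0 &
      forall p u, (forall v, om p u v = 0) -> u = 0].

End Forms.

(* (Q, om) is the reduced space J^-1(rho) / K_rho of (M, Om) for the right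
   action [act] of a group K with isotropy subgroup [Krho]: the level set is
   presented as the image of an embedded manifold N, and Q as the quotient of N
   by a surjective submersion whose fibres are the Krho-orbits. *)
Definition is_symplectic_reduction (R : realType) (EM EN EQ : normedModType R)
    (M N Q : topologicalType)
    (AM : atlas EM M) (AN : atlas EN N) (AQ : atlas EQ Q)
    (Om : M -> EM -> EM -> R) (K W : Type) (act : M -> K -> M) (J : M -> W)
    (rho : W) (Krho : set K)
    (i : N -> M) (pi : N -> Q) (om : Q -> EQ -> EQ -> R) : Prop :=
  [/\ embedding AN AM i /\ range i = [set p | J p = rho],
      forall p k, J p = rho -> Krho k -> J (act p k) = rho,
      [/\ submersion AN AQ pi, forall q, exists x, pi x = q &
          forall x y, pi x = pi y <-> exists2 k, Krho k & i y = act (i x) k],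
      is_manifold AQ /\ is_symplectic AQ om &
      forall x u v, om (pi x) (mdiff AN AQ pi x u) (mdiff AN AQ pi x v) =
                    Om (i x) (mdiff AN AM i x u) (mdiff AN AM i x v)].

#[short(type="topGroupType")]
HB.structure Definition TopGroup := {G of Group G & Topological G}.

Section LieGroup.
Context {R : realType} {n : nat} {G : topGroupType}.
Variable AG : atlas 'rV[R]_n G.

Definition is_lie_group : Prop :=
  [/\ is_manifold AG,
      msmooth (prod_atlas AG AG) AG (fun x => (x.1 * x.2)%g) &
      msmooth AG AG (fun x => (x^-1)%g)].

(* g = T_e G = 'rV_n, and g^* = 'cV_n through the following pairing *)
Definition pair (mu : 'cV[R]_n) (xi : 'rV[R]_n) : R := (xi *m mu) 0 0.

(* the element of g^* that represents a linear form *)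
Definition vdual (f : 'rV[R]_n -> R) : 'cV[R]_n := \col_j f (delta_mx 0 j).

Lemma pair_vdual (f : {linear 'rV[R]_n -> R^o}) xi : pair (vdual f) xi = f xi.
Proof.
rewrite /pair mxE [in RHS](row_sum_delta xi) linear_sum.
by apply: eq_bigr => j _; rewrite linearZ mxE.
Qed.

(* T_e R_g : T_e G -> T_g G, as the chart at 1 * g is the chart at g *)
Definition TR (g : G) : 'rV[R]_n -> 'rV[R]_n :=
  mdiff AG AG (fun h => (h * g)%g) 1%g.

(* Ad_g = T_e (h |-> g h g^-1).  This is the Ad_g for which the semidirect
   product law below is associative. *)
Definition Ad (g : G) : 'rV[R]_n -> 'rV[R]_n :=
  mdiff AG AG (fun h => (g * h * g^-1)%g) 1%g.

(* [xi, eta] = ad_xi eta, the derivative of g |-> Ad_g eta at the identity *)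
Definition bracket (xi eta : 'rV[R]_n) : 'rV[R]_n :=
  mdiff AG (vec_atlas 'rV[R]_n) (fun g => Ad g eta) 1%g xi.

Definition adstar (xi : 'rV[R]_n) (mu : 'cV[R]_n) : 'cV[R]_n :=
  vdual (fun eta => pair mu (bracket xi eta)).

(* <Adstar g mu, eta> = <mu, T_e(L_g o R_(g^-1)) eta>, where L_g o R_(g^-1) is
   I_(g^-1) for the convention I_g = L_(g^-1) o R_g *)
Definition Adstar (g : G) (mu : 'cV[R]_n) : 'cV[R]_n :=
  vdual (fun eta => pair mu (Ad g eta)).

Notation Gg := (G * 'rV[R]_n)%type.

Definition Gg_atlas : atlas ('rV[R]_n * 'rV[R]_n)%type Gg :=
  prod_atlas AG (vec_atlas 'rV[R]_n).

Definition Gg_one : Gg := (1%g, 0).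

Definition Gg_mul (a b : Gg) : Gg := ((a.1 * b.1)%g, a.2 + Ad a.1 b.2).

Definition Gg_inv (a : Gg) : Gg := ((a.1^-1)%g, - Ad (a.1^-1)%g a.2).

Definition coAd (a : Gg) (rho : 'cV[R]_n * 'cV[R]_n) : 'cV[R]_n * 'cV[R]_n :=
  (Adstar a.1 (rho.1 + adstar a.2 rho.2), Adstar a.1 rho.2).

Definition coad_orbit (rho : 'cV[R]_n * 'cV[R]_n) : set ('cV[R]_n * 'cV[R]_n) :=
  range (fun a : Gg => coAd a rho).

Definition coad_isotropy (rho : 'cV[R]_n * 'cV[R]_n) : set Gg :=
  [set a | coAd a rho = rho].

(* the tangent vector at rho labelled by a = (eta, zeta) *)
Definition coad_generator (rho : 'cV[R]_n * 'cV[R]_n)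
    (a : 'rV[R]_n * 'rV[R]_n) : 'cV[R]_n * 'cV[R]_n :=
  mdiff Gg_atlas (vec_atlas ('cV[R]_n * 'cV[R]_n)%type) (coAd^~ rho) Gg_one a.

Definition orbit_form (rho : 'cV[R]_n * 'cV[R]_n)
    (a b : 'rV[R]_n * 'rV[R]_n) : R :=
  pair rho.1 (bracket b.1 a.1)
  + pair rho.2 (bracket b.1 a.2 - bracket a.1 b.2).

(* TT^*G, trivialized by (V_g, V_mu) in T_(g, mu)(G x g^* ) |->
   (g, mu, xi, V_mu - ad^*_xi mu) where xi = T R_(g^-1) V_g *)
Notation TTsG := (G * 'cV[R]_n * 'rV[R]_n * 'cV[R]_n)%type.
Notation TTsGvec := ('rV[R]_n * 'cV[R]_n * 'rV[R]_n * 'cV[R]_n)%type.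

Definition TTsG_atlas : atlas TTsGvec TTsG :=
  prod_atlas (prod_atlas (prod_atlas AG (vec_atlas 'cV[R]_n))
                         (vec_atlas 'rV[R]_n))
             (vec_atlas 'cV[R]_n).

Definition Xfield (a : TTsGvec) (p : TTsG) : TTsGvec :=
  let '(xi2, nu2, xi3, nu3) := a in
  let '(g, mu, xi, nu) := p in
  (TR g xi2, nu2 + adstar xi2 mu, xi3 + bracket xi2 xi,
   nu3 + adstar xi2 nu - adstar xi nu2).

(* The fields X_a span every tangent space, so this determines theta2.  It is
   the tangent lift of the canonical one-form of T^*G. *)
Definition is_theta2 (theta2 : TTsG -> TTsGvec -> R) : Prop :=
  forall g mu xi nu xi2 nu2 xi3 nu3,
    theta2 (g, mu, xi, nu) (Xfield (xi2, nu2, xi3, nu3) (g, mu, xi, nu)) =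
    pair mu xi3 + pair nu xi2 + pair mu (bracket xi xi2).

Definition TTsG_act (p : TTsG) (a : Gg) : TTsG :=
  let '(g, mu, xi, nu) := p in
  ((g * a.1)%g, mu, xi + Ad g a.2, nu - adstar (Ad g a.2) mu).

Definition TTsG_generator (p : TTsG) (a : 'rV[R]_n * 'rV[R]_n) : TTsGvec :=
  mdiff Gg_atlas TTsG_atlas (TTsG_act p) Gg_one a.

(* <J(p), (xi2, xi3)> = <theta2, generator of (xi2, xi3)> (p) *)
Definition momentum (theta2 : TTsG -> TTsGvec -> R) (p : TTsG) :
    'cV[R]_n * 'cV[R]_n :=
  (vdual (fun xi2 => theta2 p (TTsG_generator p (xi2, 0))),
   vdual (fun xi3 => theta2 p (TTsG_generator p (0, xi3)))).

End LieGroup.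

Notation Gg R n G := (G * 'rV[R]_n)%type (only parsing).
Notation TTsG R n G := (G * 'cV[R]_n * 'rV[R]_n * 'cV[R]_n)%type (only parsing).
Notation TTsGvec R n :=
  ('rV[R]_n * 'cV[R]_n * 'rV[R]_n * 'cV[R]_n)%type (only parsing).

(* Main.v *)
(* Write K for the semidirect product of G and g.  The preimage of rho = (lam, mu)
   under J is a graph over K, and theta_2 pulls back to it as the one-form
     alpha_(g, xi) = <lam, Ad_(g^-1) r> + <mu, Ad_(g^-1) v>,
   where r is the right trivialization of the G-component and v is the g-component
   of the tangent vector.  The translation x |-> x b pulls alpha^rho back to
   alpha^(Phi b), where Phi b = Ad^*_(b^-1) rho, and symmetry of second derivatives
   of the group law (Maurer-Cartan) gives d alpha at the identity: it is
   orbit_form rho.  Hence d alpha at b is orbit_form (Phi b) in the right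
   trivialization.  As orbit_form sigma a b = - <generator of a at sigma, b>, this
   depends only on the differential of Phi and is nondegenerate modulo its kernel.
   The map Phi is equivariant for left translations, so it has constant rank; the
   constant rank theorem at the identity, translated over K, yields charts on the
   quotient of K by the fibres of Phi, which are the isotropy orbits.  Closedness
   and smoothness of the reduced form are read off local sections, along which it
   is the differential of the pullback of alpha. *)
Require Import Defs.
From HB Require Import structures.
From mathcomp Require Import all_boot all_order all_algebra.
From mathcomp Require Import all_classical all_reals all_analysis.
From mathcomp Require Import ring lra.
Set Implicit Arguments.
Unset Strict Implicit.
Unset Printing Implicit Defensive.
Import Order.TTheory GRing.Theory Num.Theory.
Import numFieldNormedType.Exports.
Local Open Scope classical_set_scope.
Local Open Scope ring_scope.

(** * Smooth maps *)

(** The coadjoint action is a right action, so the fibres of a |-> Ad^*_a rho are the cosets K_rho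
    a, whereas the isotropy group acts on the level set by right multiplication; the inverse in Phi
    turns the fibres into the orbits a K_rho. Along right translations the differential of Phi is
    minus the generator, and the two signs cancel in the bilinear form. The orbit need not be
    embedded, so Q is built as a quotient of K with an injective immersion [iota] into the duals,
    and tangent vectors of Q meet their labels (eta, zeta) only through the differential of [iota].
    Labels are not unique and are picked by choice, so even linearity of the reduced form has to be
    read off that differential. Differentials are written in the charts chosen at source and target.
    A family of them can be differentiated only if its members share a target chart; this holds for
    maps that are constant on a slice or on the diagonal, such as x h x^-1 at h = 1, or x^-1 h at h
    = x, and these yield Ad and the Maurer-Cartan forms. *)

Section Ck_calculus.
Context {R : realType}.
Implicit Types E F H : normedModType R.

Lemma Ck_on_sub {E F} k (U V : set E) (f : E -> F) :
  V `<=` U -> Ck_on k U f -> Ck_on k V f.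
Proof.
move=> VU; elim: k f => [|k IH] f /=; first by move=> fc x /VU /fc.
by case=> fd fk; split => [x /VU /fd//|v]; exact: IH.
Qed.

(** Continuity, differentiability and derivatives at a point refer to the ambient space and not to
    U, so [Ck_on k [set x] f] is a meaningful condition at the single point x. *)
Lemma Ck_on_pointwise {E F} k (U : set E) (f : E -> F) :
  (forall x, U x -> Ck_on k [set x] f) -> Ck_on k U f.
Proof.
elim: k f => [|k IH] f /= fU; first by move=> x Ux; exact: (fU x Ux x erefl).
split=> [x Ux|v]; first by have [fd _] := fU _ Ux; exact: (fd x erefl).
by apply: IH => x Ux; have [_ fk] := fU _ Ux; exact: fk.
Qed.

Lemma Ck_onW {E F} k (U : set E) (f : E -> F) : Ck_on k.+1 U f -> Ck_on k U f.
Proof.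
elim: k f => [|k IH] f.
  by case=> fd _ x Ux; apply: differentiable_continuous; exact: fd.
case=> fd fk; split=> // v; apply: IH; exact: fk.
Qed.

(** The first-order expansion of f at x is also one of g, since the o-term only sees points near
    x. *)
Lemma near_differentiable {E F} (f g : E -> F) x :
  (\near x, f x = g x) -> differentiable f x -> differentiable g x.
Proof.
move=> fg df; apply/diff_locallyP.
have fgx : f x = g x := nbhs_singleton fg.
have eqo_g : g \o shift x = cst (g x) + 'd f x +o_ 0 id.
  apply/eqaddoP => e e0.
  have /eqaddoP := (diff_locally df) => /(_ _ e0) fo.
  have fg0 : \forall h \near 0, f (h + x) = g (h + x).
    by move: fg; rewrite (near_shift 0)/=; apply: filterS => h/=; rewrite subr0.
  near=> h.
  have -> : (g \o shift x - (cst (g x) + 'd f x)) h =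
            (f \o shift x - (cst (f x) + 'd f x)) h.
    by rewrite !fctE /= fgx; congr (_ - _); apply/esym; near: h.
  by near: h.
have dgf : 'd g x = 'd f x :> (E -> F).
  by apply: diff_unique => //; exact: diff_continuous.
by rewrite dgf; split => //; exact: diff_continuous.
Unshelve. all: by end_near. Qed.

Lemma near_diff {E F} (f g : E -> F) x :
  (\near x, f x = g x) -> differentiable f x -> 'd f x = 'd g x :> (E -> F).
Proof.
move=> fg df; apply/funext => v; rewrite -deriveE// (near_eq_derive v fg).
by rewrite deriveE//; exact: near_differentiable fg df.
Qed.

Lemma open_eq_near {E F} (U : set E) (f g : E -> F) x :
  open U -> (forall x, U x -> f x = g x) -> U x -> \near x, f x = g x.
Proof. by move=> oU fg Ux; apply: (filterS fg); exact: open_nbhs_nbhs. Qed.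

(** Openness of U turns equality on U into equality near each of its points, which derivatives
    inherit. *)
Lemma Ck_on_eq {E F} k (U : set E) (f g : E -> F) :
  open U -> (forall x, U x -> f x = g x) -> Ck_on k U f -> Ck_on k U g.
Proof.
move=> oU; elim: k f g => [|k IH] f g /= fg.
  move=> fc x Ux; have fgx := open_eq_near oU fg Ux.
  suff: g @ x --> g x by []; rewrite -(fg _ Ux); apply: cvg_trans (fc _ Ux).
  exact: near_eq_cvg.
case=> fd fk; split => [x Ux|v].
  by apply: near_differentiable (fd _ Ux); exact: open_eq_near fg Ux.
apply: IH (fk v) => x Ux; apply: near_eq_derive; exact: open_eq_near fg Ux.
Qed.

Lemma Ck_on_cst {E F} k (U : set E) (a : F) : Ck_on k U (fun=> a).
Proof.
elim: k a => [|k IH] a /=; first by move=> x _; exact: cvg_cst.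
split=> [x _|v]; first exact: differentiable_cst.
by under [fun x => _]eq_fun do rewrite derive_cst; exact: IH.
Qed.

Lemma Ck_onD {E F} k (U : set E) (f g : E -> F) : open U ->
  Ck_on k U f -> Ck_on k U g -> Ck_on k U (fun x => f x + g x).
Proof.
move=> oU; elim: k f g => [|k IH] f g /=.
  by move=> fc gc x Ux; apply: cvgD; [exact: fc|exact: gc].
move=> [fd fk] [gd gk]; split=> [x Ux|v].
  exact: (differentiableD (fd _ Ux) (gd _ Ux)).
apply: (Ck_on_eq oU (f := fun x => 'D_v f x + 'D_v g x)); last exact: IH.
by move=> x Ux; rewrite [RHS]deriveD//; apply/diff_derivable; [exact: fd|exact: gd].
Qed.

Lemma Ck_on_sum {E F} k (U : set E) I (s : seq I) (f : I -> E -> F) : open U ->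
  (forall i, Ck_on k U (f i)) -> Ck_on k U (fun x => \sum_(i <- s) f i x).
Proof.
move=> oU fk; elim: s => [|i s IH].
  by under [fun x => _]eq_fun do rewrite big_nil; exact: Ck_on_cst.
by under [fun x => _]eq_fun do rewrite big_cons; exact: Ck_onD.
Qed.

Lemma Ck_on_linear {E F H} k (U : set E) (f : E -> F) (l : {linear F -> H}) :
  open U -> continuous l -> Ck_on k U f -> Ck_on k U (fun x => l (f x)).
Proof.
move=> oU lc; elim: k f => [|k IH] f /=.
  by move=> fc x Ux; apply: (cvg_comp _ _ (fc _ Ux)); exact: lc.
have dl y := linear_differentiable y lc.
move=> [fd fk]; split=> [x Ux|v].
  exact: (differentiable_comp (fd _ Ux) (dl _)).
apply: (Ck_on_eq oU (f := fun x => l ('D_v f x))); last exact: IH.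
move=> x Ux; rewrite -[fun x => l (f x)]/(l \o f).
have dlf : differentiable (l \o f) x by exact: (differentiable_comp (fd _ Ux) (dl _)).
rewrite (deriveE v dlf) (deriveE v (fd _ Ux)) (diff_comp (fd _ Ux) (dl _)) /=.
by rewrite diff_lin.
Qed.

Lemma continuous_bilinear_diff {E F H W : normedModType R} (f : E -> F) (g : E -> H)
    (b : {bilinear F -> H -> W}) x :
  continuous (fun p => b p.1 p.2) -> differentiable f x -> differentiable g x ->
  is_diff x (fun x => b (f x) (g x)) (fun v => b ('d f x v) (g x) + b (f x) ('d g x v)).
Proof.
move=> bc fd gd.
have db := @differentiable_bilin _ _ _ _ b (f x, g x) bc.
have dp := differentiable_pair fd gd.
apply: DiffDef.
  exact: (@differentiable_comp _ _ _ _ (fun y => (f y, g y)) (fun p => b p.1 p.2)).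
apply/funext => v; rewrite addrC.
rewrite (@diff_comp _ _ _ _ (fun y => (f y, g y)) (fun p => b p.1 p.2))//=.
by rewrite diff_pair// diff_bilin.
Qed.

Lemma Ck_on_bilinear {E F H W : normedModType R} k (U : set E) (f : E -> F) (g : E -> H)
    (b : {bilinear F -> H -> W}) : open U -> continuous (fun p => b p.1 p.2) ->
  Ck_on k U f -> Ck_on k U g -> Ck_on k U (fun x => b (f x) (g x)).
Proof.
move=> oU bc; elim: k f g => [|k IH] f g.
  move=> fc gc x Ux.
  apply: (@cvg_comp _ _ _ (fun x => (f x, g x)) (fun p => b p.1 p.2)
    _ _ _ _ (bc (f x, g x))).
  by apply: cvg_pair; [exact: fc|exact: gc].
(* Leibniz' rule mixes the derivatives with the functions themselves, so the induction hypothesis is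
   also applied to f and g at order k. *)
move=> fk gk; have fk' := Ck_onW fk; have gk' := Ck_onW gk.
case: fk gk => fd fk [gd gk]; split=> [x Ux|v].
  by have [] := continuous_bilinear_diff bc (fd _ Ux) (gd _ Ux).
apply: (Ck_on_eq oU (f := fun x => b ('D_v f x) (g x) + b (f x) ('D_v g x))).
  move=> x Ux; have [db dv] := continuous_bilinear_diff bc (fd _ Ux) (gd _ Ux).
  by rewrite [RHS]deriveE// dv (deriveE v (fd _ Ux)) (deriveE v (gd _ Ux)).
apply: Ck_onD => //; first exact: (IH _ _ (fk v) gk').
exact: (IH _ _ fk' (gk v)).
Qed.

(** With R^o as the space of scalars, scaling is a bilinear map of normed modules, and products of
    functions become an instance of the bilinear case. *)
Lemma scale_is_bilinear F :
  bilinear_for (GRing.Scale.Law.clone _ _ *:%R _) (GRing.Scale.Law.clone _ _ *:%R _)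
    (@GRing.scale R F : R^o -> F -> F).
Proof.
split=> [u|u] a x y /=; first by rewrite scalerDl scalerA.
by rewrite scalerDr !scalerA mulrC.
Qed.
HB.instance Definition _ F := bilinear_isBilinear.Build R R^o F F _ _
  (@GRing.scale R F : R^o -> F -> F) (scale_is_bilinear F).

Lemma Ck_onZ {E F} k (U : set E) (a : E -> R^o) (f : E -> F) : open U ->
  Ck_on k U a -> Ck_on k U f -> Ck_on k U (fun x => a x *: f x).
Proof.
move=> oU ak fk.
by apply: (Ck_on_bilinear (b := @GRing.scale R F : R^o -> F -> F)) => //; exact: scale_continuous.
Qed.

End Ck_calculus.

(** A spanning family e with continuous linear coefficients c, possibly redundant: c is a right
    inverse of the map from coefficients to vectors. As a class it is found by instance resolution
    for matrices and products. *)
Class FinDim (R : realType) (E : normedModType R) : Prop := fin_dim :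
  exists N (e : 'I_N -> E) (c : 'I_N -> {linear E -> R^o}),
    (forall i, continuous (c i)) /\ forall x, x = \sum_i c i x *: e i.

Lemma continuous_sum (R : realType) (T : topologicalType) (F : normedModType R) I (s : seq I)
    (f : I -> T -> F) (x : T) :
  (forall i, {for x, continuous (f i)}) ->
  (\sum_(i <- s) f i y) @[y --> x] --> \sum_(i <- s) f i x.
Proof.
move=> fc; elim: s => [|i s IH].
  by under [fun x => _]eq_fun do rewrite big_nil; rewrite big_nil; exact: cvg_cst.
under [fun x => _]eq_fun do rewrite big_cons.
by rewrite big_cons; apply: cvgD => //; exact: fc.
Qed.

Lemma FinDim_matrix_subproof (R : realType) m n : FinDim 'M[R]_(m, n).
Proof.
have lin (i : 'I_m) (j : 'I_n) : linear (fun A : 'M[R]_(m, n) => A i j : R^o).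
  by move=> a A B; rewrite !mxE.
pose ci (k : 'I_#|{: 'I_m * 'I_n}|) : {linear 'M[R]_(m, n) -> R^o} :=
  HB.pack (fun A : 'M[R]_(m, n) => A (enum_val k).1 (enum_val k).2 : R^o)
    (GRing.isLinear.Build R 'M[R]_(m, n) R^o _ _ (lin (enum_val k).1 (enum_val k).2)).
exists _, (fun k => delta_mx (enum_val k).1 (enum_val k).2), ci; split.
  by move=> k; exact: coord_continuous.
move=> A; rewrite {1}[A]matrix_sum_delta pair_big /=.
rewrite (reindex (fun k : 'I_#|{: 'I_m * 'I_n}| => enum_val k))//=.
by exists enum_rank => k _; rewrite ?enum_valK ?enum_rankK.
Qed.

#[export] Instance FinDim_matrix (R : realType) m n : FinDim 'M[R]_(m, n) :=
  FinDim_matrix_subproof R m n.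

#[export] Instance FinDim_prod (R : realType) (E F : normedModType R)
  (hE : FinDim E) (hF : FinDim F) : FinDim (E * F)%type.
Proof.
have [N [e [c [cc ce]]]] := hE; have [M [f [d [dc df]]]] := hF.
have linc i : linear (fun x : E * F => c i x.1) by move=> a x y; rewrite linearP.
have lind i : linear (fun x : E * F => d i x.2) by move=> a x y; rewrite linearP.
pose C (k : 'I_(N + M)) : {linear (E * F)%type -> R^o} := match fintype.split k with
  | inl i => HB.pack (fun x : E * F => c i x.1) (GRing.isLinear.Build R (E * F)%type R^o _ _ (linc i))
  | inr j => HB.pack (fun x : E * F => d j x.2) (GRing.isLinear.Build R (E * F)%type R^o _ _ (lind j))
  end.
exists (N + M)%N, (fun k => match fintype.split k with inl i => (e i, 0) | inr j => (0, f j) end), C.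
split=> [k x|[x y]].
  rewrite /C; case: (fintype.split k) => i.
    by apply: (@cvg_comp _ _ _ fst (c i) _ _ _ _ (cc i _)); exact: cvg_fst.
  by apply: (@cvg_comp _ _ _ snd (d i) _ _ _ _ (dc i _)); exact: cvg_snd.
rewrite big_split_ord /=.
under eq_bigr => i _ do rewrite /C (unsplitK (inl i)) /=.
under [X in _ + X]eq_bigr => i _ do rewrite /C (unsplitK (inr i)) /=.
have fstS (I : finType) (g : I -> E * F) : (\sum_i g i).1 = \sum_i (g i).1.
  exact: (big_morph fst).
have sndS (I : finType) (g : I -> E * F) : (\sum_i g i).2 = \sum_i (g i).2.
  exact: (big_morph snd).
have sp (x1 x2 : E) (y1 y2 : F) : (x1, y1) + (x2, y2) = (x1 + x2, y1 + y2) by [].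
rewrite [X in X + _]surjective_pairing [X in _ + X]surjective_pairing sp.
rewrite !fstS !sndS /=; congr (_, _).
  by rewrite [X in _ + X]big1 ?addr0 -?ce// => i _; rewrite scaler0.
by rewrite [X in X + _]big1 ?add0r -?df// => i _; rewrite scaler0.
Qed.

(** * Smoothness at a point of a finite-dimensional space *)

Section smooth_calculus.
Context {R : realType}.
Implicit Types E F H : normedModType R.

Lemma linear_continuous_findim {E F} {hE : FinDim E} (l : {linear E -> F}) :
  continuous l.
Proof.
have [N [e [c [cc ce]]]] := hE.
have -> : (l : E -> F) = fun x => \sum_i c i x *: l (e i).
  apply/funext => x; rewrite {1}(ce x) linear_sum.
  by apply: eq_bigr => i _; rewrite linearZ.
move=> x; apply: continuous_sum => i; apply: cvgZr_tmp; exact: cc.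
Qed.

(* Only C^k on all directions separately is available, whence the coordinates:
   D_v (g o f) = sum_i c_i(D_v f) (D_(e_i) g o f). *)
Lemma Ck_on_comp {E F H} {hF : FinDim F} k (U : set E) (V : set F) (f : E -> F) (g : F -> H) :
  open U -> open V -> (forall x, U x -> V (f x)) ->
  Ck_on k U f -> Ck_on k V g -> Ck_on k U (g \o f).
Proof.
move=> oU oV UV; have [N [e [c [cc ce]]]] := hF.
elim: k g => [|k IH] g fk gk.
  by move=> x Ux; apply: continuous_comp; [exact: fk|apply: gk; exact: UV].
have fk' := Ck_onW fk; case: fk gk => fd fk [gd gk].
split=> [x Ux|v]; first exact: (differentiable_comp (fd _ Ux) (gd _ (UV _ Ux))).
apply: (Ck_on_eq oU (f := fun x => \sum_i (c i ('D_v f x)) *: ('D_(e i) g \o f) x)).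
  move=> x Ux; have gdx := gd _ (UV _ Ux); have fdx := fd _ Ux.
  rewrite [RHS]deriveE; last exact: differentiable_comp.
  rewrite diff_comp//= -(deriveE v fdx) {2}(ce ('D_v f x)) linear_sum.
  by apply: eq_bigr => i _; rewrite linearZ /= (deriveE _ gdx).
apply: Ck_on_sum => // i; apply: Ck_onZ => //; last exact: (IH _ fk' (gk _)).
by apply: Ck_on_linear => //; exact: fk.
Qed.

(** The quantifier over k stands under the neighbourhood, so that a single neighbourhood serves all
    orders. *)
Definition smooth_at {E F} (f : E -> F) (x : E) :=
  \forall y \near x, forall k, Ck_on k [set y] f.

Lemma smooth_at_openP {E F} (f : E -> F) x :
  smooth_at f x <-> exists2 U, open_nbhs x U & smooth_on U f.
Proof.
split=> [|[U oU fU]].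
  move=> fs; have : nbhs x [set y | forall k, Ck_on k [set y] f] by [].
  rewrite nbhsE => -[U oU fU]; exists U => // k.
  by apply: Ck_on_pointwise => y /fU.
apply: filterS (open_nbhs_nbhs oU) => y Uy k.
by apply: Ck_on_sub (fU k) => _ ->.
Qed.

Lemma smooth_onP {E F} (U : set E) (f : E -> F) : open U ->
  smooth_on U f <-> forall x, U x -> smooth_at f x.
Proof.
move=> oU; split=> [fU x Ux|fU k]; first by apply/smooth_at_openP; exists U.
by apply: Ck_on_pointwise => x /fU/nbhs_singleton.
Qed.

Lemma smooth_at_near {E F} (f : E -> F) x :
  smooth_at f x -> \forall y \near x, smooth_at f y.
Proof.
move=> /smooth_at_openP[U [oU Ux] fU]; near=> y; apply/smooth_at_openP; exists U => //.
by split=> //; near: y; exact: open_nbhs_nbhs.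
Unshelve. all: by end_near. Qed.

Lemma smooth_at_differentiable {E F} (f : E -> F) x : smooth_at f x -> differentiable f x.
Proof. by move=> /nbhs_singleton/(_ 1%N)[fd _]; exact: fd. Qed.

Lemma smooth_at_continuous {E F} (f : E -> F) x : smooth_at f x -> {for x, continuous f}.
Proof. by move=> /smooth_at_differentiable/differentiable_continuous. Qed.

Lemma smooth_at_eq {E F} (f g : E -> F) x :
  (\near x, f x = g x) -> smooth_at f x -> smooth_at g x.
Proof.
move=> fg /smooth_at_openP[U [oU Ux] fU]; apply/smooth_at_openP.
have : nbhs x [set x | f x = g x] by []; rewrite nbhsE => -[V [oV Vx] fgV].
exists (U `&` V); first by split => //; exact: openI.
move=> k; apply: (@Ck_on_eq _ _ _ _ _ f) => [|y [_ /fgV]//|]; first exact: openI.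
by apply: Ck_on_sub (fU k) => y [].
Qed.

Lemma smooth_at_D {E F} (f : E -> F) (v : E) x : smooth_at f x -> smooth_at ('D_v f) x.
Proof.
move=> /smooth_at_openP[U oU fU]; apply/smooth_at_openP; exists U => // k.
by have [_] := fU k.+1; apply.
Qed.

Lemma smooth_at_comp {E F H} {hF : FinDim F} (f : E -> F) (g : F -> H) x :
  smooth_at f x -> smooth_at g (f x) -> smooth_at (fun y => g (f y)) x.
Proof.
move=> fs; have fc := smooth_at_continuous fs; move: fs.
move=> /smooth_at_openP[U [oU Ux] fU] /smooth_at_openP[V [oV Vfx] gV].
have : nbhs x (U `&` f @^-1` V).
  by apply: filterI; [exact: open_nbhs_nbhs|apply: fc; exact: open_nbhs_nbhs].
rewrite nbhsE => -[W [oW Wx] WUV]; apply/smooth_at_openP; exists W => // k.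
apply: (Ck_on_comp oW oV (f := f)) => //; first by move=> y /WUV[].
by apply: Ck_on_sub (fU k) => y /WUV[].
Qed.

Lemma smooth_at_linear {E F} {hE : FinDim E} (l : E -> F) x : linear l -> smooth_at l x.
Proof.
move=> hl; pose L : {linear E -> F} := HB.pack l (GRing.isLinear.Build R E F _ _ hl).
have Lc : continuous L by apply: linear_continuous_findim.
apply/smooth_at_openP; exists setT; first by split=> //; exact: openT.
move=> [|k]; first by move=> y _; exact: (Lc y).
split=> [y _|v]; first exact: (linear_differentiable y Lc).
have -> : 'D_v l = fun=> l v.
  apply/funext => y; rewrite deriveE; last exact: (linear_differentiable y Lc).
  by rewrite (diff_lin y Lc).
exact: Ck_on_cst.
Qed.

Lemma smooth_at_cst {E F} (a : F) (x : E) : smooth_at (fun=> a) x.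
Proof. by apply: nearW => y k; exact: Ck_on_cst. Qed.

Lemma smooth_atDr {E F} (f g : E -> F) x :
  smooth_at f x -> smooth_at g x -> smooth_at (fun x => f x + g x) x.
Proof.
move=> /smooth_at_openP[U [oU Ux] fU] /smooth_at_openP[V [oV Vx] gV].
apply/smooth_at_openP; exists (U `&` V); first by split => //; exact: openI.
move=> k; apply: Ck_onD; first exact: openI.
  by apply: Ck_on_sub (fU k) => y [].
by apply: Ck_on_sub (gV k) => y [].
Qed.

Lemma smooth_at_bilinear {E F H W : normedModType R} (f : E -> F) (g : E -> H)
    (b : {bilinear F -> H -> W}) x : continuous (fun p => b p.1 p.2) ->
  smooth_at f x -> smooth_at g x -> smooth_at (fun x => b (f x) (g x)) x.
Proof.
move=> bc /smooth_at_openP[U [oU Ux] fU] /smooth_at_openP[V [oV Vx] gV].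
apply/smooth_at_openP; exists (U `&` V); first by split => //; exact: openI.
move=> k; apply: Ck_on_bilinear => //; first exact: openI.
  by apply: Ck_on_sub (fU k) => y [].
by apply: Ck_on_sub (gV k) => y [].
Qed.

Lemma smooth_atZ {E F} (a : E -> R^o) (f : E -> F) x :
  smooth_at a x -> smooth_at f x -> smooth_at (fun x => a x *: f x) x.
Proof.
move=> sa sf; apply: (smooth_at_bilinear (b := @GRing.scale R F : R^o -> F -> F)) => //.
exact: scale_continuous.
Qed.

Lemma smooth_atN {E F} (f : E -> F) x :
  smooth_at f x -> smooth_at (fun x => - f x) x.
Proof.
move=> fs; apply: (@smooth_at_eq _ _ (fun x => (-1 : R^o) *: f x)).
  by apply: nearW => y; rewrite scaleN1r.
by apply: smooth_atZ => //; exact: smooth_at_cst.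
Qed.

Lemma smooth_at_sum {E F} I (s : seq I) (f : I -> E -> F) x :
  (forall i, smooth_at (f i) x) -> smooth_at (fun x => \sum_(i <- s) f i x) x.
Proof.
move=> fs; elim: s => [|i s IH].
  by under [fun x => _]eq_fun do rewrite big_nil; exact: smooth_at_cst.
by under [fun x => _]eq_fun do rewrite big_cons; exact: smooth_atDr.
Qed.

(** A pair is the sum of its components sent through the two linear inclusions of the factors, so
    sums and linear maps suffice. *)
Lemma smooth_at_pair {E F H} (f : E -> F) (g : E -> H) x :
  smooth_at f x -> smooth_at g x -> smooth_at (fun x => (f x, g x)) x.
Proof.
have linl : linear (fun y : F => (y, 0 : H)) by move=> a y z; rewrite -[RHS]/(a *: y + z, a *: 0 + 0) scaler0 addr0.
have linr : linear (fun y : H => (0 : F, y)) by move=> a y z; rewrite -[RHS]/(a *: 0 + 0, a *: y + z) scaler0 addr0.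
pose Ll : {linear F -> (F * H)%type} := HB.pack (fun y : F => (y, 0 : H))
  (GRing.isLinear.Build R F (F * H)%type _ _ linl).
pose Lr : {linear H -> (F * H)%type} := HB.pack (fun y : H => (0 : F, y))
  (GRing.isLinear.Build R H (F * H)%type _ _ linr).
have Llc : continuous Ll by move=> y; apply: cvg_pair; [exact: cvg_id|exact: cvg_cst].
have Lrc : continuous Lr by move=> y; apply: cvg_pair; [exact: cvg_cst|exact: cvg_id].
move=> /smooth_at_openP[U [oU Ux] fU] /smooth_at_openP[V [oV Vx] gV].
apply/smooth_at_openP; exists (U `&` V); first by split => //; exact: openI.
move=> k; apply: (@Ck_on_eq _ _ _ _ _ (fun x => Ll (f x) + Lr (g x))).
- exact: openI.
- by move=> y _; rewrite -[LHS]/(f y + 0, 0 + g y) addr0 add0r.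
apply: Ck_onD; first exact: openI.
- by apply: Ck_on_linear => //; [exact: openI|apply: Ck_on_sub (fU k) => y []].
- by apply: Ck_on_linear => //; [exact: openI|apply: Ck_on_sub (gV k) => y []].
Qed.

End smooth_calculus.

(** * Smooth scalar and matrix functions *)

Section smooth_scalar.
Context {R : realType}.
Implicit Types E F : normedModType R.

Lemma smooth_at_coord {E} m n (A : E -> 'M[R]_(m, n)) x i j :
  smooth_at A x -> smooth_at (fun y => A y i j : R^o) x.
Proof.
move=> As; apply: (smooth_at_comp As (g := fun B : 'M[R]_(m, n) => B i j : R^o)).
by apply: smooth_at_linear => a B C; rewrite !mxE.
Qed.

Lemma smooth_at_mx {E} m n (A : E -> 'M[R]_(m, n)) x :
  (forall i j, smooth_at (fun y => A y i j : R^o) x) -> smooth_at A x.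
Proof.
move=> As; apply: (@smooth_at_eq _ _ _
    (fun y => \sum_i \sum_j (A y i j : R^o) *: delta_mx i j)).
  by apply: nearW => y; rewrite [RHS]matrix_sum_delta.
do 2 apply: smooth_at_sum => ?; apply: smooth_atZ; first exact: As.
exact: smooth_at_cst.
Qed.

Lemma smooth_atM {E} (a b : E -> R^o) x :
  smooth_at a x -> smooth_at b x -> smooth_at (fun y => (a y : R) * (b y : R) : R^o) x.
Proof. exact: smooth_atZ. Qed.

Lemma smooth_at_prod {E} I (s : seq I) (f : I -> E -> R^o) x :
  (forall i, smooth_at (f i) x) -> smooth_at (fun x => \prod_(i <- s) f i x : R^o) x.
Proof.
move=> fs; elim: s => [|i s IH].
  by under [fun x => _]eq_fun do rewrite big_nil; exact: smooth_at_cst.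
by under [fun x => _]eq_fun do rewrite big_cons; exact: (smooth_atZ (fs i) IH).
Qed.

Lemma smooth_at_det {E} n (A : E -> 'M[R]_n) x :
  smooth_at A x -> smooth_at (fun y => \det (A y) : R^o) x.
Proof.
move=> As; apply: smooth_at_sum => s.
apply: smooth_atM; first exact: smooth_at_cst.
apply: smooth_at_prod => i.
exact: smooth_at_coord.
Qed.

(** Induction on the order by D_v (1/a) = - (1/a) (1/a) D_v a, on an open set where a is smooth and
    nonzero. *)
Lemma smooth_atV {E} (a : E -> R^o) x :
  smooth_at a x -> a x != 0 -> smooth_at (fun y => (a y)^-1 : R^o) x.
Proof.
move=> sa ax0; have ac := smooth_at_continuous sa.
have : nbhs x (smooth_at a `&` [set y | a y != 0]).
  apply: filterI; first exact: smooth_at_near.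
  exact: (@cvgr_neq0 _ _ _ _ _ a (a x)).
rewrite nbhsE => -[U [oU Ux] Ua]; apply/smooth_at_openP; exists U => //.
have aU k : Ck_on k U a by apply: Ck_on_pointwise => y /Ua[/nbhs_singleton ay _]; exact: ay.
have dV y : U y -> differentiable (fun y => (a y)^-1 : R^o) y.
  by move=> Uy; apply: differentiableV; [have [/(_ _ Uy)] := aU 1%N|have [] := Ua _ Uy].
elim=> [|k IH]; first by move=> y Uy; exact: differentiable_continuous (dV _ Uy).
split=> // v.
apply: (@Ck_on_eq _ _ _ _ _ (fun y => (-1 : R^o) *: (((a y)^-1 : R^o) *: (((a y)^-1 : R^o) *: ('D_v a y : R^o))))) => //.
  move=> y Uy; rewrite [RHS]deriveV.
  - by rewrite scaleN1r scaleNr -exprVn expr2 scalerA.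
  - by have [] := Ua _ Uy.
  - by apply: diff_derivable; have [/(_ _ Uy)] := aU 1%N.
apply: Ck_onZ => //; first exact: Ck_on_cst.
do 2 apply: Ck_onZ => //.
by have [_] := aU k.+1; apply.
Qed.

(** Cramer's rule. [invmx] is given by that formula only at invertible matrices, but the determinant
    stays nonzero near x. *)
Lemma smooth_at_invmx {E} n (A : E -> 'M[R]_n) x :
  smooth_at A x -> A x \in unitmx -> smooth_at (fun y => invmx (A y)) x.
Proof.
move=> As Ax; have ds := smooth_at_det As.
have dx : \det (A x) != 0 by move: Ax; rewrite unitmxE unitfE.
apply: (@smooth_at_eq _ _ _ (fun y => ((\det (A y))^-1 : R^o) *: \adj (A y))).
  have dn : \forall y \near x, \det (A y) != 0.
    exact: (@cvgr_neq0 _ _ _ _ _ (fun y => \det (A y)) (\det (A x)) (smooth_at_continuous ds)).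
  by apply: filterS dn => y dy; rewrite /invmx unitmxE unitfE dy.
apply: smooth_atZ; first exact: smooth_atV.
apply: smooth_at_mx => i j; under [fun y => _]eq_fun do rewrite mxE /cofactor.
apply: smooth_atM; first exact: smooth_at_cst.
apply: smooth_at_det; apply: smooth_at_mx => a b.
under [fun y => _]eq_fun do rewrite !mxE; exact: smooth_at_coord.
Qed.

Lemma smooth_at_mulmx {E} m n p (A : E -> 'M[R]_(m, n)) (B : E -> 'M[R]_(n, p)) x :
  smooth_at A x -> smooth_at B x -> smooth_at (fun y => A y *m B y) x.
Proof.
move=> As Bs; apply: smooth_at_mx => i j.
under [fun y => _]eq_fun do rewrite mxE.
apply: smooth_at_sum => k.
by apply: smooth_atM; exact: smooth_at_coord.
Qed.

End smooth_scalar.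

(** * Second derivatives, inverse functions and constant rank *)

Section mean_value.
Context {R : realType}.
Implicit Types E F : normedModType R.

Lemma MVT_line {E} (f : E -> R^o) (x u : E) :
  (forall t, 0 <= t <= 1 -> differentiable f (t *: u + x)) ->
  exists2 c, 0 <= c <= 1 & f (u + x) - f x = 'D_u f (c *: u + x).
Proof.
move=> fd; pose h (s : R) : E := s *: u + x.
have hd t : is_diff t h ( *:%R^~ u).
  by have := is_diffD (is_diff_scalel t u) (is_diff_cst x t); rewrite addr0.
pose g : R -> R := f \o h.
have gd (t : R) : 0 <= t <= 1 -> is_derive t 1 g ('D_u f (h t)).
  move=> t01; have fdt := fd _ t01.
  have dg : differentiable (g : R -> R) t by exact: differentiable_comp.
  apply: DeriveDef; first exact/diff_derivable.
  by rewrite deriveE// /g diff_comp//= diff_val/= scale1r deriveE.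
have [] := @MVT_segment R g (fun t => 'D_u f (h t)) 0 1 ler01.
- by move=> t; rewrite in_itv/= => /andP[t0 t1]; apply: gd; rewrite !ltW.
- apply: derivable_within_continuous => t; rewrite in_itv/= => t01.
  by have [] := gd _ t01.
- move=> c; rewrite in_itv/= => c01; rewrite subr0 mulr1 /g /h /= scale1r scale0r add0r => ->.
  by exists c.
Qed.

Lemma derive_scale {E F} (f : E -> F) (x v : E) (a : R) :
  differentiable f x -> 'D_(a *: v) f x = a *: 'D_v f x.
Proof. by move=> fd; rewrite !deriveE// linearZ. Qed.

(** Two applications of the mean value theorem: along u to y |-> f (s v + y) - f y, then along v to
    D_u f. The left-hand side is the alternating sum of f over the corners of the parallelogram
    spanned by s u and s v at x. *)
Lemma second_difference {E} (f : E -> R^o) (x u v : E) (s r : R) :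
  0 < s -> s * (`|u| + `|v|) < r -> (forall y, ball x r y -> smooth_at f y) ->
  exists2 y, `|x - y| <= s * (`|u| + `|v|) &
    f (s *: u + (s *: v + x)) - f (s *: u + x) - (f (s *: v + x) - f x) =
    s ^+ 2 * 'D_v ('D_u f) y.
Proof.
move=> s0 sr fs; pose nt := s * (`|u| + `|v|).
have inb a b : 0 <= a <= 1 -> 0 <= b <= 1 ->
    `|x - (b *: (s *: v) + (a *: (s *: u) + x))| <= nt.
  move=> /andP[a0 a1] /andP[b0 b1].
  rewrite [in X in _ - X]addrA opprD addrCA subrr addr0 normrN.
  rewrite (le_trans (ler_normD _ _))// !normrZ !(ger0_norm a0) !(ger0_norm b0) !(gtr0_norm s0).
  rewrite /nt mulrDr addrC; apply: lerD.
    by rewrite ler_piMl// mulr_ge0// ltW.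
  by rewrite ler_piMl// mulr_ge0// ltW.
have smo a b : 0 <= a <= 1 -> 0 <= b <= 1 ->
    smooth_at f (b *: (s *: v) + (a *: (s *: u) + x)).
  by move=> a01 b01; apply: fs; rewrite -ball_normE /ball_/=; apply: le_lt_trans (inb _ _ a01 b01) sr.
have z01 : 0 <= (0 : R) <= 1 by rewrite lexx ler01.
have o01 : 0 <= (1 : R) <= 1 by rewrite lexx ler01.
pose g (y : E) : R^o := f (s *: v + y) - f y.
have shd (y : E) : is_diff y (fun z => s *: v + z) id.
  by have := is_diffD (is_diff_cst (s *: v) y) (is_diff_id y); rewrite add0r.
have gd a : 0 <= a <= 1 ->
    is_diff (a *: (s *: u) + x) g (fun w => 'd f (s *: v + (a *: (s *: u) + x)) w
                                          - 'd f (a *: (s *: u) + x) w).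
  move=> a01; have := smooth_at_differentiable (smo _ _ a01 o01); rewrite scale1r => d1.
  have := smooth_at_differentiable (smo _ _ a01 z01); rewrite scale0r add0r => d0.
  have d2 : is_diff (a *: (s *: u) + x) (f \o (fun z => s *: v + z))
     ('d f (s *: v + (a *: (s *: u) + x)) \o id).
    by apply: is_diff_comp; apply: differentiableP.
  by apply: is_diffB => //; exact: differentiableP.
have [a a01 ga] : exists2 c, 0 <= c <= 1 &
    g (s *: u + x) - g x = 'D_(s *: u) g (c *: (s *: u) + x).
  by apply: MVT_line => t t01; have [] := gd _ t01.
have gs := gd _ a01.
have [b b01 fb] : exists2 c, 0 <= c <= 1 &
    'D_u f (s *: v + (a *: (s *: u) + x)) - 'D_u f (a *: (s *: u) + x)
    = 'D_(s *: v) ('D_u f) (c *: (s *: v) + (a *: (s *: u) + x)).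
  apply: (MVT_line (f := 'D_u f)) => t t01.
  exact: (smooth_at_differentiable (smooth_at_D u (smo _ _ a01 t01))).
exists (b *: (s *: v) + (a *: (s *: u) + x)); first exact: inb.
have := smooth_at_differentiable (smo _ _ a01 o01); rewrite scale1r => d1.
have := smooth_at_differentiable (smo _ _ a01 z01); rewrite scale0r add0r => d0.
have -> : f (s *: u + (s *: v + x)) - f (s *: u + x) - (f (s *: v + x) - f x) =
   g (s *: u + x) - g x by rewrite /g addrCA.
rewrite ga; have [gd1 gd2] := gs.
have -> : 'D_(s *: u) g (a *: (s *: u) + x) =
    s * ('D_u f (s *: v + (a *: (s *: u) + x)) - 'D_u f (a *: (s *: u) + x)).
  by rewrite (deriveE _ gd1) gd2 (deriveE u d1) (deriveE u d0) mulrBr !linearZ.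
rewrite fb derive_scale; first by rewrite expr2 -mulrA.
by apply: smooth_at_differentiable; apply: smooth_at_D; exact: smo.
Qed.

Lemma dist_le_half (a b c e : R) :
  `|a - c| <= e / 2 -> `|b - c| <= e / 2 -> `|a - b| <= e.
Proof. by rewrite !ler_norml; lra. Qed.

(** The second difference is symmetric in u and v. Hence D_v D_u f at one point equals D_u D_v f at
    another, both as close to x as desired, and continuity of the two second derivatives
    concludes. *)
Lemma derive_comm_real {E} (f : E -> R^o) (x u v : E) :
  smooth_at f x -> 'D_u ('D_v f) x = 'D_v ('D_u f) x.
Proof.
move=> fs; apply/eqP; rewrite -subr_eq0 -normr_le0; apply/ler_addgt0Pr => e e0; rewrite add0r.
have e20 : 0 < e / 2 by rewrite divr_gt0.
have c1 := smooth_at_continuous (smooth_at_D u (smooth_at_D v fs)).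
have c2 := smooth_at_continuous (smooth_at_D v (smooth_at_D u fs)).
have n0 := smooth_at_near fs.
have /cvgrPdist_lt/(_ _ e20) n1 := c1.
have /cvgrPdist_lt/(_ _ e20) n2 := c2.
have n3 := @filterI _ _ (nbhs_filter x) _ _ n0 (@filterI _ _ (nbhs_filter x) _ _ n1 n2).
have [r /= r0 rs] := (nbhs_ballP x _).1 n3.
(* This keeps the whole parallelogram in the ball of radius r; the summand 1 makes the denominator
   positive when u = v = 0. *)
pose s := r / 2 / (`|u| + `|v| + 1).
have nt0 : 0 < `|u| + `|v| + 1 by rewrite ltr_wpDl// addr_ge0.
have s0 : 0 < s by rewrite !divr_gt0.
have sr : s * (`|u| + `|v|) < r.
  rewrite /s mulrAC ltr_pdivrMr// (@le_lt_trans _ _ (r / 2 * (`|u| + `|v| + 1)))//.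
    by rewrite ler_pM2l ?divr_gt0// lerDl.
  by rewrite ltr_pM2r// ltr_pdivrMr// ltr_pMr// ltr1n.
have fb y : ball x r y -> smooth_at f y by move=> /rs[].
have [y yx E1] := second_difference s0 sr fb.
have sr' : s * (`|v| + `|u|) < r by rewrite [`|v| + _]addrC.
have [z zx E2] := second_difference s0 sr' fb.
have yb : ball x r y by rewrite -ball_normE /ball_/=; exact: le_lt_trans yx sr.
have zb : ball x r z by rewrite -ball_normE /ball_/=; exact: le_lt_trans zx sr'.
have yz : 'D_v ('D_u f) y = 'D_u ('D_v f) z.
  apply: (@mulfI _ (s ^+ 2)); first by rewrite expf_neq0// gt_eqF.
  have exch (p q r' t : R) : p - q - (r' - t) = p - r' - (q - t) by ring.
  apply: etrans (esym E1) (etrans _ E2).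
  by rewrite (addrCA (s *: v) (s *: u) x); exact: exch.
have [_ [_ yv]] := rs _ yb; have [_ [zu _]] := rs _ zb.
pose A : R := 'D_u ('D_v f) x; pose B : R := 'D_v ('D_u f) x.
have zA : `|A - 'D_u ('D_v f) z| <= e / 2 by apply: ltW; exact: zu.
have yB : `|B - 'D_u ('D_v f) z| <= e / 2 by rewrite -yz; apply: ltW; exact: yv.
exact: dist_le_half zA yB.
Qed.

Lemma derive_linear {E F H : normedModType R} (f : E -> F) (l : {linear F -> H}) (x u : E) :
  continuous l -> differentiable f x -> 'D_u (fun y => l (f y)) x = l ('D_u f x).
Proof.
move=> lc fd; have dl := linear_differentiable (f x) lc.
have dlf : differentiable (l \o f) x by exact: differentiable_comp.
by rewrite (deriveE u dlf) (deriveE u fd) (diff_comp fd dl) /= diff_lin.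
Qed.

Lemma derive_comm {E F} {hF : FinDim F} (f : E -> F) (x u v : E) :
  smooth_at f x -> 'D_u ('D_v f) x = 'D_v ('D_u f) x.
Proof.
move=> fs; have [N [e [c [cc ce]]]] := hF.
apply: etrans (ce _) (etrans _ (esym (ce _))); apply: eq_bigr => i _.
apply: (f_equal (fun a : R => a *: e i)).
have cs : smooth_at (fun y => c i (f y)) x.
  by apply: smooth_at_comp fs _; apply: smooth_at_linear => a y z; rewrite linearP.
have D a b : c i ('D_a ('D_b f) x) = 'D_a ('D_b (fun y => c i (f y))) x.
  rewrite -derive_linear//; last exact: smooth_at_differentiable (smooth_at_D _ fs).
  apply: near_eq_derive; have fn := smooth_at_near fs.
  by apply: filterS fn => y fy; rewrite derive_linear//; exact: smooth_at_differentiable.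
by rewrite !D; exact: derive_comm_real.
Qed.

End mean_value.

(** Matrices are registered as complete, as Banach's fixed point theorem requires. *)
HB.instance Definition _ (R : realType) (m n : nat) := Complete.on 'M[R]_(m, n).

(** * Inverse function theorem *)

Section inverse_function.
Context {R : realType}.

Lemma ler_norm_coord m (u : 'rV[R]_m) i : `|u 0 i| <= `|u|.
Proof.
rewrite [leRHS]/Num.Def.normr/= mx_normrE.
exact: (@le_bigmax _ _ _ 0 (fun ij : 'I_1 * 'I_m => `|u ij.1 ij.2|) (0, i)).
Qed.

Lemma norm_coord_le m (u : 'rV[R]_m) e : 0 <= e -> (forall i, `|u 0 i| <= e) -> `|u| <= e.
Proof.
move=> e0 ue; rewrite [leLHS]/Num.Def.normr/= mx_normrE bigmax_le// => -[i j] _ /=.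
by rewrite ord1; exact: ue.
Qed.

Lemma ball_convex {E : normedModType R} (x0 x y : E) r t : 0 <= t <= 1 ->
  ball x0 r x -> ball x0 r y -> ball x0 r (t *: (x - y) + y).
Proof.
move=> /andP[t0 t1]; rewrite -!ball_normE /ball_/= => xr yr.
have -> : x0 - (t *: (x - y) + y) = t *: (x0 - x) + (1 - t) *: (x0 - y).
  rewrite scalerBl scale1r addrCA -scalerBr opprB [x0 - x + _]addrC addrA subrK.
  by rewrite opprD -scalerN opprB [_ - y]addrC addrA.
rewrite (le_lt_trans (ler_normD _ _))// !normrZ (ger0_norm t0) ger0_norm ?subr_ge0//.
move: t0; rewrite le_eqVlt => /orP[/eqP<-|t0]; first by rewrite mul0r add0r subr0 mul1r.
have : t * `|x0 - x| < t * r by rewrite ltr_pM2l.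
have : (1 - t) * `|x0 - y| <= (1 - t) * r by rewrite ler_wpM2l ?subr_ge0// ltW.
lra.
Qed.

Lemma derive_row_sum {F : normedModType R} m (f : 'rV[R]_m -> F) (x u : 'rV[R]_m) :
  differentiable f x -> 'D_u f x = \sum_i u 0 i *: 'D_(delta_mx 0 i) f x.
Proof.
move=> fd; rewrite deriveE// {1}[u]row_sum_delta linear_sum.
by apply: eq_bigr => i _; rewrite linearZ deriveE.
Qed.

(** The partial derivatives vanish at x0, hence are small nearby; the mean value theorem on
    segments, one coordinate at a time, turns this into a Lipschitz bound for the sup norm. *)
Lemma small_diff_lipschitz m p (phi : 'rV[R]_m -> 'rV[R]_p) x0 (eps : R) : 0 < eps ->
  smooth_at phi x0 -> (forall v, 'd phi x0 v = 0) ->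
  exists r : R, [/\ 0 < r, forall z, ball x0 r z -> smooth_at phi z &
    forall x y, ball x0 r x -> ball x0 r y -> `|phi x - phi y| <= eps * `|x - y|].
Proof.
(* The m partial derivatives, each below e, contribute at most m * e <= eps; the successor keeps the
   quotient meaningful for m = 0. *)
move=> e0 ps p0; pose e := eps / m.+1%:R.
have epos : 0 < e by rewrite divr_gt0.
have near_small : \forall z \near x0, forall i : 'I_m, `|'D_(delta_mx 0 i) phi z| < e.
  apply: (@filter_forall _ _ (fun (i : 'I_m) z => `|'D_(delta_mx 0 i) phi z| < e) _ (nbhs_filter x0)) => i.
  have pc := smooth_at_continuous (smooth_at_D (delta_mx 0 i) ps).
  have /cvgrPdist_lt/(_ _ epos) := pc.
  apply: filterS => z; rewrite [X in `|X - _|]deriveE ?p0 ?sub0r ?normrN//.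
  exact: smooth_at_differentiable.
have nps := @filterI _ _ (nbhs_filter x0) _ _ (smooth_at_near ps) near_small.
have [r /= r0 rs] := (nbhs_ballP x0 _).1 nps.
exists r; split => // [z /rs[]//|x y xr yr].
apply: norm_coord_le => [|j]; first by rewrite mulr_ge0// ltW.
have line t : 0 <= t <= 1 -> smooth_at phi (t *: (x - y) + y).
  by move=> t01; have [] := rs _ (ball_convex t01 xr yr).
have [t t01] : exists2 c, 0 <= c <= 1 &
  (phi ((x - y) + y) 0 j : R^o) - phi y 0 j
     = 'D_(x - y) (fun z => phi z 0 j : R^o) (c *: (x - y) + y).
  apply: (MVT_line (f := fun z => phi z 0 j : R^o)) => t t01.
  exact: smooth_at_differentiable (smooth_at_coord _ _ (line _ t01)).
rewrite subrK !mxE => ->.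
have dl := smooth_at_differentiable (line _ t01).
have [_ sm] := rs _ (ball_convex t01 xr yr).
have -> : 'D_(x - y) (fun z => phi z 0 j : R^o) (t *: (x - y) + y) =
          ('D_(x - y) phi (t *: (x - y) + y)) 0 j.
  by rewrite derive_mx ?mxE//; exact: diff_derivable.
rewrite (derive_row_sum _ dl) summxE (le_trans (ler_norm_sum _ _ _))//.
apply: (@le_trans _ _ (\sum_(i < m) e * `|x - y|)).
  apply: ler_sum => i _; rewrite mxE normrM mulrC ler_pM//.
    by rewrite (le_trans (ler_norm_coord _ _))// ltW.
  exact: ler_norm_coord.
rewrite sumr_const card_ord -mulr_natr mulrAC ler_wpM2r//.
by rewrite /e -mulrA ler_piMr ?(ltW e0)// mulrC ler_pdivrMr// mul1r ler_nat.
Qed.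

End inverse_function.

Section inverse_function.
Context {R : realType}.

Lemma jacobianE m p (F : 'rV[R]_m -> 'rV[R]_p) x u : 'd F x u = u *m 'J F x.
Proof. by rewrite /jacobian mul_rV_lin1. Qed.

Lemma smooth_at_jacobian m p (F : 'rV[R]_m -> 'rV[R]_p) x :
  smooth_at F x -> smooth_at (fun y => 'J F y) x.
Proof.
move=> Fs; apply: smooth_at_mx => i j.
apply: (@smooth_at_eq _ _ _ (fun y => ('D_(delta_mx 0 i) F y) 0 j : R^o)).
  apply: filterS (smooth_at_near Fs) => y /smooth_at_differentiable Fy.
  by rewrite deriveE// mxE.
apply: smooth_at_coord; exact: smooth_at_D.
Qed.

(** The map x |-> y + phi x sends the closed ball of radius r to itself: r/2 comes from the
    displacement of the centre and r/2 from the Lipschitz constant. With phi = id - F its fixed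
    points are the solutions of F x = y. *)
Lemma banach_solve m (phi : 'rV[R]_m -> 'rV[R]_m) x0 (r : R) y : 0 <= r ->
  (forall x x', `|x0 - x| <= r -> `|x0 - x'| <= r -> `|phi x - phi x'| <= 2^-1 * `|x - x'|) ->
  `|y + phi x0 - x0| <= r / 2 -> exists2 x, `|x0 - x| <= r & x = y + phi x.
Proof.
move=> r0 lip yr; pose U := [set x : 'rV[R]_m | `|x0 - x| <= r].
pose T x := y + phi x.
have UT : {homo T : x / U x >-> U x}.
  move=> x Ux; rewrite /U /= /T.
  have -> : x0 - (y + phi x) = - (y + phi x0 - x0) + (phi x0 - phi x).
    by rewrite opprB !opprD -!addrA addKr.
  rewrite (le_trans (ler_normD _ _))// normrN [leRHS](splitr r) lerD//.
  have xx : `|x0 - x0| <= r by rewrite subrr normr0.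
  by rewrite (le_trans (lip _ _ xx Ux))// mulrC ler_wpM2r//.
have cT : is_contraction (mkfun_fun UT).
  exists (2^-1)%:nng; split => /=; first by rewrite invf_lt1// ltr1n.
  by move=> [a b] [/= Ua Ub]; rewrite /T opprD addrACA subrr add0r; exact: lip.
have cU : closed U by exact: closed_closed_ball_.
have U0 : U !=set0 by exists x0; rewrite /U/= subrr normr0.
by have [p Up pT] := banach_fixed_point cT cU U0; exists p.
Qed.

(** Since the differential at x0 is the identity, phi = id - F has zero differential there and
    contracts by 1/2 on a small ball, which gives existence and uniqueness of preimages. *)
Lemma inverse_function m (F : 'rV[R]_m -> 'rV[R]_m) x0 : smooth_at F x0 ->
  (forall v, 'd F x0 v = v) ->
  exists G, [/\ smooth_at G (F x0), G (F x0) = x0,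
                \forall y \near F x0, F (G y) = y & \forall x \near x0, G (F x) = x].
Proof.
move=> Fs dF; pose phi x := x - F x.
have phis : smooth_at phi x0.
  by apply: smooth_atDr; [exact: (smooth_at_linear (l := id))|exact: smooth_atN].
have Fd := smooth_at_differentiable Fs.
have dphi v : 'd phi x0 v = 0.
  have d1 := differentiableP Fd.
  have [_ ->] := @is_diffB _ _ _ id F id ('d F x0) x0 (is_diff_id x0) d1.
  by rewrite !fctE dF subrr.
have half0 : 0 < (2^-1 : R) by rewrite invr_gt0.
have [r1 [r10 phir1 lip]] := small_diff_lipschitz half0 phis dphi.
have Js := smooth_at_jacobian Fs.
have J0 : 'J F x0 = 1%:M by apply/row_matrixP => i; rewrite !rowE -jacobianE dF mulmx1.
have Jn : \forall x \near x0, 'J F x \in unitmx.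
  have dc := smooth_at_continuous (smooth_at_det Js).
  have d0 : \det ('J F x0) != 0 by rewrite J0 det1 oner_neq0.
  have dn : \forall x \near x0, \det ('J F x) != 0.
    exact: (@cvgr_neq0 _ _ _ _ _ (fun y => \det ('J F y)) (\det ('J F x0)) dc d0).
  by apply: filterS dn => x dx; rewrite unitmxE unitfE.
have [r2 /= r20 r2s] := (nbhs_ballP x0 _).1 (@filterI _ _ (nbhs_filter x0) _ _ Jn (smooth_at_near Fs)).
pose r := Num.min r1 r2 / 2.
have r0 : 0 < r by rewrite divr_gt0// lt_min r10.
have rr1 : r < r1.
  by rewrite /r ltr_pdivrMr// (@le_lt_trans _ _ r1)// ?ge_min ?lexx// ltr_pMr// ltr1n.
have rr2 : r < r2.
  by rewrite /r ltr_pdivrMr// (@le_lt_trans _ _ r2)// ?ge_min ?lexx ?orbT// ltr_pMr// ltr1n.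
pose U x := `|x0 - x| <= r.
have Ub1 x : U x -> ball x0 r1 x by move=> Ux; rewrite -ball_normE; exact: le_lt_trans rr1.
have Ub2 x : U x -> ball x0 r2 x by move=> Ux; rewrite -ball_normE; exact: le_lt_trans rr2.
have Ulip x x' : U x -> U x' -> `|phi x - phi x'| <= 2^-1 * `|x - x'|.
  by move=> /Ub1 bx /Ub1 bx'; exact: lip.
pose B := ball (F x0) (r / 2).
have solve y : B y -> exists x, U x /\ F x = y.
  rewrite /B -ball_normE /= => yb.
  have [|x Ux xE] := banach_solve (ltW r0) Ulip (y := y).
    by rewrite /phi addrCA [x0 + _]addrC addrK distrC ltW.
  exists x; split => //; apply/eqP; move/eqP: xE; rewrite /phi addrCA.
  by rewrite -[X in X == _]addr0 (inj_eq (addrI x)) eq_sym subr_eq0 eq_sym.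
(* Outside the image of the ball the default value x0 is taken; all statements about G are
   restricted to B. *)
pose G y := xget x0 [set x | U x /\ F x = y].
have GP y : B y -> U (G y) /\ F (G y) = y by move=> /solve By; exact: (xgetPex x0 By).
(* As phi contracts by 1/2, F shrinks distances by at most 1/2; this gives both injectivity of F on
   U and the Lipschitz constant 2 of G. *)
have Uexp x x' : U x -> U x' -> `|x - x'| <= 2 * `|F x - F x'|.
  move=> Ux Ux'; have := Ulip _ _ Ux Ux'.
  have -> : x - x' = (phi x - phi x') + (F x - F x').
    by rewrite addrACA /phi subrK -opprD subrK.
  move=> lp; have := ler_normD (phi x - phi x') (F x - F x'); lra.
have Glip y y' : B y -> B y' -> `|G y - G y'| <= 2 * `|y - y'|.
  move=> /GP[Uy {2}<-] /GP[Uy' {2}<-]; exact: Uexp.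
have oB : open B by exact: ball_open.
have G0 : G (F x0) = x0.
  have B0 : B (F x0) by apply: ballxx; rewrite divr_gt0.
  have [UG FG] := GP _ B0.
  have U0 : U x0 by rewrite /U subrr normr0 ltW.
  apply/eqP; rewrite -subr_eq0 -normr_le0.
  by have := Uexp _ _ UG U0; rewrite FG subrr normr0 mulr0.
have GJ y : B y -> 'J F (G y) \in unitmx by move=> /GP[/Ub2/r2s[]].
have GFs y : B y -> smooth_at F (G y) by move=> /GP[/Ub2/r2s[]].
have dG y : B y -> is_diff y G (mulmxr (invmx ('J F (G y)))).
  move=> By; have [Ux FG] := GP _ By; have Jx := GJ _ By.
  pose l : {linear 'rV[R]_m -> 'rV[R]_m} := mulmxr (invmx ('J F (G y))).
  have lc : continuous l by apply: linear_continuous_findim.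
  have [C C0 Cl] := linear_lipschitz lc.
  have Fdx := smooth_at_differentiable (GFs _ By).
  have Go : G \o shift y = cst (G y) + l +o_ 0 id.
    apply/eqaddoP => e e0.
    (* C bounds the inverse differential [l] and 2 is the Lipschitz constant of G, so that an error
       e/(2C) |k| of F at G y becomes an error e |h| of G. *)
    have e'0 : 0 < e / (2 * C) by rewrite divr_gt0// mulr_gt0.
    have /eqaddoP/(_ _ e'0) := diff_locally Fdx.
    move=> /nbhs_ballP[d /= d0 dF'].
    have nB : \forall h \near (0 : 'rV[R]_m), B (h + y).
      have : \forall z \near y, B z by exact: open_nbhs_nbhs.
      by rewrite (near_shift 0)/=; apply: filterS => z /=; rewrite subr0.
    have nd : \forall h \near (0 : 'rV[R]_m), ball 0 (d / 2) h.
      by apply: nbhsx_ballx; rewrite divr_gt0.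
    apply: filterS2 nB nd => h Bh; rewrite -ball_normE /= sub0r normrN => hd.
    rewrite !fctE /=.
    pose k := G (h + y) - G y.
    have kh : `|k| <= 2 * `|h| by have := Glip _ _ Bh By; rewrite addrK.
    have := dF' k; rewrite -ball_normE /= sub0r normrN !fctE /= subrK FG.
    have [_ ->] := GP _ Bh; rewrite opprD addrA addrK jacobianE => kF.
    have {kF} : `|h - k *m 'J F (G y)| <= e / (2 * C) * `|k|.
      by apply: kF; rewrite (le_lt_trans kh)// mulrC -ltr_pdivlMr.
    have -> : G (h + y) - (G y + h *m invmx ('J F (G y))) =
              - l (h - k *m 'J F (G y)).
      by rewrite /l /= mulmxBl mulmxK// opprB opprD addrA.
    rewrite normrN => hk; rewrite (le_trans (Cl _))//.
    have -> : e * `|h| = C * (e / (2 * C) * (2 * `|h|)).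
      by field; rewrite gt_eqF.
    rewrite ler_pM2l// (le_trans hk)// ler_pM2l//.
  have dGl := diff_unique lc Go.
  by apply: DiffDef => //; apply/diff_locallyP; rewrite dGl.
have BG y : B y -> ball x0 r2 (G y) by move=> /GP[/Ub2].
(* Bootstrapping: the derivative of G is an expression in G through the inverse Jacobian, hence as
   regular as G. *)
have GB k : Ck_on k B G.
  elim: k => [|k IH].
    by move=> y By; apply: differentiable_continuous; have [] := dG _ By.
  split=> [y By|v]; first by have [] := dG _ By.
  apply: (@Ck_on_eq _ _ _ _ _ ((fun x => v *m invmx ('J F x)) \o G)) => // [y By|].
    by have [Gd dGy] := dG _ By; rewrite (deriveE v Gd) dGy.
  apply: (Ck_on_comp (V := ball x0 r2)) => //; first exact: ball_open.
  apply: Ck_on_pointwise => z /r2s[Jz Fz].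
  apply: (nbhs_singleton (_ : smooth_at (fun x => v *m invmx ('J F x)) z)).
  apply: smooth_at_mulmx; first exact: smooth_at_cst.
  by apply: smooth_at_invmx => //; exact: smooth_at_jacobian.
have B0 : B (F x0) by apply: ballxx; rewrite divr_gt0.
exists G; split => //.
- by apply/smooth_at_openP; exists B.
- by apply: filterS (open_nbhs_nbhs (conj oB B0)) => y /GP[].
- have nB : \forall x \near x0, B (F x).
    exact: (smooth_at_continuous Fs (open_nbhs_nbhs (conj oB B0))).
  apply: filterS2 nB (nbhsx_ballx x0 r r0) => x Bx.
  rewrite -ball_normE /= => /ltW Ux; have [UG FG] := GP _ Bx.
  apply/eqP; rewrite -subr_eq0 -normr_le0.
  by have := Uexp _ _ UG Ux; rewrite FG subrr normr0 mulr0.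
Qed.
End inverse_function.

(** * Constant rank theorem *)

Section constant_rank.
Context {R : realType}.

Lemma near_continuous (T U : topologicalType) (f : T -> U) x y (A : set U) :
  {for x, continuous f} -> f x = y -> nbhs y A -> \forall z \near x, A (f z).
Proof. by move=> fc <-; exact: fc. Qed.

Lemma derive_mulmxr {E : normedModType R} m n p (g : E -> 'M[R]_(m, n)) (P : 'M[R]_(n, p)) z w :
  differentiable g z -> 'D_w (fun y => g y *m P) z = 'D_w g z *m P.
Proof.
move=> gd; pose l : {linear 'M[R]_(m, n) -> 'M[R]_(m, p)} := mulmxr P.
have lc : continuous l by apply: linear_continuous_findim.
exact: (derive_linear _ lc gd).
Qed.

Lemma segment_cst {E : normedModType R} {m} (g : E -> 'rV[R]_m) y0 d x y :
  ball y0 d x -> ball y0 d y ->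
  (forall z, ball y0 d z -> smooth_at g z /\ 'D_(x - y) g z = 0) -> g x = g y.
Proof.
move=> xd yd gz; apply/rowP => j; apply/eqP; rewrite -subr_eq0; apply/eqP.
have line t : 0 <= t <= 1 -> ball y0 d (t *: (x - y) + y).
  by move=> t01; exact: ball_convex.
have [t t01] : exists2 c, 0 <= c <= 1 &
  (g ((x - y) + y) 0 j : R^o) - g y 0 j
     = 'D_(x - y) (fun z => g z 0 j : R^o) (c *: (x - y) + y).
  apply: (MVT_line (f := fun z => g z 0 j : R^o)) => t t01.
  apply: smooth_at_differentiable; apply: smooth_at_coord.
  by have [] := gz _ (line _ t01).
rewrite subrK => ->; have [gs g0] := gz _ (line _ t01).
have gd := smooth_at_differentiable gs.
have -> : 'D_(x - y) (fun z => g z 0 j : R^o) (t *: (x - y) + y) =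
          ('D_(x - y) g (t *: (x - y) + y)) 0 j.
  by rewrite derive_mx ?mxE//; exact: diff_derivable.
by rewrite g0 mxE.
Qed.

(** Invertibility of D A P forces A P to have rank at least r, while its rank is that of A minus the
    dimension of the intersection of the row space of A with the kernel of P. So this intersection,
    which contains v A, is zero. *)
Lemma kernel_of_rank_le N M r (A : 'M[R]_(N, M)) (P : 'M[R]_(M, r)) (D : 'M[R]_(r, N)) v :
  D *m (A *m P) \in unitmx -> (\rank A <= r)%N -> v *m A *m P = 0 -> v *m A = 0 :> 'rV_M.
Proof.
move=> DAP Ar vAP; have rAP : (r <= \rank (A *m P))%N.
  by have := mxrankM_maxr D (A *m P); rewrite (mxrank_unit DAP).
have := mxrank_mul_ker A P => rk.
have k0 : \rank (A :&: kermx P)%MS = 0%N.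
  by apply/eqP; rewrite -leqn0 -(leq_add2l (\rank (A *m P))) rk addn0 (leq_trans Ar).
apply/eqP; rewrite -submx0; apply: (@submx_trans _ _ _ _ _ _ (A :&: kermx P)%MS).
  by rewrite sub_capmx submxMl /=; apply/sub_kermxP.
by rewrite submx0 -mxrank_eq0 k0.
Qed.

(* Straightening f by F = x - x C D + f(x) P D, whose differential at x0 is the identity. *)
Lemma constant_rank N M (f : 'rV[R]_N -> 'rV[R]_M) x0 (r := \rank ('J f x0)) :
  smooth_at f x0 -> (\forall x \near x0, (\rank ('J f x) <= r)%N) ->
  exists (P : 'M[R]_(M, r)) (s : 'rV[R]_r -> 'rV[R]_N) (e : R) (W : set 'rV[R]_N),
    [/\ 0 < e /\ open_nbhs x0 W,
        s (f x0 *m P) = x0,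
        forall c, ball (f x0 *m P) e c ->
          [/\ smooth_at s c, W (s c) & f (s c) *m P = c] &
        forall x, W x -> ball (f x0 *m P) e (f x *m P) /\ f (s (f x *m P)) = f x].
Proof.
move=> fs frk; set J := 'J f x0 in r frk *.
(* From the full-rank factorization J = [col_base J] * [row_base J]: C is the first factor, D a left
   inverse of it, and P a right inverse of the second. *)
have [C [P [D [DC JP]]]] : exists (C : 'M[R]_(N, r)) (P : 'M[R]_(M, r)) (D : 'M[R]_(r, N)),
    D *m C = 1%:M /\ J *m P = C.
  exists (col_base J), (pinvmx (row_base J)), (pinvmx (col_base J)); split.
    by apply: mulVpmx; exact: col_base_full.
  have -> : J *m pinvmx (row_base J) = col_base J *m row_base J *m pinvmx (row_base J).
    by rewrite mulmx_base.
  by rewrite -mulmxA mulmxVp ?mulmx1// row_base_free.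
pose F x := x *m (1%:M - C *m D) + f x *m (P *m D).
have fd := smooth_at_differentiable fs.
have Fs : smooth_at F x0.
  apply: smooth_atDr; apply: smooth_at_mulmx => //; try exact: smooth_at_cst.
  exact: (smooth_at_linear (l := id)).
have dF v : 'd F x0 v = v.
  rewrite -deriveE; last exact: smooth_at_differentiable.
  have d1 : differentiable (fun x => x *m (1%:M - C *m D)) x0.
    apply: smooth_at_differentiable; apply: smooth_at_mulmx; last exact: smooth_at_cst.
    exact: (smooth_at_linear (l := id)).
  have d2 : differentiable (fun x => f x *m (P *m D)) x0.
    by apply: smooth_at_differentiable; apply: smooth_at_mulmx => //; exact: smooth_at_cst.
  have -> : 'D_v F x0 = 'D_v (fun x => x *m (1%:M - C *m D)) x0
                      + 'D_v (fun x => f x *m (P *m D)) x0.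
    by apply: deriveD; exact: diff_derivable.
  rewrite (@derive_mulmxr _ _ _ _ id)// derive_mulmxr// derive_id deriveE// jacobianE.
  by rewrite -/J -(mulmxA v) (mulmxA J) JP mulmxBr mulmx1 subrK.
have [G [Gs G0 FG GF]] := inverse_function Fs dF.
(* As D C = 1, the factor 1 - C D is killed by C and only the term in f survives. *)
have FC x : F x *m C = f x *m P.
  by rewrite /F mulmxDl -!mulmxA mulmxBl mul1mx -!mulmxA DC !mulmx1 subrr mulmx0 add0r.
set c0 := f x0 *m P; set y0 := F x0 in Gs G0 FG.
have y0C : y0 *m C = c0 by rewrite /y0 FC.
(* Near x0 the rank of J is r, so that multiplication by P does not enlarge its kernel. *)
pose K x := smooth_at f x /\ forall v : 'rV[R]_N, v *m 'J f x *m P = 0 -> v *m 'J f x = 0.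
have ker_near : \forall x \near x0, K x.
  have ds : smooth_at (fun x => \det (D *m ('J f x *m P)) : R^o) x0.
    apply: smooth_at_det; apply: smooth_at_mulmx; first exact: smooth_at_cst.
    by apply: smooth_at_mulmx; [exact: smooth_at_jacobian|exact: smooth_at_cst].
  have d0 : \det (D *m ('J f x0 *m P)) != 0 by rewrite -/J JP DC det1 oner_neq0.
  have dn : \forall x \near x0, \det (D *m ('J f x *m P)) != 0.
    exact: (@cvgr_neq0 _ _ _ _ _ (fun y => \det (D *m ('J f y *m P)))
      (\det (D *m ('J f x0 *m P))) (smooth_at_continuous ds)).
  apply: (@filterS3 _ _ (nbhs_filter x0) _ _ _ _ _ (smooth_at_near fs) frk dn) => x fx rx dx; split => // v.
  by apply: (kernel_of_rank_le (D := D)) => //; rewrite unitmxE unitfE.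
have G_near : \forall y \near y0, [/\ F (G y) = y, smooth_at G y & K (G y)].
  have kn := near_continuous (smooth_at_continuous Gs) G0 ker_near.
  by apply: (@filterS3 _ _ (nbhs_filter y0) _ _ _ _ _ FG (smooth_at_near Gs) kn) => y.
have [d /= d0 dG] := (nbhs_ballP y0 _).1 G_near.
have level z : ball y0 d z -> f (G z) *m P = z *m C.
  by move=> /dG[Fz _ _]; rewrite -FC Fz.
(* Times P, the map f o G is z |-> z C, whose derivative along w is w C = 0; near x0 the factor P
   can be cancelled because it loses nothing on the image of the Jacobian. *)
have flat z w : ball y0 d z -> w *m C = 0 -> smooth_at (f \o G) z /\ 'D_w (f \o G) z = 0.
  move=> zd wC; have [_ Gz [fz kz]] := dG _ zd.
  have fGs : smooth_at (f \o G) z by exact: (smooth_at_comp Gz fz).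
  split => //; have fGd := smooth_at_differentiable fGs.
  have fGz := smooth_at_differentiable fz; have Gzd := smooth_at_differentiable Gz.
  have DE : 'D_w (f \o G) z = 'd G z w *m 'J f (G z).
    by rewrite deriveE// diff_comp//= jacobianE.
  rewrite DE; apply: kz; rewrite -DE -derive_mulmxr//.
  have -> : 'D_w (fun y => (f \o G) y *m P) z = 'D_w (fun y => y *m C) z.
    apply: near_eq_derive; have zn : nbhs z (ball y0 d) by exact: open_nbhs_nbhs (conj (ball_open _ _) zd).
    by apply: filterS zn => y yd; rewrite /= level.
  by rewrite (@derive_mulmxr _ _ _ _ id)// derive_id.
(* The affine section of z |-> z C through y0. The points [proj (f x *m P)] and F x differ by an
   element of the kernel of C, along which f o G is constant. *)
pose proj c := y0 + (c - c0) *m D.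
pose s c := G (proj c).
have claim x : ball y0 d (F x) -> ball y0 d (proj (f x *m P)) ->
    (f \o G) (proj (f x *m P)) = (f \o G) (F x).
  move=> Fxb pxb.
  have wC : (proj (f x *m P) - F x) *m C = 0.
    by rewrite mulmxBl /proj mulmxDl FC y0C -mulmxA DC mulmx1 [c0 + _]addrC subrK subrr.
  by apply: (segment_cst pxb Fxb) => z zb; exact: flat.
have projs c : smooth_at proj c.
  apply: smooth_atDr; first exact: smooth_at_cst.
  apply: smooth_at_mulmx; last exact: smooth_at_cst.
  apply: smooth_atDr; last exact: smooth_at_cst.
  exact: (smooth_at_linear (l := id)).
have proj0 : proj c0 = y0 by rewrite /proj subrr mul0mx addr0.
have s0 : s c0 = x0 by rewrite /s proj0 G0.
have fPs : smooth_at (fun x => f x *m P) x0.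
  by apply: smooth_at_mulmx => //; exact: smooth_at_cst.
have y0d : nbhs y0 (ball y0 d) by exact: nbhsx_ballx.
have n1 : \forall x \near x0, ball y0 d (F x) by exact: near_continuous (smooth_at_continuous Fs) erefl y0d.
have n2 : \forall c \near c0, ball y0 d (proj c).
  exact: near_continuous (smooth_at_continuous (projs c0)) proj0 y0d.
have n3 : \forall x \near x0, ball y0 d (proj (f x *m P)).
  exact: near_continuous (smooth_at_continuous fPs) erefl n2.
have n5 : nbhs x0 [set x | [/\ G (F x) = x, ball y0 d (F x) & ball y0 d (proj (f x *m P))]].
  by apply: (@filterS3 _ _ (nbhs_filter x0) _ _ _ _ _ GF n1 n3) => x.
have := @filterI _ _ (nbhs_filter x0) _ _ n5 (smooth_at_near fs).
rewrite nbhsE => -[W0 [oW0 W0x] W0P].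
have sc : {for c0, continuous s}.
  apply: smooth_at_continuous; apply: (smooth_at_comp (projs c0)).
  by rewrite proj0.
have n4 : \forall c \near c0, W0 (s c).
  exact: near_continuous sc s0 (open_nbhs_nbhs (conj oW0 W0x)).
have [e /= e0 eP] := (nbhs_ballP c0 _).1 (@filterI _ _ (nbhs_filter c0) _ _ n2 n4).
have fc x : W0 x -> {for x, continuous (fun x => f x *m P)}.
  move=> /W0P[_ fx]; apply: smooth_at_continuous.
  by apply: smooth_at_mulmx => //; exact: smooth_at_cst.
exists P, s, e, (W0 `&` (fun x => f x *m P) @^-1` ball c0 e); split.
- split => //; split; last by split => //; exact: ballxx.
  rewrite openE => x [Wx bx]; apply: (@filterI _ _ (nbhs_filter x)).
    exact: open_nbhs_nbhs.
  by apply: (fc _ Wx); exact: open_nbhs_nbhs (conj (ball_open _ _) bx).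
- exact: s0.
- move=> c cb; have [pc sW] := eP _ cb; have [_ Gpc _] := dG _ pc.
  have sP : f (s c) *m P = c.
    rewrite /s level// /proj mulmxDl y0C -mulmxA DC mulmx1.
    by rewrite addrC subrK.
  split => //; first by apply: (smooth_at_comp (projs c)).
  by split => //=; rewrite sP.
- move=> x [/W0P[[GFx Fxb pxb] _] bx]; split => //.
  by have := claim _ Fxb pxb; rewrite /= GFx.
Qed.

End constant_rank.

(** * Manifolds and differential forms *)

Section manifolds.
Context {R : realType}.
Implicit Types E F H : normedModType R.
Implicit Types M N : topologicalType.

(** The local conditions of [is_manifold], on which the differential calculus rests and which
    products inherit factor by factor. *)
Definition is_atlas {E M} (A : atlas E M) : Prop :=
  [/\ forall p, [/\ open (adom A p), adom A p p, open (acodom A p) &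
                    forall x, adom A p x -> apoint A p (acoord A p x) = x],
      forall p, (forall x, adom A p x -> {for x, continuous (acoord A p)}) /\
                (forall y, acodom A p y -> {for y, continuous (apoint A p)}) &
      forall p q, smooth_on (acoord A p @` (adom A p `&` adom A q))
                            (acoord A q \o apoint A p)].

Lemma is_manifold_atlas {E M} (A : atlas E M) : is_manifold A -> is_atlas A.
Proof. by case. Qed.

Section atlas_facts.
Context {E : normedModType R} {M : topologicalType} (A : atlas E M).
Hypothesis hA : is_atlas A.

Lemma acoordK p x : adom A p x -> apoint A p (acoord A p x) = x.
Proof. by case: hA => + _ _ => /(_ p)[_ _ _]; apply. Qed.

Lemma adom_id p : adom A p p.
Proof. by case: hA => + _ _ => /(_ p)[]. Qed.

Lemma adom_open p : open (adom A p).
Proof. by case: hA => + _ _ => /(_ p)[]. Qed.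

Lemma acodom_open p : open (acodom A p).
Proof. by case: hA => + _ _ => /(_ p)[]. Qed.

Lemma acodom_acoord p x : adom A p x -> acodom A p (acoord A p x).
Proof. by move=> px; exists x. Qed.

Lemma adom_apoint p y : acodom A p y -> adom A p (apoint A p y).
Proof. by case=> x px <-; rewrite acoordK. Qed.

Lemma apointK p y : acodom A p y -> acoord A p (apoint A p y) = y.
Proof. by case=> x px <-; rewrite acoordK. Qed.

Lemma acoord_continuous p x : adom A p x -> {for x, continuous (acoord A p)}.
Proof. by case: hA => _ + _ => /(_ p)[+ _]; apply. Qed.

Lemma apoint_continuous p y : acodom A p y -> {for y, continuous (apoint A p)}.
Proof. by case: hA => _ + _ => /(_ p)[_]; apply. Qed.

Lemma near_adom p x : adom A p x -> \forall z \near x, adom A p z.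
Proof. by move=> px; exact: (open_nbhs_nbhs (conj (adom_open p) px)). Qed.

Lemma near_acodom p x : adom A p x -> \forall y \near acoord A p x, acodom A p y.
Proof.
by move=> px; exact: (open_nbhs_nbhs (conj (acodom_open p) (acodom_acoord px))).
Qed.

Lemma near_apoint p x (O : set M) : adom A p x -> nbhs x O ->
  \forall y \near acoord A p x, O (apoint A p y).
Proof.
move=> px; apply: near_continuous; last exact: acoordK.
exact: apoint_continuous (acodom_acoord px).
Qed.

Lemma open_acoord_image p (O : set M) : open O -> open (acoord A p @` (adom A p `&` O)).
Proof.
move=> oO; rewrite openE => _ [x [px Ox] <-].
have n1 := near_acodom px; have n2 := near_apoint px (open_nbhs_nbhs (conj oO Ox)).
apply: (@filterS2 _ _ (nbhs_filter _) _ _ _ _ n1 n2) => y yp yO.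
by exists (apoint A p y); [split => //; exact: adom_apoint|exact: apointK].
Qed.

Lemma transition_smooth p q x : adom A p x -> adom A q x ->
  smooth_at (acoord A q \o apoint A p) (acoord A p x).
Proof.
move=> px qx; case: hA => _ _ /(_ p q) sm.
have oI := open_acoord_image p (adom_open q).
by apply: ((smooth_onP _ oI).1 sm); exists x.
Qed.

End atlas_facts.

(** Only the charts chosen at p and at f p are used; [smooth_chart_change] passes to any others.
    Continuity is a separate clause because [mrep] represents f only where f lands in the chart
    domain. *)
Definition msmooth_at {E F M N} (A : atlas E M) (B : atlas F N) (f : M -> N) (p : M) :=
  {for p, continuous f} /\ smooth_at (mrep A B f p) (acoord A p p).

Lemma smooth_chart_change {E F M N} {hE : FinDim E} {hF : FinDim F}
    (A : atlas E M) (B : atlas F N) (hA : is_atlas A) (hB : is_atlas B)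
    (f : M -> N) x p p' q q' :
  {for x, continuous f} -> adom A p x -> adom A p' x ->
  adom B q (f x) -> adom B q' (f x) ->
  smooth_at (acoord B q \o f \o apoint A p) (acoord A p x) ->
  smooth_at (acoord B q' \o f \o apoint A p') (acoord A p' x).
Proof.
move=> fc px p'x qfx q'fx fs.
have s1 := transition_smooth hA p'x px.
have s2 := transition_smooth hB qfx q'fx.
have s3 : smooth_at (fun y => (acoord B q \o f \o apoint A p) ((acoord A p \o apoint A p') y))
    (acoord A p' x).
  by apply: smooth_at_comp s1 _; rewrite /= (acoordK hA).
have s4 : smooth_at (fun y => (acoord B q' \o apoint B q)
    ((acoord B q \o f \o apoint A p) ((acoord A p \o apoint A p') y))) (acoord A p' x).
  by apply: smooth_at_comp s3 _; rewrite /= !(acoordK hA).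
apply: smooth_at_eq s4.
have n1 := near_apoint hA p'x (near_adom hA px).
have fn : \forall z \near x, adom B q (f z).
  exact: near_continuous fc erefl (near_adom hB qfx).
have n2 := near_apoint hA p'x fn.
apply: (@filterS2 _ _ (nbhs_filter _) _ _ _ _ n1 n2) => y py qy /=.
by rewrite (acoordK hA)// (acoordK hB).
Qed.

Lemma msmooth_at_chart {E F M N} {hE : FinDim E} {hF : FinDim F}
    (A : atlas E M) (B : atlas F N) (hA : is_atlas A) (hB : is_atlas B) (f : M -> N) x p q :
  adom A p x -> adom B q (f x) -> msmooth_at A B f x ->
  smooth_at (acoord B q \o f \o apoint A p) (acoord A p x).
Proof.
move=> px qx [fc fs].
exact: (smooth_chart_change hA hB fc (adom_id hA x) px (adom_id hB (f x)) qx fs).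
Qed.

Lemma msmoothP {E F M N} {hE : FinDim E} {hF : FinDim F}
    (A : atlas E M) (B : atlas F N) (hA : is_atlas A) (hB : is_atlas B) (f : M -> N) :
  msmooth A B f <-> forall p, msmooth_at A B f p.
Proof.
split=> [[fc fs] p|fs].
  split; first exact: fc.
  have oI : open (acoord A p @` (adom A p `&` f @^-1` adom B (f p))).
    apply: open_acoord_image => //.
    by move/continuousP : fc; apply; exact: adom_open.
  apply: ((smooth_onP _ oI).1 (fs p)); exists p => //.
  by split; exact: adom_id.
have fc : continuous f by move=> p; have [] := fs p.
split => // p.
have oI : open (acoord A p @` (adom A p `&` f @^-1` adom B (f p))).
  apply: open_acoord_image => //.
  by move/continuousP : fc; apply; exact: adom_open.
apply/(smooth_onP _ oI) => _ [x [px qx] <-].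
exact: (msmooth_at_chart hA hB).
Qed.

(** The equality holds only near p, because the inner chart and its inverse cancel only where f
    stays in the domain chosen at f p. *)
Lemma mrep_comp_near {E F H} {M N P : topologicalType} (A : atlas E M) (B : atlas F N)
    (C : atlas H P) (hA : is_atlas A) (hB : is_atlas B) (f : M -> N) (g : N -> P) p :
  {for p, continuous f} ->
  \forall y \near acoord A p p, mrep B C g (f p) (mrep A B f p y) = mrep A C (g \o f) p y.
Proof.
move=> fc.
have fn : \forall z \near p, adom B (f p) (f z).
  exact: near_continuous fc erefl (near_adom hB (adom_id hB _)).
apply: filterS (near_apoint hA (adom_id hA p) fn) => y fy.
by rewrite /mrep /= (acoordK hB).
Qed.

Lemma msmooth_at_comp {E F H} {M N P : topologicalType} {hF : FinDim F} (A : atlas E M)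
    (B : atlas F N) (C : atlas H P) (hA : is_atlas A) (hB : is_atlas B)
    (f : M -> N) (g : N -> P) p :
  msmooth_at A B f p -> msmooth_at B C g (f p) -> msmooth_at A C (fun x => g (f x)) p.
Proof.
move=> [fc fs] [gc gs]; split; first exact: (continuous_comp fc gc).
apply: (smooth_at_eq (mrep_comp_near C hA hB g fc)).
by apply: (smooth_at_comp fs); rewrite {2}/mrep /= (acoordK hA (adom_id hA _)).
Qed.

Lemma mdiff_comp {E F H} {M N P : topologicalType} {hF : FinDim F} (A : atlas E M)
    (B : atlas F N) (C : atlas H P) (hA : is_atlas A) (hB : is_atlas B)
    (f : M -> N) (g : N -> P) p u :
  msmooth_at A B f p -> msmooth_at B C g (f p) ->
  mdiff A C (fun x => g (f x)) p u = mdiff B C g (f p) (mdiff A B f p u).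
Proof.
move=> [fc fs] [gc gs]; rewrite /mdiff.
have e : mrep A B f p (acoord A p p) = acoord B (f p) (f p).
  by rewrite /mrep /= (acoordK hA (adom_id hA _)).
have fd := smooth_at_differentiable fs; have gd := smooth_at_differentiable gs.
rewrite -e in gd *.
have cd := differentiable_comp fd gd.
rewrite -(near_diff (mrep_comp_near C hA hB g fc) cd).
by rewrite -[fun y => _]/(mrep B C g (f p) \o mrep A B f p) (diff_comp fd gd).
Qed.

Lemma near_mrep {E F M N} (A : atlas E M) (B : atlas F N) (hA : is_atlas A) (f g : M -> N) p :
  (\forall x \near p, f x = g x) ->
  \forall y \near acoord A p p, mrep A B f p y = mrep A B g p y.
Proof.
move=> fg; have fgp : f p = g p := nbhs_singleton fg.
apply: filterS (near_apoint hA (adom_id hA p) fg) => y fy.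
by rewrite /mrep /= fy fgp.
Qed.

Lemma mdiff_eq {E F M N} (A : atlas E M) (B : atlas F N) (hA : is_atlas A)
    (f g : M -> N) p u : (\forall x \near p, f x = g x) ->
  msmooth_at A B f p -> mdiff A B f p u = mdiff A B g p u.
Proof.
move=> fg [fc fs]; rewrite /mdiff (near_diff (near_mrep B hA fg))//.
exact: smooth_at_differentiable.
Qed.

Lemma mdiff_linear {E F M N} (A : atlas E M) (B : atlas F N) (f : M -> N) p :
  linear (mdiff A B f p).
Proof. by move=> a u v; rewrite /mdiff linearP. Qed.

Lemma smooth_at_id {E} {hE : FinDim E} (x : E) : smooth_at (fun y : E => y) x.
Proof. exact: (smooth_at_linear (l := id)). Qed.

Lemma near_mrep_id {E M} (A : atlas E M) (hA : is_atlas A) p :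
  \forall y \near acoord A p p, y = mrep A A id p y.
Proof.
apply: filterS (near_acodom hA (adom_id hA p)) => y yp.
by rewrite /mrep /= apointK.
Qed.

Lemma msmooth_at_id {E M} {hE : FinDim E} (A : atlas E M) (hA : is_atlas A) p :
  msmooth_at A A (fun x => x) p.
Proof.
split; first exact: cvg_id.
exact: smooth_at_eq (near_mrep_id hA p) (smooth_at_id _).
Qed.

Lemma mdiff_id {E M} (A : atlas E M) (hA : is_atlas A) p u : mdiff A A (fun x => x) p u = u.
Proof.
by rewrite /mdiff -(near_diff (near_mrep_id hA p)) // diff_val.
Qed.

Lemma msmooth_at_cst {E F M N} (A : atlas E M) (B : atlas F N) (c : N) p :
  msmooth_at A B (fun=> c) p.
Proof. by split; [exact: cvg_cst|exact: smooth_at_cst]. Qed.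

Lemma mdiff_cst {E F M N} (A : atlas E M) (B : atlas F N) (c : N) p u :
  mdiff A B (fun=> c) p u = 0.
Proof. by rewrite /mdiff -[mrep _ _ _ _]/(cst _) diff_cst. Qed.

Lemma msmooth_at_pair {E F H M N} {P : topologicalType} (A : atlas E M) (B : atlas F N)
    (C : atlas H P) (f : M -> N) (g : M -> P) p :
  msmooth_at A B f p -> msmooth_at A C g p ->
  msmooth_at A (prod_atlas B C) (fun x => (f x, g x)) p.
Proof.
move=> [fc fs] [gc gs]; split; first exact: (cvg_pair fc gc).
exact: (smooth_at_pair fs gs).
Qed.

Lemma mdiff_pair {E F H M N} {P : topologicalType} (A : atlas E M) (B : atlas F N)
    (C : atlas H P) (f : M -> N) (g : M -> P) p u :
  msmooth_at A B f p -> msmooth_at A C g p ->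
  mdiff A (prod_atlas B C) (fun x => (f x, g x)) p u = (mdiff A B f p u, mdiff A C g p u).
Proof.
move=> [fc /smooth_at_differentiable fd] [gc /smooth_at_differentiable gd].
by rewrite /mdiff -[mrep _ (prod_atlas _ _) _ _]/(fun y => (mrep A B f p y, mrep A C g p y))
  (diff_pair fd gd).
Qed.

Lemma vec_atlasP {E} {hE : FinDim E} : is_atlas (vec_atlas E).
Proof.
have cT (p : E) : acodom (vec_atlas E) p = setT by apply/seteqP; split => // x _; exists x.
split=> [p|p|p q].
- by split=> //; [exact: openT|rewrite cT; exact: openT].
- by split=> x _; exact: cvg_id.
- have -> : acoord (vec_atlas E) p @` (adom (vec_atlas E) p `&` adom (vec_atlas E) q) = setT.
    by apply/seteqP; split => // x _; exists x.
  apply/smooth_onP; first exact: openT.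
  by move=> x _; exact: smooth_at_id.
Qed.

Lemma msmooth_at_vecP {E F} (f : E -> F) x :
  msmooth_at (vec_atlas E) (vec_atlas F) f x <-> smooth_at f x.
Proof. by split=> [[]//|fs]; split => //; exact: smooth_at_continuous. Qed.

Lemma mdiff_vec {E F} (f : E -> F) x u :
  mdiff (vec_atlas E) (vec_atlas F) f x u = 'd f x u.
Proof. by []. Qed.

Lemma mdiffE {E F M} (A : atlas E M) (f : M -> F) p u :
  msmooth_at A (vec_atlas F) f p ->
  mdiff A (vec_atlas F) f p u = 'D_u (f \o apoint A p) (acoord A p p).
Proof. by move=> [_ /smooth_at_differentiable fd]; rewrite deriveE. Qed.

Lemma open_setX {M N} (U : set M) (V : set N) : open U -> open V -> open (U `*` V).
Proof.
move=> oU oV; rewrite openE => -[x y] [/= Ux Vy].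
by exists (U, V) => //; split; exact: open_nbhs_nbhs.
Qed.

Lemma prod_atlasP {E F M N} {hE : FinDim E} {hF : FinDim F} (A : atlas E M) (B : atlas F N) :
  is_atlas A -> is_atlas B -> is_atlas (prod_atlas A B).
Proof.
move=> hA hB.
have cP p : acodom (prod_atlas A B) p = acodom A p.1 `*` acodom B p.2.
  apply/seteqP; split=> [_ [[x y] [/= px py] <-]|[_ _] [/= [x px <-] [y py <-]]].
    by split; [exists x|exists y].
  by exists (x, y).
split=> [p|p|p q].
- split.
  + by apply: open_setX; exact: adom_open.
  + by split; exact: adom_id.
  + by rewrite cP; apply: open_setX; exact: acodom_open.
  + by move=> [x y] [/= px py]; rewrite !acoordK.
- split=> [[x y] [/= px py]|].
    apply: cvg_pair.
      by apply: (@cvg_comp _ _ _ fst _ _ _ _ cvg_fst); exact: acoord_continuous.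
    by apply: (@cvg_comp _ _ _ snd _ _ _ _ cvg_snd); exact: acoord_continuous.
  rewrite cP => -[x y] [/= px py]; apply: cvg_pair.
    by apply: (@cvg_comp _ _ _ fst _ _ _ _ cvg_fst); exact: apoint_continuous.
  by apply: (@cvg_comp _ _ _ snd _ _ _ _ cvg_snd); exact: apoint_continuous.
- have -> : acoord (prod_atlas A B) p @` (adom (prod_atlas A B) p `&` adom (prod_atlas A B) q) =
    (acoord A p.1 @` (adom A p.1 `&` adom A q.1)) `*` (acoord B p.2 @` (adom B p.2 `&` adom B q.2)).
    apply/seteqP; split=> [_ [[x y] [[/= px py] [/= qx qy]] <-]|].
      by split; [exists x|exists y].
    by move=> [_ _] [/= [x [px qx] <-] [y [py qy] <-]]; exists (x, y).
  have o1 := open_acoord_image hA p.1 (adom_open hA q.1).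
  have o2 := open_acoord_image hB p.2 (adom_open hB q.2).
  apply/smooth_onP; first exact: open_setX.
  move=> [_ _] [/= [x [px qx] <-] [y [py qy] <-]].
  apply: smooth_at_pair.
    apply: (@smooth_at_comp _ _ _ _ _ fst (acoord A q.1 \o apoint A p.1)).
      by apply: smooth_at_linear => a u v.
    exact: transition_smooth.
  apply: (@smooth_at_comp _ _ _ _ _ snd (acoord B q.2 \o apoint B p.2)).
    by apply: smooth_at_linear => a u v.
  exact: transition_smooth.
Qed.

Lemma msmooth_at_fst {E F M N} {hE : FinDim E} {hF : FinDim F} (A : atlas E M) (B : atlas F N)
    (hA : is_atlas A) (hB : is_atlas B) p : msmooth_at (prod_atlas A B) A fst p.
Proof.
split; first exact: cvg_fst.
have hP : is_atlas (prod_atlas A B) by exact: prod_atlasP.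
apply: (@smooth_at_eq _ _ _ fst); last by apply: smooth_at_linear => a u v.
apply: (@open_eq_near R (E * F)%type E _ fst (mrep (prod_atlas A B) A fst p)
  _ (acodom_open hP p) _ (acodom_acoord (adom_id hP p))).
move=> _ [[x y] [/= px py] <-].
by rewrite /mrep /= acoordK.
Qed.

Lemma msmooth_at_snd {E F M N} {hE : FinDim E} {hF : FinDim F} (A : atlas E M) (B : atlas F N)
    (hA : is_atlas A) (hB : is_atlas B) p : msmooth_at (prod_atlas A B) B snd p.
Proof.
split; first exact: cvg_snd.
have hP : is_atlas (prod_atlas A B) by exact: prod_atlasP.
apply: (@smooth_at_eq _ _ _ snd); last by apply: smooth_at_linear => a u v.
apply: (@open_eq_near R (E * F)%type F _ snd (mrep (prod_atlas A B) B snd p)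
  _ (acodom_open hP p) _ (acodom_acoord (adom_id hP p))).
move=> _ [[x y] [/= px py] <-].
by rewrite /mrep /= acoordK.
Qed.

Lemma mdiff_fst {E F M N} {hE : FinDim E} {hF : FinDim F} (A : atlas E M) (B : atlas F N)
    (hA : is_atlas A) (hB : is_atlas B) p u : mdiff (prod_atlas A B) A fst p u = u.1.
Proof.
have hP : is_atlas (prod_atlas A B) by exact: prod_atlasP.
have := mdiff_pair u (msmooth_at_fst hA hB p) (msmooth_at_snd hA hB p).
rewrite (_ : (fun x => (x.1, x.2)) = fun x => x); last by apply/funext => -[].
by rewrite mdiff_id// => {2}->.
Qed.

Lemma mdiff_snd {E F M N} {hE : FinDim E} {hF : FinDim F} (A : atlas E M) (B : atlas F N)
    (hA : is_atlas A) (hB : is_atlas B) p u : mdiff (prod_atlas A B) B snd p u = u.2.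
Proof.
have hP : is_atlas (prod_atlas A B) by exact: prod_atlasP.
have := mdiff_pair u (msmooth_at_fst hA hB p) (msmooth_at_snd hA hB p).
rewrite (_ : (fun x => (x.1, x.2)) = fun x => x); last by apply/funext => -[].
by rewrite mdiff_id// => {2}->.
Qed.

Lemma msmooth_at_acoord {E M} {hE : FinDim E} (A : atlas E M) (hA : is_atlas A) p x :
  adom A p x -> msmooth_at A (vec_atlas E) (acoord A p) x.
Proof.
move=> px; split; first exact: acoord_continuous.
exact: transition_smooth (adom_id hA x) px.
Qed.

Lemma msmooth_at_apoint {E M} {hE : FinDim E} (A : atlas E M) (hA : is_atlas A) p y :
  acodom A p y -> msmooth_at (vec_atlas E) A (apoint A p) y.
Proof.
case=> x px <-; split; first by apply: apoint_continuous => //; exact: acodom_acoord.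
rewrite /mrep /= (acoordK hA px).
exact: transition_smooth px (adom_id hA x).
Qed.

(** In the chart chosen at p, the map [acoord A p] and the identity of M have the same
    representative. *)
Lemma mdiff_acoord {E M} {hE : FinDim E} (A : atlas E M) (hA : is_atlas A) p u :
  mdiff A (vec_atlas E) (acoord A p) p u = u.
Proof. by rewrite -[RHS](mdiff_id hA p). Qed.

Lemma mdiff_apoint {E M} {hE : FinDim E} (A : atlas E M) (hA : is_atlas A) p u :
  mdiff (vec_atlas E) A (apoint A p) (acoord A p p) u = u.
Proof.
rewrite -[RHS](mdiff_id hA p) /mdiff /mrep /= (acoordK hA (adom_id hA p)).
by [].
Qed.

Lemma msmooth_at_vpair {E F H M} (A : atlas E M) (f : M -> F) (g : M -> H) p :
  msmooth_at A (vec_atlas F) f p -> msmooth_at A (vec_atlas H) g p ->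
  msmooth_at A (vec_atlas (F * H)%type) (fun x => (f x, g x)) p.
Proof.
move=> [fc fs] [gc gs]; split; first exact: (cvg_pair fc gc).
exact: (smooth_at_pair fs gs).
Qed.

Lemma mdiff_vpair {E F H M} (A : atlas E M) (f : M -> F) (g : M -> H) p u :
  msmooth_at A (vec_atlas F) f p -> msmooth_at A (vec_atlas H) g p ->
  mdiff A (vec_atlas (F * H)%type) (fun x => (f x, g x)) p u =
  (mdiff A (vec_atlas F) f p u, mdiff A (vec_atlas H) g p u).
Proof. exact: mdiff_pair. Qed.

Lemma msmooth_at_D {E F M} (A : atlas E M) (f g : M -> F) p :
  msmooth_at A (vec_atlas F) f p -> msmooth_at A (vec_atlas F) g p ->
  msmooth_at A (vec_atlas F) (fun x => f x + g x) p.
Proof.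
move=> [fc fs] [gc gs]; split; first exact: (cvgD fc gc).
exact: (smooth_atDr fs gs).
Qed.

Lemma mdiff_D {E F M} (A : atlas E M) (f g : M -> F) p u :
  msmooth_at A (vec_atlas F) f p -> msmooth_at A (vec_atlas F) g p ->
  mdiff A (vec_atlas F) (fun x => f x + g x) p u =
  mdiff A (vec_atlas F) f p u + mdiff A (vec_atlas F) g p u.
Proof.
move=> fs gs; rewrite !mdiffE//; last exact: msmooth_at_D.
case: fs gs => _ /smooth_at_differentiable fd [_ /smooth_at_differentiable gd].
by rewrite -deriveD//; apply: diff_derivable.
Qed.

Lemma msmooth_at_linear {E F H M} {hF : FinDim F} (A : atlas E M) (f : M -> F) (l : F -> H) p :
  linear l -> msmooth_at A (vec_atlas F) f p -> msmooth_at A (vec_atlas H) (fun x => l (f x)) p.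
Proof.
move=> ll [fc fs]; have ls : smooth_at l (f p) by exact: smooth_at_linear.
split; first exact: (continuous_comp fc (smooth_at_continuous ls)).
by apply: (smooth_at_comp fs); exact: smooth_at_linear.
Qed.

Lemma diff_linear {E F} {hE : FinDim E} (l : E -> F) x u : linear l -> 'd l x u = l u.
Proof.
move=> hl; pose L : {linear E -> F} := HB.pack l (GRing.isLinear.Build R E F _ _ hl).
have Lc : continuous L by apply: linear_continuous_findim.
by rewrite (diff_lin x Lc : 'd l x = l :> (E -> F)).
Qed.

Lemma mdiff_linear_comp {E F H M} {hF : FinDim F} (A : atlas E M) (hA : is_atlas A)
    (f : M -> F) (l : F -> H) p u :
  linear l -> msmooth_at A (vec_atlas F) f p ->
  mdiff A (vec_atlas H) (fun x => l (f x)) p u = l (mdiff A (vec_atlas F) f p u).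
Proof.
move=> ll fs; have ls : msmooth_at (vec_atlas F) (vec_atlas H) l (f p).
  by apply/msmooth_at_vecP; exact: smooth_at_linear.
by rewrite (mdiff_comp hA vec_atlasP u fs ls) mdiff_vec diff_linear.
Qed.

End manifolds.

(** * One-forms: pullback and exterior derivative *)

Section forms.
Context {R : realType}.
Implicit Types E F : normedModType R.
Implicit Types M N : topologicalType.

Definition smooth_form_at {E M} (A : atlas E M) (al : M -> E -> R) (p : M) :=
  (forall x, linear (al x : E -> R^o)) /\
  forall v, smooth_at (fun y => rep1 A al p y v : R^o) (acoord A p p).

Definition pullback1 {E F M N} (A : atlas E M) (B : atlas F N) (f : M -> N)
  (al : N -> F -> R) (x : M) (u : E) : R := al (f x) (mdiff A B f x u).

Lemma linear_coord {E F} (k : nat) (e : 'I_k -> E) (c : 'I_k -> {linear E -> R^o}) (l : E -> F) :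
  (forall x, x = \sum_i c i x *: e i) -> linear l -> forall w, l w = \sum_i c i w *: l (e i).
Proof.
move=> ce ll w; pose L : {linear E -> F} := HB.pack l (GRing.isLinear.Build R E F _ _ ll).
rewrite {1}(ce w) -[l]/(L : E -> F) linear_sum.
by apply: eq_bigr => i _; rewrite linearZ.
Qed.

Lemma derive_sum_scale {E F} (k : nat) (a : 'I_k -> E -> R^o) (b : 'I_k -> E -> F) x u :
  (forall i, differentiable (a i) x) -> (forall i, differentiable (b i) x) ->
  'D_u (fun y => \sum_i a i y *: b i y) x =
  \sum_i ('D_u (a i) x *: b i x + a i x *: 'D_u (b i) x).
Proof.
move=> da db.
have db' i : is_diff x (fun y => a i y *: b i y)
    (fun v => 'd (a i) x v *: b i x + a i x *: 'd (b i) x v).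
  apply: (continuous_bilinear_diff (b := @GRing.scale R F : R^o -> F -> F)) => //.
  exact: scale_continuous.
have -> : (fun y => \sum_i a i y *: b i y) = \sum_i (fun y => a i y *: b i y).
  by apply/funext => y; rewrite fct_sumE.
rewrite derive_sum; last by move=> i; have [d _] := db' i; exact: diff_derivable.
apply: eq_bigr => i _; have [d dE] := db' i.
by rewrite (deriveE u d) dE (deriveE u (da i)) (deriveE u (db i)).
Qed.

(** Product rule for a form a(y) applied to a varying vector, when smoothness of a is known for each
    fixed vector only: linearity in the vector expands it along the coordinates of G. *)
Lemma derive_form_comp {E F G H : normedModType R} {hF : FinDim F} {hG : FinDim G}
    (a : F -> G -> H) (f : E -> F) (w : E -> G) x :
  (forall y, linear (a y)) -> (forall v, smooth_at (a ^~ v) (f x)) ->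
  smooth_at f x -> smooth_at w x ->
  smooth_at (fun y => a (f y) (w y)) x /\
  forall u, 'D_u (fun y => a (f y) (w y)) x =
    'D_('D_u f x) (a ^~ (w x)) (f x) + a (f x) ('D_u w x).
Proof.
move=> la sa sf sw; have [N [e [c [cc ce]]]] := hG.
have aE y v : a y v = \sum_i c i v *: a y (e i) by exact: linear_coord ce (la y) v.
have swi i : smooth_at (fun y => c i (w y)) x.
  by apply: (smooth_at_comp sw (g := c i)); apply: smooth_at_linear => k y z; rewrite linearP.
have safi i : smooth_at (fun y => a (f y) (e i)) x.
  exact: (smooth_at_comp sf (sa (e i))).
have -> : (fun y => a (f y) (w y)) = fun y => \sum_i c i (w y) *: a (f y) (e i).
  by apply/funext => y; rewrite aE.
split=> [|u]; first by apply: smooth_at_sum => i; exact: smooth_atZ.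
rewrite derive_sum_scale; last 2 first.
- by move=> i; exact: smooth_at_differentiable.
- by move=> i; exact: smooth_at_differentiable.
have -> : (a ^~ (w x)) = fun y => \sum_i c i (w x) *: a y (e i).
  by apply/funext => y; rewrite aE.
rewrite (derive_sum_scale (a := fun i => cst (c i (w x)))); last 2 first.
- by move=> i; exact: differentiable_cst.
- by move=> i; apply: smooth_at_differentiable.
rewrite [a (f x) _]aE -big_split /=; apply: eq_bigr => i _.
rewrite derive_cst scale0r add0r addrC; congr (_ *: _ + _ *: _).
  exact: (derive_linear u (cc i) (smooth_at_differentiable sw)).
have fd := smooth_at_differentiable sf; have ad := smooth_at_differentiable (sa (e i)).
have dc : differentiable ((a ^~ (e i)) \o f) x := differentiable_comp fd ad.
apply: (etrans (deriveE u dc)).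
by rewrite (diff_comp fd ad) /= (deriveE _ ad) (deriveE u fd).
Qed.

Lemma rep1_linear {E M} (A : atlas E M) (al : M -> E -> R) p y :
  (forall x, linear (al x : E -> R^o)) -> linear (rep1 A al p y : E -> R^o).
Proof. by move=> la a u v; rewrite /rep1 mdiff_linear la. Qed.

Lemma pullback1_linear {E F M N} (A : atlas E M) (B : atlas F N) (f : M -> N)
  (al : N -> F -> R) x : (forall x, linear (al x : F -> R^o)) ->
  linear (pullback1 A B f al x : E -> R^o).
Proof. by move=> la a u v; rewrite /pullback1 mdiff_linear la. Qed.

(** In charts a pullback is substitution of F = [mrep A B f p] at the point and of D_v F at the
    vector; this is the chain rule for [apoint] after F, which is f after [apoint]. *)
Lemma rep1_pullback {E F M N} {hE : FinDim E} {hF : FinDim F} (A : atlas E M) (B : atlas F N)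
    (hA : is_atlas A) (hB : is_atlas B) (f : M -> N) (al : N -> F -> R) p :
  (\forall x \near p, msmooth_at A B f x) ->
  \forall y \near acoord A p p, forall v,
    rep1 B al (f p) (mrep A B f p y) ('D_v (mrep A B f p) y) =
    rep1 A (pullback1 A B f al) p y v.
Proof.
move=> fn; have [fc fs] : msmooth_at A B f p := nbhs_singleton fn.
have pp := adom_id hA p.
have fa : \forall z \near p, adom B (f p) (f z).
  exact: near_continuous fc erefl (near_adom hB (adom_id hB _)).
have n1 := near_apoint hA pp fn.
have n2 := near_join (near_apoint hA pp fa).
have n3 := smooth_at_near fs; have n4 := near_acodom hA pp.
have n34 := @filterI _ _ (nbhs_filter _) _ _ n3 n4.
apply: (@filterS3 _ _ (nbhs_filter _) _ _ _ _ _ n1 n2 n34) => y fy fay [Fy ya] v.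
have fyB : adom B (f p) (f (apoint A p y)) := nbhs_singleton fay.
rewrite /rep1 /pullback1 -(mdiff_comp vec_atlasP hA v (msmooth_at_apoint hA ya) fy).
have fyc := acodom_acoord fyB.
have Fd := smooth_at_differentiable Fy.
have E1 : mdiff (vec_atlas F) B (apoint B (f p)) (mrep A B f p y) ('D_v (mrep A B f p) y)
   = mdiff (vec_atlas E) B (fun z => apoint B (f p) (mrep A B f p z)) y v.
  rewrite (deriveE v Fd) -mdiff_vec.
  rewrite (mdiff_comp vec_atlasP vec_atlasP v _ (msmooth_at_apoint hB fyc))//.
  exact/msmooth_at_vecP.
rewrite E1.
have E2 : \forall z \near y, apoint B (f p) (mrep A B f p z) = f (apoint A p z).
  by apply: filterS fay => z fz; rewrite /mrep /= (acoordK hB).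
rewrite (mdiff_eq vec_atlasP v E2).
  by rewrite /mrep /= (acoordK hB).
apply: (msmooth_at_comp vec_atlasP vec_atlasP _ (msmooth_at_apoint hB fyc)).
exact/msmooth_at_vecP.
Qed.

Lemma pullback1_smooth {E F M N} {hE : FinDim E} {hF : FinDim F} (A : atlas E M) (B : atlas F N)
    (hA : is_atlas A) (hB : is_atlas B) (f : M -> N) (al : N -> F -> R) p :
  (\forall x \near p, msmooth_at A B f x) -> smooth_form_at B al (f p) ->
  smooth_form_at A (pullback1 A B f al) p.
Proof.
move=> fn [la sa]; split; first by move=> x; exact: pullback1_linear.
move=> v; have [fc fs] : msmooth_at A B f p := nbhs_singleton fn.
have e : mrep A B f p (acoord A p p) = acoord B (f p) (f p).
  by rewrite /mrep /= (acoordK hA (adom_id hA _)).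
have [s _] := derive_form_comp (hF := hF) (hG := hF) (a := rep1 B al (f p)) (f := mrep A B f p)
  (w := 'D_v (mrep A B f p)) (x := acoord A p p)
  (fun y => rep1_linear B (f p) y la) (fun v => eq_ind_r (smooth_at _) (sa v) e) fs (smooth_at_D v fs).
apply: smooth_at_eq s.
by apply: filterS (rep1_pullback hA hB al fn) => y; apply.
Qed.

(** The product rule produces, besides the wanted terms, the form applied to D_u D_v F and to D_v
    D_u F; these cancel by symmetry of second derivatives. *)
Lemma dform1_pullback {E F M N} {hE : FinDim E} {hF : FinDim F} (A : atlas E M) (B : atlas F N)
    (hA : is_atlas A) (hB : is_atlas B) (f : M -> N) (al : N -> F -> R) p u v :
  (\forall x \near p, msmooth_at A B f x) -> smooth_form_at B al (f p) ->
  dform1 A (pullback1 A B f al) p u v =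
  dform1 B al (f p) (mdiff A B f p u) (mdiff A B f p v).
Proof.
move=> fn [la sa]; have [fc fs] : msmooth_at A B f p := nbhs_singleton fn.
have e : mrep A B f p (acoord A p p) = acoord B (f p) (f p).
  by rewrite /mrep /= (acoordK hA (adom_id hA _)).
have key w : forall u, 'D_u (fun y => rep1 A (pullback1 A B f al) p y w : R^o) (acoord A p p) =
   'D_(mdiff A B f p u) (fun y => rep1 B al (f p) y (mdiff A B f p w) : R^o) (acoord B (f p) (f p))
   + rep1 B al (f p) (acoord B (f p) (f p)) ('D_u ('D_w (mrep A B f p)) (acoord A p p)).
  move=> u'; have [_ d] := derive_form_comp (hF := hF) (hG := hF) (a := rep1 B al (f p)) (f := mrep A B f p)
  (w := 'D_w (mrep A B f p)) (x := acoord A p p)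
  (fun y => rep1_linear B (f p) y la) (fun v => eq_ind_r (smooth_at _) (sa v) e) fs (smooth_at_D w fs).
  rewrite -(@near_eq_derive _ _ _ (fun y => rep1 B al (f p) (mrep A B f p y) ('D_w (mrep A B f p) y) : R^o)); last first.
    by apply: filterS (rep1_pullback hA hB al fn) => y; apply.
  by rewrite d e !(deriveE _ (smooth_at_differentiable fs)).
rewrite /dform1 !key (derive_comm u v fs) opprD addrACA subrr addr0.
by [].
Qed.

End forms.

(** * Partial differentials on products *)

Section partial_differentials.
Context {R : realType}.
Implicit Types E F H : normedModType R.

(** The charts of a vector space are identities, so continuity of g follows from that of its
    representative. *)
Lemma msmooth_at_vecI {E H} {M : topologicalType} {hE : FinDim E} (A : atlas E M)
    (hA : is_atlas A) (g : M -> H) p :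
  smooth_at (g \o apoint A p) (acoord A p p) -> msmooth_at A (vec_atlas H) g p.
Proof.
move=> gs; split => //; have gc := smooth_at_continuous gs.
have pp := adom_id hA p.
have cc : {for p, continuous ((g \o apoint A p) \o acoord A p)}.
  by apply: continuous_comp => //; exact: acoord_continuous.
have n : \forall x \near p, ((g \o apoint A p) \o acoord A p) x = g x.
  by apply: filterS (near_adom hA pp) => x px /=; rewrite acoordK.
suff: g @ p --> g p by [].
rewrite -(nbhs_singleton n); apply: cvg_trans cc; exact: near_eq_cvg.
Qed.

Lemma smooth_at_pairr {E F} {hE : FinDim E} (b : F) (x : E) : smooth_at (fun y => (y, b)) x.
Proof. by apply: smooth_at_pair; [exact: smooth_at_id|exact: smooth_at_cst]. Qed.

Lemma smooth_at_pairl {E F} {hF : FinDim F} (a : E) (x : F) : smooth_at (fun y => (a, y)) x.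
Proof. by apply: smooth_at_pair; [exact: smooth_at_cst|exact: smooth_at_id]. Qed.

Lemma derive_pairr {E F H} {hE : FinDim E} {hF : FinDim F} (f : E * F -> H) a b u :
  differentiable f (a, b) -> 'D_u (fun y => f (y, b)) a = 'D_(u, 0) f (a, b).
Proof.
move=> fd; have pd : is_diff a (fun y : E => (y, b)) (fun v : E => (v, 0)).
  exact: (is_diff_pair (is_diff_id a) (is_diff_cst b a)).
have [d1 d2] := pd.
have dc : differentiable (f \o (fun y : E => (y, b))) a by exact: differentiable_comp.
apply: (etrans (deriveE u dc)).
by rewrite (diff_comp d1 fd) /= d2 (deriveE _ fd).
Qed.

Lemma derive_pairl {E F H} {hE : FinDim E} {hF : FinDim F} (f : E * F -> H) a b v :
  differentiable f (a, b) -> 'D_v (fun y => f (a, y)) b = 'D_(0, v) f (a, b).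
Proof.
move=> fd; have pd : is_diff b (fun y : F => (a, y)) (fun v : F => (0, v)).
  exact: (is_diff_pair (is_diff_cst a b) (is_diff_id b)).
have [d1 d2] := pd.
have dc : differentiable (f \o (fun y : F => (a, y))) b by exact: differentiable_comp.
apply: (etrans (deriveE v dc)).
by rewrite (diff_comp d1 fd) /= d2 (deriveE _ fd).
Qed.

Context {E F H : normedModType R} {M N P : topologicalType}.
Context {hE : FinDim E} {hF : FinDim F}.
Variables (A : atlas E M) (B : atlas F N) (C : atlas H P).
Hypotheses (hA : is_atlas A) (hB : is_atlas B).

Lemma msmooth_at_pairr b a : msmooth_at A (prod_atlas A B) (fun x => (x, b)) a.
Proof. by apply: msmooth_at_pair; [exact: msmooth_at_id|exact: msmooth_at_cst]. Qed.

Lemma msmooth_at_pairl b a : msmooth_at B (prod_atlas A B) (fun x => (a, x)) b.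
Proof. by apply: msmooth_at_pair; [exact: msmooth_at_cst|exact: msmooth_at_id]. Qed.

Lemma mdiff_partial (f : M * N -> P) a b u v :
  msmooth_at (prod_atlas A B) C f (a, b) ->
  mdiff (prod_atlas A B) C f (a, b) (u, v) =
  mdiff A C (fun x => f (x, b)) a u + mdiff B C (fun x => f (a, x)) b v.
Proof.
move=> fs; have hP : is_atlas (prod_atlas A B) by exact: prod_atlasP.
rewrite (mdiff_comp hA hP u (msmooth_at_pairr b a) fs).
rewrite (mdiff_comp hB hP v (msmooth_at_pairl b a) fs).
rewrite (mdiff_pair u (msmooth_at_id hA a) (msmooth_at_cst A B b a)).
rewrite (mdiff_pair v (msmooth_at_cst B A a b) (msmooth_at_id hB b)).
rewrite !mdiff_id// !mdiff_cst.
have -> : (u, v) = 1 *: (u, 0 : F) + (0 : E, v).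
  by rewrite scale1r -[RHS]/(u + 0, 0 + v) addr0 add0r.
by rewrite mdiff_linear !scale1r.
Qed.

(** As f (x, b) = c for all x, the partial differentials all use the charts at b and c and are
    derivatives of one and the same representative of f. This is what makes Ad smooth in the group
    variable. *)
Lemma smooth_partial (f : M * N -> P) p b c v :
  (forall x, f (x, b) = c) -> msmooth_at (prod_atlas A B) C f (p, b) ->
  msmooth_at A (vec_atlas H) (fun x => mdiff B C (fun z => f (x, z)) b v) p.
Proof.
move=> fc [_ fs]; apply: msmooth_at_vecI => //.
pose g := mrep (prod_atlas A B) C f (p, b).
pose o := acoord A p p; pose ob := acoord B b b.
have gs : smooth_at g (o, ob) by exact: fs.
have gD : smooth_at (fun y => 'D_(0, v) g (y, ob)) o.
  by apply: (smooth_at_comp (smooth_at_pairr ob o) (g := 'D_(0, v) g)); exact: smooth_at_D.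
apply: smooth_at_eq gD.
have gn : \forall y \near o, smooth_at g (y, ob).
  exact: near_continuous (smooth_at_continuous (smooth_at_pairr ob o)) erefl (smooth_at_near gs).
apply: filterS gn => y gy.
rewrite /= -derive_pairl; last exact: smooth_at_differentiable.
rewrite deriveE.
  by rewrite /g /mdiff /mrep /= !fc.
apply: (differentiable_comp (f := fun z => (y, z))); last exact: smooth_at_differentiable.
exact: smooth_at_differentiable (smooth_at_pairl y ob).
Qed.

End partial_differentials.

(** The intermediate point is a variable q, because [mdiff] uses the chart at f p and an f p such as
    g * 1 * g^-1 has to be replaced by its value 1. *)
Lemma mdiff_comp_at {R : realType} {E F H : normedModType R} {M N P : topologicalType}
    {hF : FinDim F} (A : atlas E M) (B : atlas F N) (C : atlas H P) (hA : is_atlas A)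
    (hB : is_atlas B) (f : M -> N) (g : N -> P) p q u :
  f p = q -> msmooth_at A B f p -> msmooth_at B C g q ->
  mdiff A C (fun x => g (f x)) p u = mdiff B C g q (mdiff A B f p u).
Proof. by move=> <-; exact: mdiff_comp. Qed.

(** * Lie groups *)

Section lie_group.
Context {R : realType} {n : nat} {G : topGroupType}.
Variable AG : atlas 'rV[R]_n G.
Hypothesis hG : is_lie_group AG.
Local Notation V := 'rV[R]_n.
Local Notation Ad := (Ad AG).
Local Notation bracket := (bracket AG).
Local Notation adstar := (adstar AG).
Local Notation TR := (TR AG).

Lemma lie_atlas : is_atlas AG.
Proof. by case: hG => /is_manifold_atlas. Qed.
Local Notation hA := lie_atlas.

Lemma lie2_atlas : is_atlas (prod_atlas AG AG).
Proof. by apply: prod_atlasP; exact: lie_atlas. Qed.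

Lemma mul_smooth p : msmooth_at (prod_atlas AG AG) AG (fun x => (x.1 * x.2)%g) p.
Proof. by case: hG => _ ms _; apply: ((msmoothP lie2_atlas lie_atlas _).1 ms). Qed.

Lemma inv_smooth p : msmooth_at AG AG (fun x => (x^-1)%g) p.
Proof. by case: hG => _ _ ms; apply: ((msmoothP lie_atlas lie_atlas _).1 ms). Qed.

Section products.
Context {E : normedModType R} {M : topologicalType} {hE : FinDim E} (A : atlas E M).
Hypothesis hM : is_atlas A.

Lemma msmooth_at_mul (f g : M -> G) p : msmooth_at A AG f p -> msmooth_at A AG g p ->
  msmooth_at A AG (fun x => (f x * g x)%g) p.
Proof.
move=> fs gs; have ps := msmooth_at_pair fs gs.
exact: (msmooth_at_comp hM lie2_atlas ps (mul_smooth _)).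
Qed.

Lemma msmooth_at_inv (f : M -> G) p : msmooth_at A AG f p ->
  msmooth_at A AG (fun x => (f x)^-1%g) p.
Proof. by move=> fs; exact: (msmooth_at_comp hM lie_atlas fs (inv_smooth _)). Qed.

Lemma mdiff_mul (f g : M -> G) p u : msmooth_at A AG f p -> msmooth_at A AG g p ->
  mdiff A AG (fun x => (f x * g x)%g) p u =
  mdiff AG AG (fun h => (h * g p)%g) (f p) (mdiff A AG f p u) +
  mdiff AG AG (fun h => (f p * h)%g) (g p) (mdiff A AG g p u).
Proof.
move=> fs gs; have ps := msmooth_at_pair fs gs.
rewrite (mdiff_comp hM lie2_atlas u ps (mul_smooth _)) (mdiff_pair u fs gs).
by rewrite (mdiff_partial hA hA _ _ (mul_smooth _)).
Qed.

End products.

Lemma lmul_smooth g p : msmooth_at AG AG (fun h => (g * h)%g) p.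
Proof.
by apply: msmooth_at_mul; [exact: lie_atlas|exact: msmooth_at_cst|exact: msmooth_at_id hA p].
Qed.

Lemma rmul_smooth g p : msmooth_at AG AG (fun h => (h * g)%g) p.
Proof.
by apply: msmooth_at_mul; [exact: lie_atlas|exact: msmooth_at_id hA p|exact: msmooth_at_cst].
Qed.

Lemma conj_smooth g p : msmooth_at AG AG (fun h => (g * h * g^-1)%g) p.
Proof.
apply: msmooth_at_mul; [exact: lie_atlas|exact: lmul_smooth|exact: msmooth_at_cst].
Qed.

Lemma Ad_linear g : linear (Ad g).
Proof. exact: mdiff_linear. Qed.

Lemma Ad0 g : Ad g 0 = 0.
Proof. by rewrite /Defs.Ad /mdiff linear0. Qed.

Lemma AdD g : {morph Ad g : x y / x + y}.
Proof. by move=> x y; have := Ad_linear g 1 x y; rewrite !scale1r. Qed.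

Lemma AdN g : {morph Ad g : x / - x}.
Proof. by move=> x; have := Ad_linear g (-1) x 0; rewrite !addr0 !scaleN1r Ad0 addr0. Qed.

Lemma AdZ g a x : Ad g (a *: x) = a *: Ad g x.
Proof. by have := Ad_linear g a x 0; rewrite addr0 Ad0 addr0. Qed.

Lemma conj1 (g : G) : (g * 1 * g^-1 = 1)%g.
Proof. by rewrite mulg1 mulgV. Qed.

Lemma Ad_mul g h x : Ad (g * h)%g x = Ad g (Ad h x).
Proof.
have e : (fun k => (g * h * k * (g * h)^-1)%g) = (fun k => (g * (h * k * h^-1) * g^-1)%g).
  by apply/funext => k; rewrite invgM !mulgA.
rewrite /Defs.Ad e; exact: (mdiff_comp_at hA hA (f := fun k => (h * k * h^-1)%g)
  (g := fun k => (g * k * g^-1)%g) x (conj1 h) (conj_smooth h 1%g) (conj_smooth g 1%g)).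
Qed.

Lemma Ad1 x : Ad 1%g x = x.
Proof.
rewrite /Defs.Ad (_ : (fun h => _) = fun h => h) ?mdiff_id//; first exact: lie_atlas.
by apply/funext => k; rewrite mul1g invg1 mulg1.
Qed.

Lemma AdVK g x : Ad g^-1%g (Ad g x) = x.
Proof. by rewrite -Ad_mul mulVg Ad1. Qed.

(** [smooth_partial] for (y1, y2) |-> y1 y2 y1^-1, which is constantly 1 on the slice y2 = 1. *)
Lemma Ad_smooth x p : msmooth_at AG (vec_atlas V) (fun g => Ad g x) p.
Proof.
have hP := lie2_atlas.
have fs : msmooth_at (prod_atlas AG AG) AG (fun y : G * G => (y.1 * y.2 * y.1^-1)%g) (p, 1%g).
  apply: msmooth_at_mul => //; first exact: mul_smooth.
  by apply: msmooth_at_inv => //; exact: msmooth_at_fst hA hA _.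
exact: (smooth_partial hA (c := 1%g) (f := fun y : G * G => (y.1 * y.2 * y.1^-1)%g) x conj1 fs).
Qed.

Lemma bracket_linearl y : linear (bracket ^~ y).
Proof. exact: mdiff_linear. Qed.

Lemma bracket_linearr x : linear (bracket x).
Proof.
move=> a y z; rewrite /Defs.bracket.
have sc w b : linear ( *:%R b : V -> V) by move=> c u v; rewrite scalerDr !scalerA mulrC.
have -> : (fun g => Ad g (a *: y + z)) = (fun g => a *: Ad g y + Ad g z).
  by apply/funext => g; exact: Ad_linear.
rewrite mdiff_D.
- congr (_ + _); apply: (mdiff_linear_comp hA); last exact: Ad_smooth.
  by move=> c u v; rewrite scalerDr !scalerA mulrC.
- apply: msmooth_at_linear; last exact: Ad_smooth.
  by move=> c u v; rewrite scalerDr !scalerA mulrC.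
- exact: Ad_smooth.
Qed.

(** The derivative at h = 1 of Ad_g Ad_h y = Ad_(g h g^-1) (Ad_g y). *)
Lemma Ad_bracket g x y : Ad g (bracket x y) = bracket (Ad g x) (Ad g y).
Proof.
rewrite {1}/Defs.bracket -(mdiff_linear_comp hA _ (Ad_linear g) (Ad_smooth y 1%g)).
have -> : (fun h => Ad g (Ad h y)) = (fun h => Ad (g * h * g^-1)%g (Ad g y)).
  by apply/funext => h; rewrite !Ad_mul AdVK.
by rewrite (mdiff_comp_at hA hA (f := fun h => (g * h * g^-1)%g)
  (g := fun h : G => Ad h (Ad g y)) x (conj1 g) (conj_smooth g 1%g) (Ad_smooth _ _)).
Qed.

End lie_group.

Section diagonal.
Context {R : realType} {E H : normedModType R} {M P : topologicalType} {hE : FinDim E}.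
Variables (A : atlas E M) (C : atlas H P).
Hypotheses (hA : is_atlas A).

(** Here the point of differentiation moves along with the parameter; constancy of f on the diagonal
    still fixes the target chart. The Maurer-Cartan forms, evaluated on a constant vector of a
    chart, are of this shape. *)
Lemma smooth_diag (f : M * M -> P) p c v :
  (forall x, f (x, x) = c) -> (forall x, msmooth_at (prod_atlas A A) C f (x, x)) ->
  smooth_at (fun z => mdiff A C (fun h => f (apoint A p z, h)) (apoint A p z)
    (mdiff (vec_atlas E) A (apoint A p) z v)) (acoord A p p).
Proof.
move=> fc fs; pose g := mrep (prod_atlas A A) C f (p, p); pose o := acoord A p p.
have gs : smooth_at g (o, o) by have [_] := fs p.
have ds : smooth_at (fun z : E => (z, z)) o by apply: smooth_at_pair; exact: smooth_at_id.
have gD : smooth_at (fun z => 'D_(0, v) g (z, z)) o.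
  by apply: (smooth_at_comp ds (g := 'D_(0, v) g)); exact: smooth_at_D.
apply: smooth_at_eq gD.
have gn : \forall z \near o, smooth_at g (z, z).
  exact: near_continuous (smooth_at_continuous ds) erefl (smooth_at_near gs).
have an := near_acodom hA (adom_id hA p).
apply: (@filterS2 _ _ (nbhs_filter _) _ _ _ _ gn an) => z gz za.
have hP : is_atlas (prod_atlas A A) by exact: prod_atlasP.
have fz : msmooth_at A C (fun h => f (apoint A p z, h)) (apoint A p z).
  exact: (msmooth_at_comp hA hP (msmooth_at_pairl A hA _ _) (fs _)).
rewrite -(mdiff_comp vec_atlasP hA v (msmooth_at_apoint hA za) fz).
rewrite -derive_pairl; last exact: smooth_at_differentiable.
rewrite deriveE; first by rewrite /g /mdiff /mrep /= !fc.
apply: (differentiable_comp (f := fun y => (z, y))); last exact: smooth_at_differentiable.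
exact: smooth_at_differentiable (smooth_at_pairl z z).
Qed.

End diagonal.

Section pairing.
Context {R : realType} {n : nat}.
Local Notation V := 'rV[R]_n.
Local Notation V' := 'cV[R]_n.

Lemma pair_linearr (mu : V') : linear (pair mu : V -> R^o).
Proof. by move=> a x y; rewrite /pair mulmxDl -scalemxAl !mxE. Qed.

Lemma pair_linearl (x : V) : linear ((pair (R := R) (n := n))^~ x : V' -> R^o).
Proof. by move=> a mu nu; rewrite /pair mulmxDr -scalemxAr !mxE. Qed.

Lemma pairDr (mu : V') x y : pair mu (x + y) = pair mu x + pair mu y.
Proof. by rewrite /pair mulmxDl mxE. Qed.

Lemma pairNr (mu : V') x : pair mu (- x) = - pair mu x.
Proof. by rewrite /pair mulNmx mxE. Qed.

Lemma pairDl (mu nu : V') x : pair (mu + nu) x = pair mu x + pair nu x.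
Proof. by rewrite /pair mulmxDr mxE. Qed.

Lemma pairNl (mu : V') x : pair (- mu) x = - pair mu x.
Proof. by rewrite /pair mulmxN mxE. Qed.

Lemma pair0l x : pair (0 : V') x = 0.
Proof. by rewrite /pair mulmx0 mxE. Qed.

Lemma pair0r (mu : V') : pair mu 0 = 0.
Proof. by rewrite /pair mul0mx mxE. Qed.

Lemma pairZl a (mu : V') x : pair (a *: mu) x = a * pair mu x.
Proof. by rewrite /pair -scalemxAr mxE. Qed.

Lemma pairZr a (mu : V') x : pair mu (a *: x) = a * pair mu x.
Proof. by rewrite /pair -scalemxAl mxE. Qed.

Lemma pair_inj (mu nu : V') : (forall x, pair mu x = pair nu x) -> mu = nu.
Proof.
move=> e; apply/colP => i; have := e (delta_mx 0 i).
by rewrite /pair -!rowE !mxE.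
Qed.

Lemma pair_vdualE (f : V -> R) x : linear (f : V -> R^o) -> pair (vdual f) x = f x.
Proof.
move=> lf; pose F : {linear V -> R^o} := HB.pack (f : V -> R^o) (GRing.isLinear.Build R V R^o _ _ lf).
exact: (pair_vdual F).
Qed.

End pairing.

Section lie_group.
Context {R : realType} {n : nat} {G : topGroupType}.
Variable AG : atlas 'rV[R]_n G.
Hypothesis hG : is_lie_group AG.
Local Notation V := 'rV[R]_n.
Local Notation V' := 'cV[R]_n.
Local Notation Ad := (Ad AG).
Local Notation bracket := (bracket AG).
Local Notation adstar := (adstar AG).
Local Notation Adstar := (Adstar AG).
Local Notation TR := (TR AG).
Local Notation hA := (lie_atlas hG).

(** The right and left Maurer-Cartan forms; they take values in the tangent space at the identity
    because g g^-1 = g^-1 g = 1. *)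
Definition rightMC (g : G) (u : V) : V := mdiff AG AG (fun h => (h * g^-1)%g) g u.
Definition leftMC (g : G) (u : V) : V := mdiff AG AG (fun h => (g^-1 * h)%g) g u.

Lemma mdiff_compG (f g k : G -> G) p q u : (forall x, g (f x) = k x) -> f p = q ->
  msmooth_at AG AG f p -> msmooth_at AG AG g q ->
  mdiff AG AG g q (mdiff AG AG f p u) = mdiff AG AG k p u.
Proof.
move=> /funext <- fp fs gs; apply/esym; exact: (mdiff_comp_at hA hA).
Qed.

Lemma TRK g u : rightMC g (TR g u) = u.
Proof.
rewrite -[RHS](mdiff_id hA 1%g); apply: mdiff_compG.
- by move=> x; rewrite mulgK.
- exact: mul1g.
- exact: rmul_smooth.
- exact: rmul_smooth.
Qed.

Lemma rightMCK g u : TR g (rightMC g u) = u.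
Proof.
rewrite -[RHS](mdiff_id hA g); apply: mdiff_compG.
- by move=> x; rewrite mulgVK.
- exact: mulgV.
- exact: rmul_smooth.
- exact: rmul_smooth.
Qed.

(** Left translation by g^-1 is right translation by g^-1 followed by conjugation by g^-1. *)
Lemma leftMC_rightMC g u : leftMC g u = Ad g^-1%g (rightMC g u).
Proof.
apply/esym; apply: mdiff_compG.
- by move=> x; rewrite invgK mulgA mulgVK.
- exact: mulgV.
- exact: rmul_smooth.
- exact: conj_smooth.
Qed.

Lemma TR_Ad g x : TR g (Ad g x) = mdiff AG AG (fun h => (g * h)%g) 1%g x.
Proof.
apply: mdiff_compG.
- by move=> h; rewrite mulgVK.
- exact: conj1.
- exact: conj_smooth.
- exact: rmul_smooth.
Qed.

Lemma rightMC_rmul g h u : rightMC (g * h)%g (mdiff AG AG (fun x => (x * h)%g) g u) = rightMC g u.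
Proof.
apply: mdiff_compG.
- by move=> x; rewrite invgM mulgA mulgK.
- by [].
- exact: rmul_smooth.
- exact: rmul_smooth.
Qed.

Lemma rightMC1 u : rightMC 1%g u = u.
Proof.
rewrite /rightMC (_ : (fun h => _) = fun h => h) ?(mdiff_id hA)//.
by apply/funext => k; rewrite invg1 mulg1.
Qed.

(** Leibniz' rule for the constant map x x^-1 at the identity. *)
Lemma mdiff_inv1 u : mdiff AG AG (fun h => (h^-1)%g) 1%g u = - u.
Proof.
have := mdiff_mul hG hA u (msmooth_at_id hA 1%g) (inv_smooth hG 1%g).
have -> : (fun x : G => (x * x^-1)%g) = fun=> 1%g by apply/funext => k; rewrite mulgV.
rewrite mdiff_cst (mdiff_id hA).
have -> : (fun h : G => (h * 1^-1)%g) = fun h => h by apply/funext => k; rewrite invg1 mulg1.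
have -> : (fun h : G => (1 * h)%g) = fun h => h by apply/funext => k; rewrite mul1g.
rewrite !(mdiff_id hA) => e; apply/eqP.
by rewrite -addr_eq0 addrC -e.
Qed.

Lemma Ad_smooth2 (M : topologicalType) (E : normedModType R) (hE : FinDim E) (A : atlas E M)
    (hM : is_atlas A) (f : M -> G) (x : M -> V) p :
  msmooth_at A AG f p -> msmooth_at A (vec_atlas V) x p ->
  msmooth_at A (vec_atlas V) (fun q => Ad (f q) (x q)) p.
Proof.
move=> fs [xc xs].
have -> : (fun q => Ad (f q) (x q)) = fun q => \sum_i (x q 0 i : R^o) *: Ad (f q) (delta_mx 0 i).
  apply/funext => q; rewrite {1}[x q]row_sum_delta.
  rewrite (big_morph (Ad (f q)) (AdD AG (f q)) (Ad0 AG (f q))).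
  by apply: eq_bigr => i _; rewrite AdZ.
have As i : msmooth_at A (vec_atlas V) (fun q => Ad (f q) (delta_mx 0 i)) p.
  exact: (msmooth_at_comp hM hA fs (Ad_smooth hG (delta_mx 0 i) (f p))).
apply: msmooth_at_vecI => //; apply: smooth_at_sum => i; apply: smooth_atZ.
  exact: (smooth_at_coord (A := x \o apoint A p) 0 i xs).
by have [_] := As i.
Qed.

End lie_group.

(** * Second-order part of the group law and the Maurer-Cartan equation *)

Section maurer_cartan.
Context {R : realType} {n : nat} {G : topGroupType}.
Variable AG : atlas 'rV[R]_n G.
Hypothesis hG : is_lie_group AG.
Local Notation V := 'rV[R]_n.
Local Notation Ad := (Ad AG).
Local Notation bracket := (bracket AG).
Local Notation hA := (lie_atlas hG).
Local Notation vV := (vec_atlas V).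
Local Notation pt := (apoint AG 1%g).
Local Notation o := (acoord AG 1%g 1%g).

(** The group law in the chart at the identity. [D u v] below is its mixed second derivative, along
    u in the first factor and v in the second; its antisymmetric part is the bracket. *)
Definition locmul (y : V * V) : V := acoord AG 1%g (pt y.1 * pt y.2)%g.

Local Notation D := (fun u v => 'D_(u : V, 0 : V) ('D_(0 : V, v : V) locmul) (o, o)).

Lemma dom1 : adom AG 1%g 1%g.
Proof. exact: (adom_id hA). Qed.

Lemma pt_o : pt o = 1%g.
Proof. exact: (acoordK hA dom1). Qed.

Lemma locmul_smooth : smooth_at locmul (o, o).
Proof. by have [_] := mul_smooth hG (1%g, 1%g); rewrite /mrep /= mulg1. Qed.

Lemma near_coord1 : \forall z \near o, acodom AG 1%g z.
Proof. exact: (near_acodom hA dom1). Qed.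

Lemma near_locmul_l : \forall z \near o, smooth_at locmul (z, o).
Proof.
exact: near_continuous (smooth_at_continuous (smooth_at_pairr o o)) erefl
  (smooth_at_near locmul_smooth).
Qed.

Lemma near_locmul_r : \forall z \near o, smooth_at locmul (o, z).
Proof.
exact: near_continuous (smooth_at_continuous (smooth_at_pairl o o)) erefl
  (smooth_at_near locmul_smooth).
Qed.

Lemma derive_locmul_l x w : acodom AG 1%g x -> smooth_at locmul (o, x) ->
  'D_(w, 0) locmul (o, x) =
  mdiff AG vV (acoord AG 1%g) (pt x) (mdiff AG AG (fun h => (h * pt x)%g) 1%g w).
Proof.
move=> xa ms.
have cs : msmooth_at AG vV (acoord AG 1%g) (pt x).
  exact: (msmooth_at_acoord hA (adom_apoint hA xa)).
rewrite -(mdiff_comp_at hA hA (f := fun h => (h * pt x)%g) w (mul1g _)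
  (rmul_smooth hG (pt x) 1%g) cs).
rewrite mdiffE; last first.
  have cs' : msmooth_at AG vV (acoord AG 1%g) (1 * pt x)%g by rewrite mul1g.
  exact: (msmooth_at_comp hA hA (rmul_smooth hG (pt x) 1%g) cs').
by rewrite -derive_pairr//; exact: smooth_at_differentiable.
Qed.

Lemma derive_locmul_r x w : acodom AG 1%g x -> smooth_at locmul (x, o) ->
  'D_(0, w) locmul (x, o) =
  mdiff AG vV (acoord AG 1%g) (pt x) (mdiff AG AG (fun h => (pt x * h)%g) 1%g w).
Proof.
move=> xa ms.
have cs : msmooth_at AG vV (acoord AG 1%g) (pt x).
  exact: (msmooth_at_acoord hA (adom_apoint hA xa)).
rewrite -(mdiff_comp_at hA hA (f := fun h => (pt x * h)%g) w (mulg1 _)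
  (lmul_smooth hG (pt x) 1%g) cs).
rewrite mdiffE; last first.
  have cs' : msmooth_at AG vV (acoord AG 1%g) (pt x * 1)%g by rewrite mulg1.
  exact: (msmooth_at_comp hA hA (lmul_smooth hG (pt x) 1%g) cs').
by rewrite -derive_pairl//; exact: smooth_at_differentiable.
Qed.

(** [TR_Ad] in coordinates: right translation by x applied to Ad_x v is left translation by x
    applied to v. No inverse occurs, so both sides can be differentiated in x through [locmul]
    alone. *)
Lemma near_Ad_locmul v : \forall x \near o,
  'D_(Ad (pt x) v, 0) locmul (o, x) = 'D_(0, v) locmul (x, o).
Proof.
apply: (@filterS3 _ _ (nbhs_filter _) _ _ _ _ _ near_coord1 near_locmul_l near_locmul_r).
move=> x xa xl xr; rewrite derive_locmul_l// derive_locmul_r//; congr (mdiff _ _ _ _ _).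
exact: (TR_Ad hG (pt x) v).
Qed.

Lemma locmul_l_id w : 'D_(w, 0) locmul (o, o) = w.
Proof.
rewrite -derive_pairr; last exact: smooth_at_differentiable locmul_smooth.
have -> : 'D_w (fun y => locmul (y, o)) o = 'D_w (@id V) o.
  apply: near_eq_derive.
  by apply: filterS near_coord1 => z za; rewrite /locmul /= pt_o mulg1 (apointK hA).
exact: derive_id.
Qed.

Lemma locmul_r_id w : 'D_(0, w) locmul (o, o) = w.
Proof.
rewrite -derive_pairl; last exact: smooth_at_differentiable locmul_smooth.
have -> : 'D_w (fun y => locmul (o, y)) o = 'D_w (@id V) o.
  apply: near_eq_derive.
  by apply: filterS near_coord1 => z za; rewrite /locmul /= pt_o mul1g (apointK hA).
exact: derive_id.
Qed.

(** Product rule for a directional derivative of [locmul] whose base point a x and direction l (w x)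
    both vary: a second derivative with the direction frozen, plus a first derivative along the
    variation of the direction. *)
Lemma derive_slice_comp (a : V -> V * V) (w : V -> V) (l : V -> V * V) u a' w0 :
  linear l -> smooth_at a o -> smooth_at w o -> a o = (o, o) ->
  'D_u a o = a' -> w o = w0 ->
  'D_u (fun x => 'D_(l (w x)) locmul (a x)) o =
  'D_a' ('D_(l w0) locmul) (o, o) + 'D_(l ('D_u w o)) locmul (o, o).
Proof.
move=> ll sa sw ao <- <-.
have ms := locmul_smooth; rewrite -ao in ms.
have da y (v : V * V) : smooth_at locmul y -> 'd locmul y v = 'D_v locmul y.
  by move=> /smooth_at_differentiable yd; rewrite deriveE.
have la y : linear (fun v => 'd locmul y (l v)) by move=> c x z; rewrite ll linearP.
have sl v : smooth_at (fun y => 'd locmul y (l v)) (a o).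
  apply: smooth_at_eq (smooth_at_D (l v) ms).
  by apply: filterS (smooth_at_near ms) => y /da ->.
have [_ d] := derive_form_comp (hF := FinDim_prod (FinDim_matrix R 1 n) (FinDim_matrix R 1 n))
  (hG := FinDim_matrix R 1 n) la sl sa sw.
have -> : 'D_u (fun x => 'D_(l (w x)) locmul (a x)) o = 'D_u (fun x => 'd locmul (a x) (l (w x))) o.
  apply: near_eq_derive.
  have := near_continuous (smooth_at_continuous sa) erefl (smooth_at_near ms).
  by apply: filterS => x /da ->.
have e1 : 'd locmul (a o) (l ('D_u w o)) = 'D_(l ('D_u w o)) locmul (o, o).
  by rewrite (da _ _ ms) ao.
have e2 : 'D_('D_u a o) (fun y => 'd locmul y (l (w o))) (a o) =
          'D_('D_u a o) ('D_(l (w o)) locmul) (o, o).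
  rewrite -[in RHS]ao; apply: near_eq_derive.
  by apply: filterS (smooth_at_near ms) => y /da ->.
exact: (etrans (d u) (f_equal2 +%R e2 e1)).
Qed.

Lemma addrAC_cancel (x y : V) : x + y - x = y.
Proof. by rewrite [x + y]addrC addrK. Qed.

(** Differentiating [near_Ad_locmul] along u at the identity gives D v u + [u, v] = D u v, since
    first derivatives of the group law at the identity are the identity. *)
Lemma bracket_locmul u v : bracket u v = D u v - D v u.
Proof.
have As := Ad_smooth hG v 1%g.
have -> : bracket u v = 'D_u (fun x => Ad (pt x) v) o by exact: mdiffE.
have As' : smooth_at (fun x => Ad (pt x) v) o by case: As.
have ll : linear (fun w : V => (w, 0 : V)).
  by move=> a x y; rewrite -[RHS]/(a *: x + y, a *: 0 + 0) scaler0 addr0.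
have ss : smooth_at (fun x : V => (o, x)) o by exact: smooth_at_pairl.
have du : 'D_u (fun x : V => (o, x)) o = (0, u).
  have [d dE] := is_diff_pair (is_diff_cst o o) (is_diff_id o).
  by rewrite (deriveE u d) dE.
have E2 : 'D_u (fun x => 'D_(Ad (pt x) v, 0) locmul (o, x)) o = D u v.
  transitivity ('D_u (fun x => 'D_(0, v) locmul (x, o)) o).
    apply: near_eq_derive; exact: near_Ad_locmul.
  apply: (derive_pairr (f := 'D_(0, v) locmul)).
  exact: smooth_at_differentiable (smooth_at_D _ locmul_smooth).
have E3 : 'D_(0, u) ('D_(v, 0) locmul) (o, o) = D v u by exact: derive_comm locmul_smooth.
have w0 : Ad (pt o) v = v by rewrite pt_o Ad1.
have E1 := derive_slice_comp ll ss As' erefl du w0.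
have E6 := locmul_l_id ('D_u (fun x => Ad (pt x) v) o).
have E7 := etrans (esym E2) (etrans E1 (f_equal2 +%R E3 E6)).
apply/esym; apply: (etrans (f_equal (fun z => z - D v u) E7)).
exact: (addrAC_cancel _ _).
Qed.

Lemma bracket_anti u v : bracket u v = - bracket v u.
Proof. by rewrite !bracket_locmul opprB. Qed.

Definition leftMC_coord (z v : V) : V := leftMC AG (pt z) (mdiff vV AG pt z v).

(** Translating back by z undoes the left Maurer-Cartan form: an implicit equation for it in terms
    of [locmul]. *)
Lemma near_leftMC_coord v : \forall z \near o, 'D_(0, leftMC_coord z v) locmul (z, o) = v.
Proof.
have cn := near_join near_coord1.
apply: (@filterS3 _ _ (nbhs_filter _) _ _ _ _ _ near_coord1 near_locmul_l cn).
move=> z za zl zn; rewrite derive_locmul_r// /leftMC_coord /leftMC.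
have ps : msmooth_at vV AG pt z by exact: (msmooth_at_apoint hA za).
have cs : msmooth_at AG vV (acoord AG 1%g) (pt z).
  exact: (msmooth_at_acoord hA (adom_apoint hA za)).
rewrite (mdiff_compG hG (k := fun h => h) _ _ (mulVg (pt z)) (lmul_smooth hG _ _) (lmul_smooth hG _ _)).
  rewrite (mdiff_id hA) -(mdiff_comp vec_atlasP hA v ps cs) mdiff_vec.
  have nd : \forall y \near z, y = acoord AG 1%g (pt y).
    by apply: filterS zn => y ya; rewrite (apointK hA).
  have dd : 'd (fun y : V => y) z = 'd (fun y => acoord AG 1%g (pt y)) z :> (V -> V).
    exact: (near_diff nd (smooth_at_differentiable (smooth_at_id z))).
  have li : linear (fun y : V => y).
    by move=> a x y.
  have dv : 'd (fun y : V => y) z v = v by exact: (diff_linear z v li).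
  exact: (etrans (f_equal (@^~ v) (esym dd)) dv).
by move=> x; rewrite mulVKg.
Qed.

Lemma leftMC_coord_smooth v : smooth_at (fun z => leftMC_coord z v) o.
Proof.
have hP := lie2_atlas hG.
have fc (x : G) : (x^-1 * x)%g = 1%g :> G by exact: mulVg.
have fs (x : G) : msmooth_at (prod_atlas AG AG) AG (fun y : G * G => (y.1^-1 * y.2)%g) (x, x).
  apply: (msmooth_at_mul hG hP); last exact: msmooth_at_snd hA hA _.
  by apply: (msmooth_at_inv hG hP); exact: msmooth_at_fst hA hA _.
exact: (@smooth_diag R V V G G (FinDim_matrix R 1 n) AG AG hA _ 1%g 1%g v fc fs).
Qed.

(** The derivative of [near_leftMC_coord], whose right-hand side is constant: 0 = D u v + D_u of the
    form. Antisymmetrized with [bracket_locmul], this is the Maurer-Cartan equation at the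
    identity. *)
Lemma derive_leftMC_coord u v : 'D_u (fun z => leftMC_coord z v) o = - D u v.
Proof.
have ll : linear (fun w : V => (0 : V, w)).
  by move=> a x y; rewrite -[RHS]/(a *: 0 + 0, a *: x + y) scaler0 addr0.
have ss : smooth_at (fun x : V => (x, o)) o by exact: smooth_at_pairr.
have du : 'D_u (fun x : V => (x, o)) o = (u, 0).
  have [d dE] := is_diff_pair (is_diff_id o) (is_diff_cst o o).
  by rewrite (deriveE u d) dE.
have E2 : 'D_u (fun x => 'D_(0, leftMC_coord x v) locmul (x, o)) o = 0.
  rewrite (near_eq_derive (g := cst v)); last exact: near_leftMC_coord.
  exact: derive_cst.
have E3 : leftMC_coord o v = v by have := nbhs_singleton (near_leftMC_coord v); rewrite locmul_r_id.
have E1 := derive_slice_comp ll ss (leftMC_coord_smooth v) erefl du E3.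
have E5 := locmul_r_id ('D_u (fun z => leftMC_coord z v) o).
have E6 : 0 = D u v + 'D_u (fun z => leftMC_coord z v) o.
  exact: (etrans (esym E2) (etrans E1 (f_equal (fun z => D u v + z) E5))).
exact: (esym (addr0_eq (esym E6))).
Qed.

End maurer_cartan.

(** * Orbits of equivariant maps *)

Lemma findim_coordinates (R : realType) (E : normedModType R) : FinDim E ->
  exists N (e : 'rV[R]_N -> E) (c : E -> 'rV[R]_N), [/\ linear e, linear c & cancel c e].
Proof.
move=> [N [e [c [_ ce]]]]; exists N, (fun x => \sum_i x 0 i *: e i), (fun x => \row_i c i x).
split=> [a x y|a x y|x].
- rewrite scaler_sumr -big_split; apply: eq_bigr => i _.
  by rewrite !mxE scalerDl scalerA.
- by apply/rowP => i; rewrite !mxE linearP.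
- by rewrite [RHS]ce; apply: eq_bigr => i _; rewrite mxE.
Qed.

Lemma linear_mulmx (R : realType) M N (l : 'rV[R]_M -> 'rV[R]_N) :
  linear l -> exists A, forall x, l x = x *m A.
Proof.
move=> ll; pose L : {linear 'rV[R]_M -> 'rV[R]_N} :=
  HB.pack l (GRing.isLinear.Build R _ _ _ _ ll).
by exists (lin1_mx L) => x; rewrite mul_rV_lin1.
Qed.

Section equivariant_map.
Context {R : realType} {E W : normedModType R} {hE : FinDim E} {hW : FinDim W}.
Context {K : topologicalType} (AK : atlas E K).
Hypothesis hK : is_atlas AK.
Variables (mul : K -> K -> K) (one : K) (inv : K -> K).
Hypotheses (mulA : forall a b c, mul (mul a b) c = mul a (mul b c))
  (mul1 : forall a, mul one a = a) (mulr1 : forall a, mul a one = a)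
  (mulV : forall a, mul (inv a) a = one) (mulrV : forall a, mul a (inv a) = one).
Hypothesis (lmulS : forall b p, msmooth_at AK AK (mul b) p).
Variables (Phi : K -> W) (T : K -> W -> W).
Hypotheses (PhiS : forall p, msmooth_at AK (vec_atlas W) Phi p)
  (TL : forall b, linear (T b)) (PhiM : forall a b, Phi (mul b a) = T b (Phi a)).

(** Equivariance bounds the rank of Phi near the identity by the rank there, so the constant rank
    theorem applies. S is a section of P o Phi, and near its image P determines Phi; the last clause
    holds around every S c, which later makes chart domains open. *)
Lemma local_slice : exists d (P : W -> 'rV[R]_d) (S : 'rV[R]_d -> K) (D : set 'rV[R]_d),
  [/\ linear P, open D, D (P (Phi one)), S (P (Phi one)) = one &
      forall c, D c -> [/\ msmooth_at (vec_atlas 'rV[R]_d) AK S c, P (Phi (S c)) = c &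
        \forall x \near S c, D (P (Phi x)) /\ Phi (S (P (Phi x))) = Phi x]].
Proof.
have [N [e [c [le lc ec]]]] := findim_coordinates hE.
have [M [eW [cW [leW lcW ecW]]]] := findim_coordinates hW.
pose o := acoord AK one one; pose y0 := c o.
(* Phi in row coordinates on both sides. The coordinates on the source may be redundant, in which
   case f is constant along the kernel of e. *)
pose f y := cW (Phi (apoint AK one (e y))).
have oc : acodom AK one o by exact: acodom_acoord (adom_id hK one).
have ey0 : e y0 = o by exact: ec.
have se x : smooth_at e x by exact: smooth_at_linear.
have fS y : acodom AK one (e y) -> smooth_at f y.
  move=> yc; apply/msmooth_at_vecP; apply: msmooth_at_linear => //.
  have s1 : msmooth_at (vec_atlas 'rV[R]_N) AK (fun y => apoint AK one (e y)) y.
    have e1 : msmooth_at (vec_atlas 'rV[R]_N) (vec_atlas E) e y by apply/msmooth_at_vecP.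
    exact: (msmooth_at_comp vec_atlasP vec_atlasP e1 (msmooth_at_apoint hK yc)).
  exact: (msmooth_at_comp vec_atlasP hK s1 (PhiS _)).
have near_cod : \forall y \near y0, acodom AK one (e y).
  exact: near_continuous (smooth_at_continuous (se y0)) ey0 (near_acodom hK (adom_id hK one)).
have rk : \forall y \near y0, (\rank ('J f y) <= \rank ('J f y0))%N.
  apply: filterS near_cod => y yc.
  pose b := apoint AK one (e y).
  (* Left translation taking b to the identity, in coordinates. By equivariance f is f o h followed
     by the matrix A of T b, which bounds the rank of f at y by that at y0. *)
  pose h y' := c (acoord AK one (mul (inv b) (apoint AK one (e y')))).
  have hy : mul (inv b) (apoint AK one (e y)) = one by rewrite mulV.
  have s1 : msmooth_at (vec_atlas 'rV[R]_N) AK (fun y => apoint AK one (e y)) y.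
    have e1 : msmooth_at (vec_atlas 'rV[R]_N) (vec_atlas E) e y by apply/msmooth_at_vecP.
    exact: (msmooth_at_comp vec_atlasP vec_atlasP e1 (msmooth_at_apoint hK yc)).
  have s2 : msmooth_at (vec_atlas 'rV[R]_N) AK (fun y => mul (inv b) (apoint AK one (e y))) y.
    exact: (msmooth_at_comp vec_atlasP hK s1 (lmulS _ _)).
  have sh : smooth_at h y.
    apply/msmooth_at_vecP; apply: msmooth_at_linear => //.
    apply: (msmooth_at_comp vec_atlasP hK s2); rewrite hy.
    exact: (msmooth_at_acoord hK (adom_id hK one)).
  have [A fA] : exists A, forall x, cW (T b (eW x)) = x *m A.
    by apply: linear_mulmx => a u v; rewrite leW TL lcW.
  have fE : \forall y' \near y, f (h y') *m A = f y'.
    have n1 := near_continuous (proj1 s2) hy (near_adom hK (adom_id hK one)).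
    apply: filterS n1 => y' yd; rewrite -fA /f ecW /h ec (acoordK hK yd) -PhiM.
    by rewrite -mulA mulrV mul1.
  have hyy : h y = y0 by rewrite /h hy.
  have fy := smooth_at_differentiable (fS y yc).
  have fy0 : differentiable f (h y).
    by rewrite hyy; apply: smooth_at_differentiable; apply: fS; rewrite ey0.
  have hd := smooth_at_differentiable sh.
  have -> : 'J f y = 'J h y *m 'J f y0 *m A.
    apply/row_matrixP => i; rewrite !rowE -jacobianE -(deriveE _ fy).
    have dm : differentiable (f \o h) y by exact: differentiable_comp.
    have <- := near_eq_derive (delta_mx 0 i) fE.
    rewrite (derive_mulmxr A (delta_mx 0 i) dm) (deriveE _ dm) (diff_comp hd fy0) /=.
    by rewrite !jacobianE hyy !mulmxA.
  exact: leq_trans (mxrankM_maxl _ _) (mxrankM_maxr _ _).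
have fy0 : smooth_at f y0 by apply: fS; rewrite ey0.
have [P [s [r [U [[r0 oU] sf sP fU]]]]] := constant_rank fy0 rk.
have f0 : f y0 = cW (Phi one) by rewrite /f ey0 (acoordK hK (adom_id hK one)).
have Pc : linear (fun w => cW w *m P) by move=> a x y; rewrite lcW mulmxDl scalemxAl.
pose B := ball (f y0 *m P) r.
have oB : open B by exact: ball_open.
have B0 : B (f y0 *m P) by exact: ballxx.
have sc c1 : B c1 -> {for c1, continuous s}.
  by move=> /sP[/smooth_at_continuous].
(* The ball is shrunk so that s takes values in the image of the chart. *)
have [D [oD D0 DB Dc]] : exists D, [/\ open D, D (f y0 *m P), D `<=` B &
    forall c1, D c1 -> acodom AK one (e (s c1))].
  have n1 : \forall c1 \near f y0 *m P, acodom AK one (e (s c1)).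
    exact: near_continuous (sc _ B0) sf near_cod.
  have : nbhs (f y0 *m P) (B `&` [set c1 | acodom AK one (e (s c1))]).
    by apply: (@filterI _ _ (nbhs_filter _)) => //; exact: open_nbhs_nbhs.
  rewrite nbhsE => -[D [oD D0] DI]; exists D; split=> // c1 /DI[] //.
exists _, (fun w => cW w *m P), (fun c1 => apoint AK one (e (s c1))), D; split => //.
- by rewrite -f0.
- by rewrite -f0 sf ey0 (acoordK hK (adom_id hK one)).
move=> c1 Dc1; have [ss Us fs] := sP _ (DB _ Dc1); have cc := Dc _ Dc1.
have ss1 : msmooth_at (vec_atlas 'rV[R]_(\rank ('J f y0))) AK (fun c1 => apoint AK one (e (s c1))) c1.
  have es : msmooth_at (vec_atlas 'rV[R]_(\rank ('J f y0))) (vec_atlas E) (fun c1 => e (s c1)) c1.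
    by apply: msmooth_at_linear => //; apply/msmooth_at_vecP.
  exact: (msmooth_at_comp vec_atlasP vec_atlasP es (msmooth_at_apoint hK cc)).
split => //; set x1 := apoint AK one (e (s c1)).
have x1d : adom AK one x1 by exact: adom_apoint.
(* The coordinates c need not be injective on the image of s: the path
   x |-> s c1 + c (acoord x - acoord x1) stays in the domain of the slice. *)
pose g x := s c1 + c (acoord AK one x - e (s c1)).
have gx1 : g x1 = s c1.
  have c0 : c 0 = 0 by have := lc (-1) 0 0; rewrite scaler0 addr0 scaleN1r addNr.
  by rewrite /g /x1 (apointK hK cc) subrr c0 addr0.
have gc : {for x1, continuous g}.
  have ac := acoord_continuous hK x1d.
  have sub : {for x1, continuous (fun x => acoord AK one x - e (s c1))}.
    by apply: cvgB => //; exact: cvg_cst.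
  have cc' : {for acoord AK one x1 - e (s c1), continuous c}.
    by apply: smooth_at_continuous; exact: smooth_at_linear.
  by apply: cvgD; [exact: cvg_cst|exact: (continuous_comp sub cc')].
have eg x : e (g x) = acoord AK one x.
  by have := le 1 (s c1) (c (acoord AK one x - e (s c1))); rewrite !scale1r ec addrC subrK.
have fg x : adom AK one x -> f (g x) = cW (Phi x).
  by move=> xd; rewrite /f eg (acoordK hK xd).
have n1 := near_adom hK x1d.
have n2 := near_continuous gc gx1 (open_nbhs_nbhs (conj (proj1 oU) Us)).
have PP : smooth_at (fun w => cW w *m P) (Phi x1) by exact: smooth_at_linear.
have Px1 : cW (Phi x1) *m P = c1 by exact: fs.
have n3 : \forall x \near x1, D (cW (Phi x) *m P).
  have Pcc := continuous_comp (proj1 (PhiS x1)) (smooth_at_continuous PP).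
  exact: near_continuous Pcc Px1 (open_nbhs_nbhs (conj oD Dc1)).
apply: (@filterS3 _ _ (nbhs_filter x1) _ _ _ _ _ n1 n2 n3) => x xd Ux Dx; split => //.
have [_ fsf] := fU _ Ux; rewrite (fg _ xd) in fsf.
by apply: (can_inj ecW); exact: fsf.
Qed.

End equivariant_map.

(** * Second countability, Hausdorff spaces and quotients by fibres *)

Lemma second_countableP (T : topologicalType) : @second_countable T <->
  exists2 B : set (set T), countable B & B `<=` open /\
    forall x U, nbhs x U -> exists V, [/\ B V, V x & V `<=` U].
Proof.
split=> -[B cB [oB hB]]; exists B => //; split => // x.
  by move=> U /(hB x)[V [BV Vx] VU]; exists V.
by move=> U /(hB x)[V [BV Vx VU]]; exists V.
Qed.

Lemma second_countable_image (T U : topologicalType) (f : T -> U) :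
  continuous f -> (forall O : set T, open O -> open (f @` O)) ->
  (forall y, exists x, f x = y) -> @second_countable T -> @second_countable U.
Proof.
move=> fc fo fs /second_countableP[B cB [oB hB]]; apply/second_countableP.
exists ((fun V => f @` V) @` B); first exact: sub_countable (card_image_le _ _) cB.
split=> [_ [V BV <-]|y O]; first by apply: fo; exact: oB.
have [x <-] := fs y => /fc /hB[V [BV Vx VO]].
by exists (f @` V); split=> [||_ [z /VO Oz <-]]; [exists V|exists x|].
Qed.

Lemma second_countable_prod (T U : topologicalType) :
  @second_countable T -> @second_countable U -> @second_countable (T * U)%type.
Proof.
move=> /second_countableP[B cB [oB hB]] /second_countableP[C cC [oC hC]]; apply/second_countableP.
exists ((fun p => p.1 `*` p.2) @` (B `*` C)).
  exact: sub_countable (card_image_le _ _) (countableX cB cC).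
split=> [_ [[V V'] [/= BV CV] <-]|[x y] O]; first by apply: open_setX; [exact: oB|exact: oC].
case=> -[U1 U2] [/= /hB[V [BV Vx VO]] /hC[V' [CV Vy VO']]] hO.
exists (V `*` V'); split => //; first by exists (V, V').
by move=> [a b] [/= Va Vb]; apply: hO; split; [exact: VO|exact: VO'].
Qed.

Lemma second_countable_rV (R : realType) n : @second_countable 'rV[R]_n.
Proof.
apply/second_countableP.
pose b (p : 'rV[rat]_n * nat) : set 'rV[R]_n := ball (map_mx ratr p.1 : 'rV[R]_n) p.2.+1%:R^-1.
exists (range b); first exact: sub_countable (card_image_le _ _) (countableP _).
split=> [_ [p _ <-]|x U]; first by apply: ball_open; rewrite invr_gt0.
rewrite -nbhs_ballE => -[e /= e0 eU].
(* With 1/(k+1) < e/2 and a rational centre within 1/(k+1) of x, the ball around that centre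
   contains x and stays in the e-ball of x. *)
have [k] := ltr_add_invr (divr_gt0 e0 (ltr0Sn R 1)); rewrite add0r => ke.
have k0 : 0 < (k.+1%:R : R)^-1 by rewrite invr_gt0.
have qP i : exists q : rat, ratr q \in `]x 0 i, (x 0 i + k.+1%:R^-1)[.
  by apply: rat_in_itvoo; rewrite ltrDl.
have [q hq] := choice qP; exists (b (\row_i q i, k)).
have qx : ball (map_mx ratr (\row_i q i) : 'rV[R]_n) k.+1%:R^-1 x.
  split => // i j; rewrite !mxE ord1 -ball_normE /=; have := hq j.
  by rewrite in_itv /= => /andP[h1 h2]; rewrite ger0_norm ?subr_ge0 ?(ltW h1)// ltrBlDl.
split => //; first by exists (\row_i q i, k).
move=> z qz; apply: eU; rewrite [e]splitr.
apply: (@ball_triangle _ _ (map_mx ratr (\row_i q i) : 'rV[R]_n)).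
  by apply: le_ball (ball_sym qx); exact: ltW.
by apply: le_ball qz; exact: ltW.
Qed.

(** The last clause is the quotient topology; [iota] is Phi at a chosen representative. *)
Lemma fibre_quotient (K : topologicalType) (W : Type) (Phi : K -> W) :
  exists (Q : topologicalType) (pi : K -> Q) (iota : Q -> W),
    [/\ forall x, iota (pi x) = Phi x, injective iota, forall q, exists x, pi x = q &
        forall U, open U <-> open (pi @^-1` U)].
Proof.
pose r x y := `[< Phi x = Phi y >].
have rr : reflexive r by move=> x; exact/asboolP.
have rs : symmetric r by move=> x y; apply/asboolP/asboolP.
have rt : transitive r by move=> y x z /asboolP xy /asboolP yz; apply/asboolP; rewrite xy.
pose e := EquivRel r rr rs rt.
pose Q := quotient_topology {eq_quot e}%qT.
pose p : K -> Q := (\pi_Q)%qT.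
have pP x y : p x = p y <-> Phi x = Phi y.
  by split=> [/eqmodP/asboolP//|xy]; apply/eqmodP/asboolP.
have pK (q : Q) : p (repr q) = q by exact: reprK.
have ip x : Phi (repr (p x)) = Phi x by apply/pP; rewrite pK.
exists Q, p, (fun q => Phi (repr q)); split => //.
- by move=> q q' /pP; rewrite !pK.
- by move=> q; exists (repr q).
Qed.

Lemma hausdorff_injective (T U : topologicalType) (f : T -> U) :
  continuous f -> injective f -> hausdorff_space U -> hausdorff_space T.
Proof.
move=> fc fi hU x y xy; apply: fi; apply: hU => A B Ax By.
have [z [Az Bz]] := xy _ _ (fc _ _ Ax) (fc _ _ By); by exists (f z).
Qed.

(** * The manifold structure on the quotient by the fibres *)

Section orbit_manifold.
Context {R : realType} {E W : normedModType R} {hE : FinDim E} {hW : FinDim W}.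
Context {K : topologicalType} (AK : atlas E K).
Hypotheses (hK : is_atlas AK) (cK : @second_countable K).
Variables (mul : K -> K -> K) (one : K) (inv : K -> K).
Hypotheses (mulA : forall a b c, mul (mul a b) c = mul a (mul b c))
  (mul1 : forall a, mul one a = a) (mulr1 : forall a, mul a one = a)
  (mulV : forall a, mul (inv a) a = one) (mulrV : forall a, mul a (inv a) = one).
Hypotheses (lmulS : forall b p, msmooth_at AK AK (mul b) p)
  (rmulS : forall b p, msmooth_at AK AK (mul^~ b) p).
Variables (Phi : K -> W) (T : K -> W -> W).
Hypotheses (PhiS : forall p, msmooth_at AK (vec_atlas W) Phi p)
  (TL : forall b, linear (T b)) (PhiM : forall a b, Phi (mul b a) = T b (Phi a))
  (TK : forall b w, T (inv b) (T b w) = w) (TKV : forall b w, T b (T (inv b) w) = w).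

(** The element x^-1 y stabilizes Phi one, and right translation by the stabilizer preserves every
    fibre. *)
Lemma fibre_rmul x y z : Phi x = Phi y -> Phi (mul z (mul (inv x) y)) = Phi z.
Proof. by move=> xy; rewrite PhiM PhiM -xy -PhiM mulV -PhiM mulr1. Qed.

(** Right translation by y^-1 x takes y to x and preserves Phi, so a condition on Phi valid near one
    point of a fibre is valid near all its points. *)
Lemma near_fibre x y (A : set W) : Phi x = Phi y ->
  (\forall z \near x, A (Phi z)) -> \forall z \near y, A (Phi z).
Proof.
move=> xy nA; pose k := mul (inv y) x.
have yk : mul y k = x by rewrite /k -mulA mulrV mul1.
have n1 := near_continuous (proj1 (rmulS k y)) yk nA.
by apply: filterS n1 => z; rewrite /= (fibre_rmul z (esym xy)).
Qed.

Variables (Q : topologicalType) (pi : K -> Q) (iota : Q -> W).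
Hypotheses (iotaE : forall x, iota (pi x) = Phi x) (iotaI : injective iota)
  (piS : forall q, exists x, pi x = q) (openQ : forall U, open U <-> open (pi @^-1` U)).
Variables (rep : Q -> K).
Hypothesis repK : forall q, pi (rep q) = q.
Variables (d : nat) (P : W -> 'rV[R]_d) (S : 'rV[R]_d -> K) (D : set 'rV[R]_d).
Hypotheses (PL : linear P) (oD : open D) (D0 : D (P (Phi one))) (S0 : S (P (Phi one)) = one)
  (SP : forall c, D c -> [/\ msmooth_at (vec_atlas 'rV[R]_d) AK S c, P (Phi (S c)) = c &
        \forall x \near S c, D (P (Phi x)) /\ Phi (S (P (Phi x))) = Phi x]).

Lemma quotient_map_continuous : continuous pi.
Proof. by apply/continuousP => U oU; apply/openQ. Qed.

Lemma iota_continuous : continuous iota.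
Proof.
apply/continuousP => U oU; apply/openQ.
have -> : pi @^-1` (iota @^-1` U) = Phi @^-1` U.
  by apply/seteqP; split=> x /=; rewrite iotaE.
by apply: open_comp => // x _; exact: (proj1 (PhiS x)).
Qed.

Lemma pi_open U : open U -> open (pi @` U).
Proof.
move=> oU; apply/openQ; rewrite openE => y [x Ux xy].
have xy' : Phi x = Phi y by rewrite -!iotaE xy.
have nx : \forall z \near x, (Phi @` U) (Phi z).
  by apply: filterS (open_nbhs_nbhs (conj oU Ux)) => z Uz; exists z.
apply: filterS (near_fibre xy' nx) => z [u Uu uz]; exists u => //.
by apply: iotaI; rewrite !iotaE.
Qed.

Let slice (w : W) := D (P w) /\ Phi (S (P w)) = w.
Let co (q p : Q) := P (T (inv (rep q)) (iota p)).
Let slice_at (q : Q) (c : 'rV[R]_d) := mul (rep q) (S c).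
(** The slice through the identity, translated by a representative of q, gives the chart at q. Hence
    all charts have the same image D. *)
Definition orbit_atlas : atlas 'rV[R]_d Q :=
  Atlas (fun q p => slice (T (inv (rep q)) (iota p))) co (fun q c => pi (slice_at q c)).
Local Notation AQ := orbit_atlas.
Local Notation vd := (vec_atlas 'rV[R]_d).
Local Notation vW := (vec_atlas W).

Let T_sect q c : T (inv (rep q)) (iota (pi (slice_at q c))) = Phi (S c).
Proof. by rewrite iotaE PhiM TK. Qed.

Let slice_S c : D c -> slice (Phi (S c)).
Proof. by move=> Dc; have [_ e _] := SP Dc; rewrite /slice e. Qed.

Let co_sect q c : D c -> co q (pi (slice_at q c)) = c.
Proof. by move=> Dc; rewrite /co T_sect; have [] := SP Dc. Qed.

Let sect_co q p : adom AQ q p -> pi (slice_at q (co q p)) = p.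
Proof. by case=> _ e; apply: iotaI; rewrite iotaE PhiM /co e TKV. Qed.

Let adom_sect q c : D c -> adom AQ q (pi (slice_at q c)).
Proof. by move=> Dc; rewrite /= T_sect; exact: slice_S. Qed.

Let T_rep q : T (inv (rep q)) (iota q) = Phi one.
Proof. by rewrite -{2}(repK q) iotaE -PhiM mulV. Qed.

Let adom_self q : adom AQ q q.
Proof. by rewrite /= T_rep; rewrite -S0; exact: slice_S. Qed.

Let co_self q : co q q = P (Phi one).
Proof. by rewrite /co T_rep. Qed.

Let acodomE q : acodom AQ q = D.
Proof.
apply/seteqP; split=> [_ [p [Dp _] <-] //|c Dc].
by exists (pi (slice_at q c)); [exact: adom_sect|exact: co_sect].
Qed.

Let sect_smooth q c : D c -> msmooth_at vd AK (slice_at q) c.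
Proof. by move=> Dc; have [s _ _] := SP Dc; exact: (msmooth_at_comp vec_atlasP hK s (lmulS _ _)). Qed.

Let PT_linear q : linear (fun w => P (T (inv (rep q)) w)).
Proof. by move=> a u v; rewrite TL PL. Qed.

Let PTPhi_smooth q x : msmooth_at AK vd (fun x => P (T (inv (rep q)) (Phi x))) x.
Proof. exact: (msmooth_at_linear (PT_linear q) (PhiS x)). Qed.

(** The slice condition holds near S c; [near_fibre] carries it to the point rep(q)^-1 y of the same
    fibre, and left translation to y. *)
Lemma orbit_chart_open q : open (adom AQ q).
Proof.
apply/openQ; rewrite openE => y [Dy ey]; pose c := co q (pi y).
have [_ _ n1] := SP (Dy : D c).
have e1 : Phi (S c) = Phi (mul (inv (rep q)) y) by rewrite /c [LHS]ey iotaE PhiM.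
have n2 := near_fibre (A := slice) e1 n1.
have n3 := near_continuous (proj1 (lmulS (inv (rep q)) y)) erefl n2.
by apply: filterS n3 => z; rewrite /= iotaE PhiM.
Qed.

Lemma orbit_is_manifold : is_manifold AQ.
Proof.
split.
- apply: hausdorff_injective iota_continuous iotaI _; exact: norm_hausdorff.
- exact: second_countable_image quotient_map_continuous pi_open piS cK.
- move=> q; split; [exact: orbit_chart_open|exact: adom_self|by rewrite acodomE|].
  by move=> p; exact: sect_co.
- move=> q; split=> [p _|c].
    have lc : {for iota p, continuous (fun w => P (T (inv (rep q)) w))}.
      by apply: smooth_at_continuous; apply: smooth_at_linear; exact: PT_linear.
    exact: (continuous_comp (@iota_continuous p) lc).
  rewrite acodomE => Dc; have [sc _] := sect_smooth q Dc.
  exact: (continuous_comp sc (@quotient_map_continuous _)).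
- move=> p q k; apply: Ck_on_pointwise => _ [x [[Dx ex] _] <-].
  suff : smooth_at (acoord AQ q \o apoint AQ p) (co p x) by move=> /nbhs_singleton; apply.
  have s : msmooth_at vd vd (fun c => P (T (inv (rep q)) (Phi (slice_at p c)))) (co p x).
    exact: (msmooth_at_comp vec_atlasP hK (sect_smooth p (Dx : D (co p x))) (PTPhi_smooth q _)).
  have -> : acoord AQ q \o apoint AQ p = fun c => P (T (inv (rep q)) (Phi (slice_at p c))).
    by apply/funext => c; rewrite /= /co iotaE.
  by move/msmooth_at_vecP: s.
Qed.

Let hQ : is_atlas AQ. Proof. exact: is_manifold_atlas orbit_is_manifold. Qed.

Lemma pi_smooth a : msmooth_at AK AQ pi a.
Proof.
split; first exact: quotient_map_continuous.
have [_ s] := PTPhi_smooth (pi a) a.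
have e : mrep AK AQ pi a = (fun x => P (T (inv (rep (pi a))) (Phi x))) \o apoint AK a.
  by apply/funext => y; rewrite /mrep /= /co iotaE.
by rewrite e.
Qed.

Lemma iota_smooth q : msmooth_at AQ vW iota q.
Proof.
split; first exact: iota_continuous.
have Dq : D (co q q) by rewrite co_self.
have s : msmooth_at vd vW (fun c => Phi (slice_at q c)) (co q q).
  exact: (msmooth_at_comp vec_atlasP hK (sect_smooth q Dq) (PhiS _)).
have e : mrep AQ vW iota q = fun c => Phi (slice_at q c).
  by apply/funext => c; rewrite /mrep /= iotaE.
by rewrite e; move/msmooth_at_vecP: s.
Qed.

(** The chart at q is the linear map P o T (rep(q)^-1) after [iota], so that this linear map is a
    left inverse of the differential. *)
Lemma iota_immersion q : injective (mdiff AQ vW iota q).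
Proof.
apply: (@can_inj _ _ _ (fun w => P (T (inv (rep q)) w))) => u.
rewrite -(mdiff_linear_comp hQ u (PT_linear q) (iota_smooth q)).
exact: (mdiff_acoord hQ q u).
Qed.

Lemma section_smooth q c : acodom AQ q c ->
  msmooth_at vd AK (slice_at q) c /\ pi (slice_at q c) = apoint AQ q c.
Proof. by rewrite acodomE => Dc; split => //; exact: sect_smooth. Qed.

(** The section over the chart at q = pi a, right translated by the stabilizer element k = rep(q)^-1
    a, is a section of pi through a itself. *)
Lemma pi_submersion a v : exists u, mdiff AK AQ pi a u = v.
Proof.
pose q := pi a; pose k := mul (inv (rep q)) a.
have ra : Phi (rep q) = Phi a by rewrite -!iotaE repK.
have rk : mul (rep q) k = a by rewrite /k -mulA mulrV mul1.
have Dq : D (co q q) by rewrite co_self.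
pose sg c := mul (slice_at q c) k.
have sga : sg (co q q) = a by rewrite /sg /slice_at co_self S0 mulr1.
have sgs : msmooth_at vd AK sg (co q q).
  exact: (msmooth_at_comp vec_atlasP hK (sect_smooth q Dq) (rmulS k _)).
exists (mdiff vd AK sg (co q q) v).
rewrite -(mdiff_comp_at vec_atlasP hK (f := sg) (g := pi) v sga sgs (pi_smooth a)).
have -> : (fun c => pi (sg c)) = apoint AQ q.
  by apply/funext => c; apply: iotaI; rewrite /= !iotaE (fibre_rmul _ ra).
exact: (mdiff_apoint hQ q v).
Qed.

End orbit_manifold.

(* Q carries the quotient topology of K, which may be finer than the one induced
   by iota. *)
Theorem equivariant_orbit (R : realType) (E W : normedModType R) {hE : FinDim E} {hW : FinDim W}
    (K : topologicalType) (AK : atlas E K) (mul : K -> K -> K) (one : K) (inv : K -> K)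
    (Phi : K -> W) (T : K -> W -> W) :
  is_atlas AK -> @second_countable K ->
  (forall a b c, mul (mul a b) c = mul a (mul b c)) ->
  (forall a, mul one a = a) -> (forall a, mul a one = a) ->
  (forall a, mul (inv a) a = one) -> (forall a, mul a (inv a) = one) ->
  (forall b p, msmooth_at AK AK (mul b) p) -> (forall b p, msmooth_at AK AK (mul^~ b) p) ->
  (forall p, msmooth_at AK (vec_atlas W) Phi p) -> (forall b, linear (T b)) ->
  (forall a b, Phi (mul b a) = T b (Phi a)) ->
  (forall b w, T (inv b) (T b w) = w) -> (forall b w, T b (T (inv b) w) = w) ->
  exists (d : nat) (Q : topologicalType) (AQ : atlas 'rV[R]_d Q) (pi : K -> Q) (iota : Q -> W)
      (s : Q -> 'rV[R]_d -> K),
    [/\ is_manifold AQ,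
        (forall q, exists x, pi x = q) /\ submersion AK AQ pi,
        (forall x, iota (pi x) = Phi x) /\ injective iota,
        immersion AQ (vec_atlas W) iota &
        forall q c, acodom AQ q c ->
          msmooth_at (vec_atlas 'rV[R]_d) AK (s q) c /\ pi (s q c) = apoint AQ q c].
Proof.
move=> hK cK mulA mul1 mulr1 mulV mulrV lS rS PhiS TL PhiM TK TKV.
have [Q [pi [iota [iE iI piS oQ]]]] := fibre_quotient Phi.
have [rep repK] := choice piS.
have [d [P [S [D [PL oD D0 S0 SP]]]]] := local_slice hK mulA mul1 mulV mulrV lS PhiS TL PhiM.
have hm := orbit_is_manifold hK cK mulA mul1 mulr1 mulV mulrV lS rS PhiS TL PhiM TK TKV
  iE iI piS oQ repK PL oD D0 S0 SP.
pose AQ := orbit_atlas mul inv Phi T pi iota rep P S D.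
have hQ : is_atlas AQ by exact: is_manifold_atlas (hm _ _).
exists d, Q, AQ, pi, iota, (fun q c => mul (rep q) (S c)); split => //.
- exact: hm.
- split => //; split=> [|p v].
    by apply/(msmoothP hK hQ) => p; exact: (pi_smooth mul inv PhiS TL iE oQ rep S D PL p).
  exact: (pi_submersion hK cK mulA mul1 mulr1 mulV mulrV lS rS PhiS TL PhiM TK TKV
    iE iI piS oQ repK PL oD D0 S0 SP p v).
- split=> [|q].
    by apply/(msmoothP hQ vec_atlasP) => q; exact: (iota_smooth hK mulV lS PhiS PhiM iE oQ repK D0 SP q).
  exact: (iota_immersion hK cK mulA mul1 mulr1 mulV mulrV lS rS PhiS TL PhiM TK TKV
    iE iI piS oQ repK PL oD D0 S0 SP).
- by move=> q c qc; exact: (section_smooth hK lS PhiM TK iE SP qc).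
Qed.

(** * Two-forms with a potential in each chart *)

Section locally_exact.
Context {R : realType} {F : normedModType R} {hF : FinDim F} {Q : topologicalType} (AQ : atlas F Q).
Hypothesis hQ : is_atlas AQ.
Variables (om : Q -> F -> F -> R) (q : Q) (be : F -> F -> R^o).
Hypothesis beS : forall c v, acodom AQ q c -> smooth_at (be ^~ v) c.
Hypothesis omE : forall c u v, acodom AQ q c ->
  rep2 AQ om q c u v = 'D_u (be ^~ v) c - 'D_v (be ^~ u) c.

Let near_rep2 c u v : acodom AQ q c ->
  \forall z \near c, 'D_u (be ^~ v) z - 'D_v (be ^~ u) z = (rep2 AQ om q z u v : R^o).
Proof.
move=> cc; apply: filterS (open_nbhs_nbhs (conj (acodom_open hQ q) cc)) => z zc.
by rewrite omE.
Qed.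

Let smooth_d c u v : acodom AQ q c ->
  smooth_at (fun z => 'D_u (be ^~ v) z - 'D_v (be ^~ u) z) c.
Proof.
by move=> cc; apply: smooth_atDr; [|apply: smooth_atN]; apply: smooth_at_D; exact: beS.
Qed.

Lemma exact_smooth u v : smooth_on (acodom AQ q) (fun c => rep2 AQ om q c u v : R^o).
Proof.
apply/(smooth_onP _ (acodom_open hQ q)) => c cc.
exact: smooth_at_eq (near_rep2 u v cc) (smooth_d u v cc).
Qed.

Lemma derive_rep2 u v w c : acodom AQ q c ->
  'D_u (fun c => rep2 AQ om q c v w : R^o) c = 'D_u ('D_v (be ^~ w)) c - 'D_u ('D_w (be ^~ v)) c.
Proof.
move=> cc; rewrite -(near_eq_derive u (near_rep2 v w cc)).
have d (x y : F) : derivable ('D_x (be ^~ y)) c u.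
  by apply: diff_derivable; apply: smooth_at_differentiable; apply: smooth_at_D; exact: beS.
exact: deriveB.
Qed.

Let closed_sum (a b c d e f : R) : a = d -> b = e -> c = f ->
  (a - b) - (d - c) + (e - f) = 0.
Proof. by move=> -> -> ->; ring. Qed.

(** The six second derivatives of the potential cancel in pairs. *)
Lemma exact_closed u v w : dform2 AQ om q u v w = 0.
Proof.
have cc : acodom AQ q (acoord AQ q q) by exact: acodom_acoord (adom_id hQ q).
apply: (etrans (f_equal2 (fun x y => x + y) (f_equal2 (fun x y => x - y)
  (derive_rep2 u v w cc) (derive_rep2 v u w cc)) (derive_rep2 w u v cc))).
by apply: closed_sum; apply: derive_comm_real; exact: beS.
Qed.

End locally_exact.

(** * The reduction of TT^*G *)

Section coadjoint.
Context {R : realType} {n : nat} {G : topGroupType}.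
Variable AG : atlas 'rV[R]_n G.
Hypothesis hG : is_lie_group AG.
Local Notation V := 'rV[R]_n.
Local Notation V' := 'cV[R]_n.
Local Notation hA := (lie_atlas hG).

(* Ad and bracket are kept abstract, because unification must not unfold them to
   differentials in charts; adst, Adst, mulK, invK, coA, act, oform, mom and gen
   are copies of notions of Defs that depend on them. *)
Variables (Ad : G -> V -> V) (bracket : V -> V -> V).
Hypotheses (AdE : Ad = Defs.Ad AG) (bracketE : bracket = Defs.bracket AG).

Definition adst (xi : V) (mu : V') : V' := vdual (fun eta => pair mu (bracket xi eta)).
Definition Adst (g : G) (mu : V') : V' := vdual (fun eta => pair mu (Ad g eta)).
Definition mulK (a b : G * V) : G * V := ((a.1 * b.1)%g, a.2 + Ad a.1 b.2).
Definition invK (a : G * V) : G * V := ((a.1^-1)%g, - Ad (a.1^-1)%g a.2).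
Definition coA (a : G * V) (rho : V' * V') : V' * V' :=
  (Adst a.1 (rho.1 + adst a.2 rho.2), Adst a.1 rho.2).
Definition act (p : TTsG R n G) (a : G * V) : TTsG R n G :=
  let '(g, mu, xi, nu) := p in
  ((g * a.1)%g, mu, xi + Ad g a.2, nu - adst (Ad g a.2) mu).
Definition oform (rho : V' * V') (a b : V * V) : R :=
  pair rho.1 (bracket b.1 a.1) + pair rho.2 (bracket b.1 a.2 - bracket a.1 b.2).

Lemma AdL g : linear (Ad g). Proof. by rewrite AdE; exact: Ad_linear. Qed.
Lemma Ad_0 g : Ad g 0 = 0. Proof. by rewrite AdE; exact: Ad0. Qed.
Lemma Ad_D g x y : Ad g (x + y) = Ad g x + Ad g y. Proof. by rewrite AdE; exact: AdD. Qed.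
Lemma Ad_N g x : Ad g (- x) = - Ad g x. Proof. by rewrite AdE; exact: AdN. Qed.
Lemma Ad_M g h x : Ad (g * h)%g x = Ad g (Ad h x). Proof. by rewrite AdE; exact: Ad_mul. Qed.
Lemma Ad_1 x : Ad 1%g x = x. Proof. by rewrite AdE; exact: Ad1. Qed.
Lemma Ad_VK g x : Ad g^-1%g (Ad g x) = x. Proof. by rewrite -Ad_M mulVg Ad_1. Qed.
Lemma Ad_KV g x : Ad g (Ad g^-1%g x) = x. Proof. by rewrite -Ad_M mulgV Ad_1. Qed.
Lemma bracketLl y : linear (bracket^~ y). Proof. by rewrite bracketE; exact: bracket_linearl. Qed.
Lemma bracketLr x : linear (bracket x). Proof. by rewrite bracketE; exact: bracket_linearr. Qed.
Lemma bracketC x y : bracket x y = - bracket y x. Proof. by rewrite bracketE; exact: bracket_anti. Qed.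
Lemma Ad_br g x y : Ad g (bracket x y) = bracket (Ad g x) (Ad g y).
Proof. by rewrite AdE bracketE; exact: Ad_bracket. Qed.

Lemma bracketDl x y z : bracket (x + y) z = bracket x z + bracket y z.
Proof. by have := bracketLl z 1 x y; rewrite !scale1r. Qed.

Lemma bracketDr x y z : bracket z (x + y) = bracket z x + bracket z y.
Proof. by have := bracketLr z 1 x y; rewrite !scale1r. Qed.

Lemma bracket0l x : bracket 0 x = 0.
Proof. by have := bracketDl 0 0 x; rewrite addr0 -[LHS]addr0 => /addrI. Qed.

Lemma bracket0r x : bracket x 0 = 0.
Proof. by have := bracketDr 0 0 x; rewrite addr0 -[LHS]addr0 => /addrI. Qed.

Lemma bracketNl x y : bracket (- x) y = - bracket x y.
Proof. by have := bracketDl x (- x) y; rewrite subrr bracket0l => /esym/addr0_eq. Qed.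

Lemma pair_adst xi mu eta : pair (adst xi mu) eta = pair mu (bracket xi eta).
Proof.
apply: pair_vdualE => a x y.
by rewrite bracketLr (pair_linearr mu).
Qed.

Lemma pair_Adst g mu eta : pair (Adst g mu) eta = pair mu (Ad g eta).
Proof. by apply: pair_vdualE => a x y; rewrite AdL (pair_linearr mu). Qed.

Lemma adstDl x y mu : adst (x + y) mu = adst x mu + adst y mu.
Proof. by apply: pair_inj => z; rewrite pairDl !pair_adst bracketDl pairDr. Qed.

Lemma adstNl x mu : adst (- x) mu = - adst x mu.
Proof. by apply: pair_inj => z; rewrite pairNl !pair_adst bracketNl pairNr. Qed.

Lemma adst0l mu : adst 0 mu = 0.
Proof. by apply: pair_inj => z; rewrite pair_adst bracket0l pair0r pair0l. Qed.

Lemma adst_linearl mu : linear (adst^~ mu).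
Proof.
move=> a x y; apply: pair_inj => z.
by rewrite pairDl pairZl !pair_adst (bracketLl z) pairDr pairZr.
Qed.

Lemma AdstD g mu nu : Adst g (mu + nu) = Adst g mu + Adst g nu.
Proof. by apply: pair_inj => z; rewrite !(pairDl, pair_Adst). Qed.

Lemma Adst_mul g h mu : Adst h (Adst g mu) = Adst (g * h)%g mu.
Proof. by apply: pair_inj => z; rewrite !pair_Adst Ad_M. Qed.

Lemma Adst1 mu : Adst 1%g mu = mu.
Proof. by apply: pair_inj => z; rewrite pair_Adst Ad_1. Qed.

Lemma Adst_VK g mu : Adst g (Adst g^-1%g mu) = mu.
Proof. by rewrite Adst_mul mulVg Adst1. Qed.

Lemma Adst_KV g mu : Adst g^-1%g (Adst g mu) = mu.
Proof. by rewrite Adst_mul mulgV Adst1. Qed.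

Lemma Adst_adst g eta mu :
  Adst g (adst (Ad g eta) mu) = adst eta (Adst g mu).
Proof.
by apply: pair_inj => z; rewrite pair_adst !pair_Adst pair_adst Ad_br.
Qed.

(** The order of the factors shows a right action; it becomes a left one only after composition with
    [invK]. *)
Lemma coA_mul a b rho : coA b (coA a rho) = coA (mulK a b) rho.
Proof.
case: a b rho => [g x] [h y] [l m]; rewrite /coA /mulK /=.
by rewrite !Adst_mul -Adst_adst -AdstD Adst_mul adstDl addrA.
Qed.

Lemma coA1 rho : coA Gg_one rho = rho.
Proof. by case: rho => l m; rewrite /coA /= adst0l addr0 !Adst1. Qed.

Lemma mulKV a : mulK a (invK a) = Gg_one.
Proof.
case: a => g x; rewrite /mulK /invK /Gg_one /= mulgV.
by rewrite Ad_N Ad_KV subrr.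
Qed.

Lemma mulVK a : mulK (invK a) a = Gg_one.
Proof. by case: a => g x; rewrite /mulK /invK /Gg_one /= mulVg addNr. Qed.

Lemma mulKA a b c : mulK (mulK a b) c = mulK a (mulK b c).
Proof.
case: a b c => [g x] [h y] [k z]; rewrite /mulK /= mulgA.
by rewrite Ad_D Ad_M addrA.
Qed.

Lemma mulK1 a : mulK a Gg_one = a.
Proof. by case: a => g x; rewrite /mulK /= mulg1 Ad_0 addr0. Qed.

Lemma mul1K a : mulK Gg_one a = a.
Proof. by case: a => g x; rewrite /mulK /= mul1g Ad_1 add0r. Qed.

Lemma invKM a b : invK (mulK a b) = mulK (invK b) (invK a).
Proof.
case: a b => [g x] [h y]; rewrite /mulK /invK /= invgM.
by rewrite Ad_D Ad_N !Ad_M Ad_VK opprD addrC.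
Qed.

Lemma coA_linear a : linear (coA a).
Proof.
move=> k [l m] [l' m']; have -> : k *: (l, m) + (l', m') = (k *: l + l', k *: m + m') by [].
rewrite /coA /=; have -> : k *: (Adst a.1 (l + adst a.2 m), Adst a.1 m) +
    (Adst a.1 (l' + adst a.2 m'), Adst a.1 m') =
  (k *: Adst a.1 (l + adst a.2 m) + Adst a.1 (l' + adst a.2 m'),
   k *: Adst a.1 m + Adst a.1 m') by [].
congr (_, _); apply: pair_inj => z.
  by rewrite !(pairDl, pairZl, pair_Adst, pair_adst) mulrDr addrACA.
by rewrite !(pairDl, pairZl, pair_Adst).
Qed.

Lemma act_one p : act p Gg_one = p.
Proof.
by case: p => [[[g m] x] v]; rewrite /act /= mulg1 Ad_0 adst0l addr0 subr0.
Qed.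

Lemma act_mulK p a b : act (act p a) b = act p (mulK a b).
Proof.
case: p a b => [[[g m] x] v] [h y] [k z]; rewrite /act /mulK /=.
by rewrite mulgA Ad_D Ad_M adstDl opprD !addrA.
Qed.

Lemma oformE (rho : V' * V') (a b : V * V) : oform rho a b =
  - (pair rho.1 (bracket a.1 b.1) + pair rho.2 (bracket a.1 b.2 + bracket a.2 b.1)).
Proof.
rewrite /oform (bracketC b.1 a.1) (bracketC b.1 a.2).
rewrite !(pairDr, pairNr); ring.
Qed.


Lemma smooth_at_pairing {E : normedModType R} (m : E -> V') (v : E -> V) x :
  smooth_at m x -> smooth_at v x -> smooth_at (fun y => pair (m y) (v y) : R^o) x.
Proof.
move=> ms vs; apply: (smooth_at_coord (A := fun y => v y *m m y)).
exact: smooth_at_mulmx.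
Qed.

Lemma smooth_at_bracket {E : normedModType R} (v w : E -> V) x :
  smooth_at v x -> smooth_at w x -> smooth_at (fun y => bracket (v y) (w y)) x.
Proof.
move=> vs ws.
have bE y z : bracket y z =
    \sum_i \sum_j (y 0 i : R^o) *: ((z 0 j : R^o) *: bracket (delta_mx 0 i) (delta_mx 0 j)).
  rewrite {1}[y]row_sum_delta.
  rewrite (big_morph (bracket ^~ z) (fun a b => bracketDl a b z) (bracket0l z)).
  apply: eq_bigr => i _; have := bracketLl z (y 0 i) (delta_mx 0 i) 0.
  rewrite addr0 bracket0l addr0 => ->; rewrite {1}[z]row_sum_delta.
  rewrite (big_morph (bracket (delta_mx 0 i)) (fun a b => bracketDr a b _) (bracket0r _)).
  rewrite scaler_sumr; apply: eq_bigr => j _; congr (_ *: _).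
  by have := bracketLr (delta_mx 0 i) (z 0 j) (delta_mx 0 j) 0; rewrite addr0 bracket0r addr0.
have -> : (fun y => bracket (v y) (w y)) = fun y => \sum_i \sum_j (v y 0 i : R^o) *:
    ((w y 0 j : R^o) *: bracket (delta_mx 0 i) (delta_mx 0 j)).
  by apply/funext => y; exact: bE.
apply: smooth_at_sum => i; apply: smooth_at_sum => j.
apply: smooth_atZ; first exact: (smooth_at_coord 0 i vs).
apply: smooth_atZ; first exact: (smooth_at_coord 0 j ws).
exact: smooth_at_cst.
Qed.

Section families.
Context {E : normedModType R} {M : topologicalType} {hE : FinDim E} (A : atlas E M).
Hypothesis hM : is_atlas A.

Lemma msmooth_at_Ad (f : M -> G) (x : M -> V) p :
  msmooth_at A AG f p -> msmooth_at A (vec_atlas V) x p ->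
  msmooth_at A (vec_atlas V) (fun q => Ad (f q) (x q)) p.
Proof. by rewrite AdE; exact: Ad_smooth2. Qed.

Lemma msmooth_at_adst (v : M -> V) (m : M -> V') p :
  msmooth_at A (vec_atlas V) v p -> msmooth_at A (vec_atlas V') m p ->
  msmooth_at A (vec_atlas V') (fun x => adst (v x) (m x)) p.
Proof.
move=> [_ vs] [_ ms]; apply: msmooth_at_vecI => //; apply: smooth_at_mx => i j.
apply: (@smooth_at_eq _ _ _ (fun y => pair (m (apoint A p y))
    (bracket (v (apoint A p y)) (delta_mx 0 i)) : R^o)).
  by apply: nearW => y /=; rewrite mxE.
by apply: smooth_at_pairing => //; apply: smooth_at_bracket => //; exact: smooth_at_cst.
Qed.

Lemma msmooth_at_Adst (g : M -> G) (m : M -> V') p :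
  msmooth_at A AG g p -> msmooth_at A (vec_atlas V') m p ->
  msmooth_at A (vec_atlas V') (fun x => Adst (g x) (m x)) p.
Proof.
move=> gs [_ ms]; apply: msmooth_at_vecI => //; apply: smooth_at_mx => i j.
apply: (@smooth_at_eq _ _ _ (fun y => pair (m (apoint A p y))
    (Ad (g (apoint A p y)) (delta_mx 0 i)) : R^o)).
  by apply: nearW => y /=; rewrite mxE.
apply: smooth_at_pairing => //.
have [_ s] := msmooth_at_Ad gs (msmooth_at_cst A (vec_atlas V) (delta_mx 0 i) p).
exact: s.
Qed.

End families.

Lemma mdiff_Ad g u y :
  mdiff AG (vec_atlas V) (fun h => Ad h y) g u = bracket (rightMC AG g u) (Ad g y).
Proof.
have e : (fun h => Ad h y) = fun h => Ad (h * g^-1)%g (Ad g y).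
  by apply/funext => h; rewrite Ad_M Ad_VK.
have As : msmooth_at AG (vec_atlas V) (fun h => Ad h (Ad g y)) 1%g.
  exact: (msmooth_at_Ad hA (msmooth_at_id hA 1%g) (msmooth_at_cst AG (vec_atlas V) (Ad g y) 1%g)).
rewrite e bracketE /Defs.bracket -AdE.
exact: (mdiff_comp_at hA hA (f := fun h => (h * g^-1)%g) (g := fun h => Ad h (Ad g y))
  u (mulgV g) (rmul_smooth hG _ g) As).
Qed.

Lemma mdiff_Ad_inv u y :
  mdiff AG (vec_atlas V) (fun h => Ad h^-1%g y) 1%g u = - bracket u y.
Proof.
have As : msmooth_at AG (vec_atlas V) (fun h => Ad h y) 1%g.
  exact: (msmooth_at_Ad hA (msmooth_at_id hA 1%g) (msmooth_at_cst AG (vec_atlas V) y 1%g)).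
rewrite (mdiff_comp_at hA hA (f := fun h => (h^-1)%g) (g := fun h => Ad h y)
  u (invg1 G) (inv_smooth hG _) As) mdiff_inv1 //.
by rewrite -bracketNl bracketE /Defs.bracket -AdE.
Qed.

Variable RMC : G -> V -> V.
Hypothesis RMCE : RMC = rightMC AG.

Local Notation vV := (vec_atlas V).
Local Notation vV' := (vec_atlas V').
Local Notation KA := (Gg_atlas AG).
Local Notation TA := (TTsG_atlas AG).

Lemma RMC_linear g : linear (RMC g).
Proof. by rewrite RMCE; exact: mdiff_linear. Qed.

Lemma RMC_TR g u : RMC g (Defs.TR AG g u) = u.
Proof. by rewrite RMCE; exact: TRK. Qed.

Lemma TR_RMC g u : Defs.TR AG g (RMC g u) = u.
Proof. by rewrite RMCE; exact: rightMCK. Qed.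

Lemma RMC_lmul g u : RMC g (mdiff AG AG (fun h => (g * h)%g) 1%g u) = Ad g u.
Proof. by rewrite -(TR_Ad hG) -AdE RMC_TR. Qed.

Lemma Gg_atlasP : is_atlas KA.
Proof. by apply: prod_atlasP; [exact: hA|exact: vec_atlasP]. Qed.

Lemma TTsG_atlasP : is_atlas TA.
Proof.
apply: prod_atlasP; last exact: vec_atlasP.
apply: prod_atlasP; last exact: vec_atlasP.
by apply: prod_atlasP; [exact: hA|exact: vec_atlasP].
Qed.

(** * The momentum map, its level sets and the potential on them *)

Variable theta2 : TTsG R n G -> TTsGvec R n -> R.
Hypothesis htheta2 : is_theta2 AG theta2.

(** An arbitrary tangent vector is written as a value of a field X, with xi2 its right
    trivialization r. One bracket term is the one in [is_theta2], the other comes from xi3 = V3 -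
    [r, xi]; hence the factor 2. *)
Lemma theta2E g mu xi nu V1 V2 V3 V4 : theta2 (g, mu, xi, nu) (V1, V2, V3, V4) =
  pair mu V3 + pair nu (RMC g V1) + 2 * pair mu (bracket xi (RMC g V1)).
Proof.
have cancel (x a b : V') : x - a + b + a - b = x by rewrite addrAC addrK subrK.
pose r := RMC g V1.
pose nu2 := V2 - Defs.adstar AG r mu.
pose xi3 := V3 - Defs.bracket AG r xi.
pose nu3 := V4 - Defs.adstar AG r nu + Defs.adstar AG xi nu2.
have e : Xfield AG (r, nu2, xi3, nu3) (g, mu, xi, nu) = (V1, V2, V3, V4).
  have e1 : Defs.TR AG g r = V1 by exact: TR_RMC.
  have e2 : nu2 + Defs.adstar AG r mu = V2 by exact: subrK.
  have e3 : xi3 + Defs.bracket AG r xi = V3 by exact: subrK.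
  have e4 : nu3 + Defs.adstar AG r nu - Defs.adstar AG xi nu2 = V4 by exact: cancel.
  by rewrite /Xfield e1 e2 e3 e4.
have := htheta2 g mu xi nu r nu2 xi3 nu3; rewrite e => ->.
rewrite /xi3 -bracketE (bracketC r) opprK pairDr; ring.
Qed.

Definition mom (p : TTsG R n G) : V' * V' :=
  (vdual (fun x => theta2 p (mdiff KA TA (act p) Gg_one (x, 0))),
   vdual (fun x => theta2 p (mdiff KA TA (act p) Gg_one (0, x)))).

Lemma adst_Ad_linear g mu : linear (fun x => adst (Ad g x) mu).
Proof. by move=> a x y; rewrite AdL adst_linearl. Qed.

Lemma mdiff_act g mu xi nu x :
  mdiff KA TA (act (g, mu, xi, nu)) Gg_one x =
  (mdiff AG AG (fun h => (g * h)%g) 1%g x.1, 0, Ad g x.2, - adst (Ad g x.2) mu).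
Proof.
have fs : msmooth_at KA AG fst (1%g, 0 : V) by exact: (msmooth_at_fst hA vec_atlasP).
have ss : msmooth_at KA vV snd (1%g, 0 : V) by exact: (msmooth_at_snd hA vec_atlasP).
have s1 : msmooth_at KA AG (fun a => (g * a.1)%g) (1%g, 0 : V).
  exact: (msmooth_at_comp Gg_atlasP hA fs (lmul_smooth hG g 1%g)).
have s2 : msmooth_at KA vV' (fun=> mu) (1%g, 0 : V) by exact: msmooth_at_cst.
have s3 : msmooth_at KA vV (fun a => Ad g a.2) (1%g, 0 : V).
  exact: (msmooth_at_linear (AdL g) ss).
have s3' : msmooth_at KA vV (fun a => xi + Ad g a.2) (1%g, 0 : V).
  exact: (msmooth_at_D (msmooth_at_cst KA vV xi _) s3).
have lN : linear (fun x => - adst (Ad g x) mu).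
  by move=> a y z; rewrite adst_Ad_linear opprD scalerN.
have s4 : msmooth_at KA vV' (fun a => - adst (Ad g a.2) mu) (1%g, 0 : V).
  exact: (msmooth_at_linear lN ss).
have s4' : msmooth_at KA vV' (fun a => nu - adst (Ad g a.2) mu) (1%g, 0 : V).
  exact: (msmooth_at_D (msmooth_at_cst KA vV' nu _) s4).
have d1 : mdiff KA AG (fun a => (g * a.1)%g) (1%g, 0 : V) x =
    mdiff AG AG (fun h => (g * h)%g) 1%g x.1.
  rewrite (mdiff_comp_at Gg_atlasP hA (f := fst) (g := fun h => (g * h)%g) (p := (1%g, 0 : V)) (q := 1%g) x erefl fs
    (lmul_smooth hG g 1%g)).
  by rewrite (mdiff_fst hA vec_atlasP).
have d3 : mdiff KA vV (fun a => xi + Ad g a.2) (1%g, 0 : V) x = Ad g x.2.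
  rewrite (mdiff_D x (msmooth_at_cst KA vV xi _) s3) mdiff_cst add0r.
  by rewrite (mdiff_linear_comp Gg_atlasP x (AdL g) ss) (mdiff_snd hA vec_atlasP).
have d4 : mdiff KA vV' (fun a => nu - adst (Ad g a.2) mu) (1%g, 0 : V) x = - adst (Ad g x.2) mu.
  rewrite (mdiff_D x (msmooth_at_cst KA vV' nu _) s4) mdiff_cst add0r.
  by rewrite (mdiff_linear_comp Gg_atlasP x lN ss) (mdiff_snd hA vec_atlasP).
have P12 := msmooth_at_pair s1 s2; have P123 := msmooth_at_pair P12 s3'.
rewrite /act /Gg_one (mdiff_pair x P123 s4') (mdiff_pair x P12 s3') (mdiff_pair x s1 s2).
by rewrite mdiff_cst d1 d3 d4.
Qed.

(* G x g acts on the right, so that the generators of the action are left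
   translates and not the right invariant fields X: hence Adst g and the factor 2. *)
Lemma momE g mu xi nu : mom (g, mu, xi, nu) = (Adst g (nu + 2 *: adst xi mu), Adst g mu).
Proof.
have l2 : linear ((fun x => pair nu (Ad g x) + 2 * pair mu (bracket xi (Ad g x))) : V -> R^o).
  move=> a x y; rewrite !(AdL, bracketLr) !(pairDr, pairZr) -[RHS]/(_ * _ + _); ring.
have l1 : linear ((fun x => pair mu (Ad g x)) : V -> R^o).
  by move=> a x y; rewrite AdL pairDr pairZr.
rewrite /mom; congr (_, _); apply: pair_inj => z.
  have -> : (fun x => theta2 (g, mu, xi, nu) (mdiff KA TA (act (g, mu, xi, nu)) Gg_one (x, 0)))
      = fun x => pair nu (Ad g x) + 2 * pair mu (bracket xi (Ad g x)).
    by apply/funext => x; rewrite mdiff_act theta2E /= RMC_lmul Ad_0 pair0r add0r.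
  by rewrite (pair_vdualE _ l2) pair_Adst pairDl pairZl pair_adst.
have -> : (fun x => theta2 (g, mu, xi, nu) (mdiff KA TA (act (g, mu, xi, nu)) Gg_one (0, x)))
      = fun x => pair mu (Ad g x).
  by apply/funext => x; rewrite mdiff_act theta2E /= RMC_lmul Ad_0 bracket0r !pair0r mulr0 !addr0.
by rewrite (pair_vdualE _ l1).
Qed.

(** The action subtracts one term ad^* from nu, while the shift of xi enters [momE] twice; the
    remaining single term is the one in [coA]. *)
Lemma mom_act p a : mom (act p a) = coA a (mom p).
Proof.
case: p a => [[[g mu] xi] nu] [h eta]; rewrite /act /= !momE /coA /=.
rewrite !Adst_mul -Adst_adst -AdstD Adst_mul; congr (Adst _ _, _).
apply: pair_inj => z.
rewrite !(pairDl, pairNl, pairZl, pair_adst) bracketDl pairDr; ring.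
Qed.

(* The solution of mom p = rho over a: the preimage of rho is a graph over G x g. *)
Definition lvl (rho : V' * V') (a : G * V) : TTsG R n G :=
  (a.1, Adst a.1^-1%g rho.2, a.2,
   Adst a.1^-1%g rho.1 - 2 *: adst a.2 (Adst a.1^-1%g rho.2)).

Lemma mom_lvl rho a : mom (lvl rho a) = rho.
Proof.
by case: rho => l m; rewrite /lvl momE /= subrK !Adst_VK.
Qed.

Lemma lvlP rho p : mom p = rho -> p = lvl rho (p.1.1.1, p.1.2).
Proof.
case: p => [[[g mu] xi] nu]; rewrite momE => <-; rewrite /lvl /=.
by rewrite !Adst_KV addrK.
Qed.

(** By equivariance the left-hand side is again in the level set, where a point is determined by its
    components in G and g. *)
Lemma lvl_act rho a k : coA k rho = rho -> act (lvl rho a) k = lvl rho (mulK a k).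
Proof.
move=> kr; have := mom_act (lvl rho a) k; rewrite mom_lvl kr => /lvlP ->.
by [].
Qed.

Lemma range_lvl rho : range (lvl rho) = [set p | mom p = rho].
Proof.
apply/seteqP; split=> [_ [a _ <-]|p /= /lvlP ->]; first exact: mom_lvl.
by exists (p.1.1.1, p.1.2).
Qed.

Lemma near_all (T : topologicalType) (x : T) (P : set T) :
  (forall y, P y) -> \forall y \near x, P y.
Proof. by move=> h; apply: (@filterE _ _ (nbhs_filter x)). Qed.

(** The components along the two duals are left unspecified, because [theta2E] does not involve
    them. *)
Lemma lvl_diff rho a : msmooth_at KA TA (lvl rho) a /\
  forall u, exists d2 d4, mdiff KA TA (lvl rho) a u = (u.1, d2, u.2, d4).
Proof.
have fs : msmooth_at KA AG fst a by exact: (msmooth_at_fst hA vec_atlasP).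
have ss : msmooth_at KA vV snd a by exact: (msmooth_at_snd hA vec_atlasP).
have is1 : msmooth_at KA AG (fun x => x.1^-1%g) a by exact: (msmooth_at_inv hG Gg_atlasP fs).
have s2 m : msmooth_at KA vV' (fun x => Adst x.1^-1%g m) a.
  exact: (msmooth_at_Adst Gg_atlasP is1 (msmooth_at_cst KA vV' m a)).
have s3 : msmooth_at KA vV' (fun x => adst x.2 (Adst x.1^-1%g rho.2)) a.
  exact: (msmooth_at_adst Gg_atlasP ss (s2 rho.2)).
have lZ : linear (fun x : V' => - (2 *: x)).
  by move=> k x y; rewrite scalerDr opprD !scalerA scalerN scalerA [2 * k]mulrC.
have s3' : msmooth_at KA vV' (fun x => - (2 *: adst x.2 (Adst x.1^-1%g rho.2))) a.
  exact: (msmooth_at_linear lZ s3).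
have s4 := msmooth_at_D (s2 rho.1) s3'.
have P12 := msmooth_at_pair fs (s2 rho.2); have P123 := msmooth_at_pair P12 ss.
split=> [|u]; first exact: (msmooth_at_pair P123 s4).
rewrite /lvl (mdiff_pair u P123 s4) (mdiff_pair u P12 ss) (mdiff_pair u fs (s2 rho.2)).
rewrite (mdiff_fst hA vec_atlasP) (mdiff_snd hA vec_atlasP).
by eexists; eexists.
Qed.

Lemma lvl_smooth rho a : msmooth_at KA TA (lvl rho) a.
Proof. by have [] := lvl_diff rho a. Qed.

Definition alpha (rho : V' * V') (a : G * V) (u : V * V) : R :=
  pair rho.1 (Ad a.1^-1%g (RMC a.1 u.1)) + pair rho.2 (Ad a.1^-1%g u.2).

(** The term - 2 ad^*_xi in the last component of [lvl] cancels the bracket term of [theta2E]. *)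
Lemma pullback_theta2 rho : pullback1 KA TA (lvl rho) theta2 = alpha rho.
Proof.
apply/funext => a; apply/funext => u; rewrite /pullback1.
have [_ /(_ u)[d2 [d4 ->]]] := lvl_diff rho a.
rewrite /lvl theta2E /alpha !pairDl pairNl pairZl pair_adst !pair_Adst; ring.
Qed.

Lemma theta2_linear p : linear (theta2 p : TTsGvec R n -> R^o).
Proof.
case: p => [[[g mu] xi] nu] k [[[u1 u2] u3] u4] [[[v1 v2] v3] v4].
have -> : k *: (u1, u2, u3, u4) + (v1, v2, v3, v4) =
  (k *: u1 + v1, k *: u2 + v2, k *: u3 + v3, k *: u4 + v4) by [].
rewrite !theta2E (RMC_linear g) bracketLr !(pairDr, pairZr) -[RHS]/(_ * _ + _); ring.
Qed.

Lemma msmooth_at_apoint_fst (E : normedModType R) (hE : FinDim E) g (l : E -> V) (y : E) :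
  linear l -> acodom AG g (l y) ->
  msmooth_at (vec_atlas E) AG (fun z => apoint AG g (l z)) y /\
  forall v, mdiff (vec_atlas E) AG (fun z => apoint AG g (l z)) y v =
    mdiff vV AG (apoint AG g) (l y) (l v).
Proof.
move=> ll yc; have ls : msmooth_at (vec_atlas E) vV l y.
  by apply/msmooth_at_vecP; exact: smooth_at_linear.
have ps : msmooth_at vV AG (apoint AG g) (l y) by exact: (msmooth_at_apoint hA).
split=> [|v]; first exact: (msmooth_at_comp vec_atlasP vec_atlasP ls ps).
rewrite (mdiff_comp vec_atlasP vec_atlasP v ls ps); congr (mdiff _ _ _ _ _).
by rewrite mdiff_vec diff_linear.
Qed.

Lemma quad_eq (A B C D : Type) (a a' : A) (b b' : B) (c c' : C) (d d' : D) :
  a = a' -> b = b' -> c = c' -> d = d' -> (a, b, c, d) = (a', b', c', d').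
Proof. by move=> -> -> -> ->. Qed.

(** In a chart, [theta2E] is polynomial in the vector coordinates and in w, the right Maurer-Cartan
    form on a constant vector, which is smooth by [smooth_diag]. *)
Lemma theta2_smooth p : smooth_form_at TA theta2 p.
Proof.
split=> [x|v]; first exact: theta2_linear.
have hE : FinDim (TTsGvec R n) by exact: _.
case: p => [[[g mu] xi] nu]; set o := acoord TA _ _.
pose pr1 (y : TTsGvec R n) : V := y.1.1.1.
have l1 : linear pr1 by [].
have l2 : linear (fun y : TTsGvec R n => y.1.1.2) by [].
have l3 : linear (fun y : TTsGvec R n => y.1.2) by [].
have l4 : linear (fun y : TTsGvec R n => y.2) by [].
pose w z := RMC (apoint AG g z) (mdiff vV AG (apoint AG g) z (pr1 v)).
have ws : smooth_at w (acoord AG g g).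
  have fc (x : G) : (x * x^-1)%g = 1%g :> G by exact: mulgV.
  have fs (x : G) : msmooth_at (prod_atlas AG AG) AG (fun y : G * G => (y.2 * y.1^-1)%g) (x, x).
    apply: (msmooth_at_mul hG (lie2_atlas hG)); first exact: msmooth_at_snd hA hA _.
    by apply: (msmooth_at_inv hG (lie2_atlas hG)); exact: msmooth_at_fst hA hA _.
  rewrite /w RMCE.
  exact: (@smooth_diag R V V G G (FinDim_matrix R 1 n) AG AG hA _ g 1%g (pr1 v) fc fs).
have wps : smooth_at (fun y : TTsGvec R n => w (pr1 y)) o.
  by apply: (smooth_at_comp (smooth_at_linear o l1)).
apply: (@smooth_at_eq _ _ _ (fun y : TTsGvec R n =>
  (pair y.1.1.2 v.1.2 : R^o) + (pair y.2 (w (pr1 y)) : R^o) +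
  (2 : R^o) *: (pair y.1.1.2 (bracket y.1.2 (w (pr1 y))) : R^o))).
  have po : pr1 o = acoord AG g g by [].
  have ls : smooth_at pr1 o by exact: smooth_at_linear.
  have n0 : nbhs (acoord AG g g) (acodom AG g) := near_acodom hA (adom_id hA g).
  have n1 := near_continuous (smooth_at_continuous ls) po n0.
  apply: filterS n1 => y yc; rewrite /rep1.
  have [s1 d1] := msmooth_at_apoint_fst hE l1 yc.
  have sm (F : normedModType R) (l : TTsGvec R n -> F) : linear l ->
      msmooth_at (vec_atlas (TTsGvec R n)) (vec_atlas F) l y.
    by move=> ll; apply/msmooth_at_vecP; exact: smooth_at_linear.
  have P12 := msmooth_at_pair s1 (sm _ _ l2); have P123 := msmooth_at_pair P12 (sm _ _ l3).
  have -> : mdiff (vec_atlas (TTsGvec R n)) TA (apoint TA (g, mu, xi, nu)) y v =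
      (mdiff vV AG (apoint AG g) (pr1 y) (pr1 v), v.1.1.2, v.1.2, v.2).
    rewrite (mdiff_pair v P123 (sm _ _ l4)) (mdiff_pair v P12 (sm _ _ l3)).
    rewrite (mdiff_pair v s1 (sm _ _ l2)).
    exact: (quad_eq (d1 v) (diff_linear y v l2) (diff_linear y v l3) (diff_linear y v l4)).
  by rewrite theta2E.
apply: smooth_atDr; first apply: smooth_atDr.
- by apply: smooth_at_pairing; [exact: smooth_at_linear|exact: smooth_at_cst].
- by apply: smooth_at_pairing => //; exact: smooth_at_linear.
- apply: smooth_atZ; first exact: smooth_at_cst.
  apply: smooth_at_pairing; first exact: smooth_at_linear.
  by apply: smooth_at_bracket => //; exact: smooth_at_linear.
Qed.

Lemma alpha_smooth rho a : smooth_form_at KA (alpha rho) a.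
Proof.
rewrite -pullback_theta2; apply: (pullback1_smooth Gg_atlasP TTsG_atlasP).
  by apply: near_all => x; exact: lvl_smooth.
exact: theta2_smooth.
Qed.

Lemma dtheta2_lvl rho a u v : dform1 TA theta2 (lvl rho a) (mdiff KA TA (lvl rho) a u)
  (mdiff KA TA (lvl rho) a v) = dform1 KA (alpha rho) a u v.
Proof.
rewrite -pullback_theta2 (dform1_pullback Gg_atlasP TTsG_atlasP)//.
  by apply: near_all => x; exact: lvl_smooth.
exact: theta2_smooth.
Qed.

Lemma mdiff_apoint_Gg (y : V * V) v : acodom AG 1%g y.1 ->
  mdiff (vec_atlas (V * V)%type) KA (apoint KA Gg_one) y v =
  (mdiff vV AG (apoint AG 1%g) y.1 v.1, v.2).
Proof.
move=> yc; have l1 : linear (fst : V * V -> V) by [].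
have l2 : linear (snd : V * V -> V) by [].
have hE : FinDim (V * V)%type by exact: _.
have [s1 d1] := msmooth_at_apoint_fst hE l1 yc.
have s2 : msmooth_at (vec_atlas (V * V)%type) vV snd y.
  by apply/msmooth_at_vecP; exact: smooth_at_linear.
rewrite (mdiff_pair v s1 s2); congr (_, _); first exact: d1.
exact: (diff_linear y v l2).
Qed.

(** [alpha] depends on the base point through its G-component only. Its first term is the left
    Maurer-Cartan form by [leftMC_rightMC], with derivative - D; its second differentiates Ad_(g^-1)
    and gives minus a bracket. *)
Lemma derive_alpha_one rho (x y : V * V) :
  'D_x (fun z => rep1 KA (alpha rho) Gg_one z y : R^o) (acoord KA Gg_one Gg_one) =
  - pair rho.1 ('D_(x.1, 0 : V) ('D_(0 : V, y.1) (locmul AG)) (acoord AG 1%g 1%g, acoord AG 1%g 1%g))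
  - pair rho.2 (bracket x.1 y.2).
Proof.
set o := acoord AG 1%g 1%g.
pose h (z : V) : R^o := pair rho.1 (leftMC_coord AG z y.1) +
  pair rho.2 (Ad (apoint AG 1%g z)^-1%g y.2).
have l1 : linear (fst : V * V -> V) by [].
have As : msmooth_at AG vV (fun g => Ad g^-1%g y.2) 1%g.
  have As' : msmooth_at AG vV (fun g => Ad g y.2) 1^-1%g.
    exact: (msmooth_at_Ad hA (msmooth_at_id hA _) (msmooth_at_cst AG vV y.2 _)).
  exact: (msmooth_at_comp hA hA (inv_smooth hG _) As').
have s1 : smooth_at (fun z => leftMC_coord AG z y.1) o by exact: leftMC_coord_smooth.
have s2 : smooth_at (fun z => Ad (apoint AG 1%g z)^-1%g y.2) o by case: As.
have hs : smooth_at h o.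
  by apply: smooth_atDr; apply: smooth_at_pairing => //; exact: smooth_at_cst.
have fs : smooth_at (fst : V * V -> V) (o, 0 : V) by exact: smooth_at_linear.
have n0 : nbhs o (acodom AG 1%g) := near_acodom hA (adom_id hA 1%g).
have n1 := near_continuous (smooth_at_continuous fs) erefl n0.
have e1 : 'D_x (fun z => rep1 KA (alpha rho) Gg_one z y : R^o) (o, 0) =
    'D_x (fun z : V * V => h z.1) (o, 0).
  apply: near_eq_derive; apply: filterS n1 => z zc.
  by rewrite /rep1 mdiff_apoint_Gg// /alpha /h /leftMC_coord leftMC_rightMC// RMCE AdE.
have e2 : 'D_x (fun z : V * V => h z.1) (o, 0) = 'D_x.1 h o.
  have fd := smooth_at_differentiable fs; have hd := smooth_at_differentiable hs.
  have hd' : differentiable (h \o fst) (o, 0 : V) by exact: differentiable_comp.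
  apply: (etrans (deriveE x hd')); rewrite (diff_comp fd hd) /=.
  by rewrite (diff_linear _ _ l1) (deriveE x.1 hd).
have e3 : 'D_x.1 h o = (pair rho.1 ('D_x.1 (fun z => leftMC_coord AG z y.1) o) : R^o) +
    pair rho.2 ('D_x.1 (fun z => Ad (apoint AG 1%g z)^-1%g y.2) o).
  have ps (m : V') (f : V -> V) : smooth_at f o ->
      differentiable (fun z => pair m (f z) : R^o) o /\
      'D_x.1 (fun z => pair m (f z) : R^o) o = pair m ('D_x.1 f o).
    move=> sf; split.
      by apply: smooth_at_differentiable; apply: smooth_at_pairing => //; exact: smooth_at_cst.
    pose L : {linear V -> R^o} := HB.pack (pair m : V -> R^o)
      (GRing.isLinear.Build R V R^o _ _ (pair_linearr m)).
    have Lc : continuous L by apply: linear_continuous_findim.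
    exact: (derive_linear x.1 Lc (smooth_at_differentiable sf)).
  have [d1 <-] := ps rho.1 _ s1; have [d2 <-] := ps rho.2 _ s2.
  by apply: deriveD; exact: diff_derivable.
rewrite -[acoord KA _ _]/(o, 0 : V) e1 e2 e3 (derive_leftMC_coord hG) pairNr.
congr (_ + _).
have -> : 'D_x.1 (fun z => Ad (apoint AG 1%g z)^-1%g y.2) o =
    mdiff AG vV (fun g => Ad g^-1%g y.2) 1%g x.1 by exact: esym (mdiffE x.1 As).
by rewrite mdiff_Ad_inv pairNr.
Qed.

Let skew_regroup (a1 a2 q p s : R) : q = a2 - a1 -> (- a1 - p) - (- a2 - s) = q + (s - p).
Proof. by move=> ->; ring. Qed.

Lemma dalpha_one rho x y : dform1 KA (alpha rho) Gg_one x y = oform rho x y.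
Proof.
rewrite /dform1; apply: (etrans (f_equal2 (fun a b => a - b) (derive_alpha_one rho x y) (derive_alpha_one rho y x))).
rewrite /oform pairDr pairNr; apply: skew_regroup.
by rewrite bracketE (bracket_locmul hG) pairDr pairNr.
Qed.

(** * Translations of the semidirect product and generators of the coadjoint action *)

Section families_semidirect.
Context {E : normedModType R} {M : topologicalType} {hE : FinDim E} (A : atlas E M).
Hypothesis hM : is_atlas A.

Lemma msmooth_at_Gg (f : M -> G * V) p : msmooth_at A KA f p ->
  msmooth_at A AG (fun x => (f x).1) p /\ msmooth_at A vV (fun x => (f x).2) p.
Proof.
move=> fs; split.
- exact: (msmooth_at_comp hM Gg_atlasP fs (msmooth_at_fst hA vec_atlasP (f p))).
- exact: (msmooth_at_comp hM Gg_atlasP fs (msmooth_at_snd hA vec_atlasP (f p))).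
Qed.

Lemma msmooth_at_mulK (f g : M -> G * V) p : msmooth_at A KA f p -> msmooth_at A KA g p ->
  msmooth_at A KA (fun x => mulK (f x) (g x)) p.
Proof.
move=> /msmooth_at_Gg[f1 f2] /msmooth_at_Gg[g1 g2]; rewrite /mulK.
apply: (msmooth_at_pair (msmooth_at_mul hG hM f1 g1)).
exact: (msmooth_at_D f2 (msmooth_at_Ad hM f1 g2)).
Qed.

Lemma linear_oppV : linear (-%R : V -> V).
Proof. by move=> a x y; rewrite opprD scalerN. Qed.

Lemma msmooth_at_invK (f : M -> G * V) p : msmooth_at A KA f p ->
  msmooth_at A KA (fun x => invK (f x)) p.
Proof.
move=> /msmooth_at_Gg[f1 f2]; have i1 := msmooth_at_inv hG hM f1; rewrite /invK.
apply: (msmooth_at_pair i1).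
exact: (msmooth_at_linear linear_oppV (msmooth_at_Ad hM i1 f2)).
Qed.

Lemma msmooth_at_coA (f : M -> G * V) rho p : msmooth_at A KA f p ->
  msmooth_at A (vec_atlas (V' * V')%type) (fun x => coA (f x) rho) p.
Proof.
move=> /msmooth_at_Gg[f1 f2]; rewrite /coA.
have c m : msmooth_at A vV' (fun=> m) p by exact: msmooth_at_cst.
apply: msmooth_at_vpair; last exact: (msmooth_at_Adst hM f1 (c _)).
apply: (msmooth_at_Adst hM f1); apply: (msmooth_at_D (c _)).
exact: (msmooth_at_adst hM f2 (c _)).
Qed.

End families_semidirect.

Lemma KA_id p : msmooth_at KA KA (fun x => x) p.
Proof. exact: (msmooth_at_id Gg_atlasP). Qed.

Lemma KA_cst c p : msmooth_at KA KA (fun=> c) p.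
Proof. exact: msmooth_at_cst. Qed.

Lemma mulK_smoothl b p : msmooth_at KA KA (mulK b) p.
Proof. exact: (msmooth_at_mulK Gg_atlasP (KA_cst b p) (KA_id p)). Qed.

Lemma mulK_smoothr b p : msmooth_at KA KA (mulK^~ b) p.
Proof. exact: (msmooth_at_mulK Gg_atlasP (KA_id p) (KA_cst b p)). Qed.

Lemma coA_smooth rho p : msmooth_at KA (vec_atlas (V' * V')%type) (coA^~ rho) p.
Proof. exact: (msmooth_at_coA Gg_atlasP rho (KA_id p)). Qed.

Lemma coA_inv_smooth rho p :
  msmooth_at KA (vec_atlas (V' * V')%type) (fun a => coA (invK a) rho) p.
Proof. exact: (msmooth_at_coA Gg_atlasP rho (msmooth_at_invK Gg_atlasP (KA_id p))). Qed.

Lemma mdiff_mulKr b a u : mdiff KA KA (mulK^~ b) a u =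
  (mdiff AG AG (fun x => (x * b.1)%g) a.1 u.1, u.2 + bracket (RMC a.1 u.1) (Ad a.1 b.2)).
Proof.
have [f1 f2] := msmooth_at_Gg Gg_atlasP (KA_id a).
have cb : msmooth_at AG vV (fun=> b.2) a.1 by exact: msmooth_at_cst.
have As : msmooth_at AG vV (fun h => Ad h b.2) a.1.
  exact: (msmooth_at_Ad hA (msmooth_at_id hA a.1) cb).
have s1 : msmooth_at KA AG (fun x => (x.1 * b.1)%g) a.
  exact: (msmooth_at_comp Gg_atlasP hA f1 (rmul_smooth hG b.1 a.1)).
have s2 : msmooth_at KA vV (fun x => Ad x.1 b.2) a.
  exact: (msmooth_at_comp Gg_atlasP hA f1 As).
rewrite /mulK (mdiff_pair u s1 (msmooth_at_D f2 s2)); congr (_, _).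
  rewrite (mdiff_comp_at Gg_atlasP hA (f := fst) (g := fun h => (h * b.1)%g) u
    erefl f1 (rmul_smooth hG b.1 a.1)).
  by rewrite (mdiff_fst hA vec_atlasP).
rewrite (mdiff_D u f2 s2) (mdiff_snd hA vec_atlasP); congr (_ + _).
rewrite (mdiff_comp_at Gg_atlasP hA (f := fst) (g := fun h => Ad h b.2) u erefl f1 As).
by rewrite (mdiff_fst hA vec_atlasP) mdiff_Ad RMCE.
Qed.

(** Right trivialization is invariant under right translation. The cross term [r, Ad_a y] of
    [mdiff_mulKr], paired with the second component of rho, supplies the ad^* term in the coadjoint
    action of the inverse of b. *)
Lemma alpha_rmul rho b : pullback1 KA KA (mulK^~ b) (alpha rho) = alpha (coA (invK b) rho).
Proof.
apply/funext => a; apply/funext => u; rewrite /pullback1 mdiff_mulKr /alpha /=.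
rewrite RMCE (rightMC_rmul hG) -RMCE invgM !Ad_M !Ad_D Ad_br Ad_VK.
case: b => h y /=; rewrite !pair_Adst pairDl pair_adst.
rewrite Ad_br pairDr bracketNl pairNr (bracketC (Ad h^-1%g y)) pairNr; ring.
Qed.

(** The point q is a variable so that it can be instantiated with b, which is only provably equal to
    [mulK Gg_one b]. *)
Lemma dform1_mulKr rho b q x y : mulK Gg_one b = q ->
  dform1 KA (alpha rho) q (mdiff KA KA (mulK^~ b) Gg_one x) (mdiff KA KA (mulK^~ b) Gg_one y) =
  dform1 KA (pullback1 KA KA (mulK^~ b) (alpha rho)) Gg_one x y.
Proof.
move=> <-; apply: esym; apply: (dform1_pullback Gg_atlasP Gg_atlasP); last exact: alpha_smooth.
by apply: near_all => z; exact: mulK_smoothr.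
Qed.

Lemma dalpha rho b x y :
  dform1 KA (alpha rho) b (mdiff KA KA (mulK^~ b) Gg_one x) (mdiff KA KA (mulK^~ b) Gg_one y) =
  oform (coA (invK b) rho) x y.
Proof. by rewrite -dalpha_one -alpha_rmul; apply: dform1_mulKr; exact: mul1K. Qed.

Local Notation vO := (vec_atlas (V' * V')%type).

Lemma mdiff_Adst m u : mdiff AG vV' (fun h => Adst h m) 1%g u = adst u m.
Proof.
have cm : msmooth_at AG vV' (fun=> m) 1%g by exact: msmooth_at_cst.
have s1 : msmooth_at AG vV' (fun h => Adst h m) 1%g.
  exact: (msmooth_at_Adst hA (msmooth_at_id hA 1%g) cm).
(* Testing against z moves the derivative from [Adst] to [Ad]. *)
apply: pair_inj => z; rewrite pair_adst.
rewrite -(mdiff_linear_comp hA u (pair_linearl z) s1).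
have cz : msmooth_at AG vV (fun=> z) 1%g by exact: msmooth_at_cst.
have s2 : msmooth_at AG vV (fun h => Ad h z) 1%g.
  exact: (msmooth_at_Ad hA (msmooth_at_id hA 1%g) cz).
have -> : (fun h => pair (Adst h m) z : R^o) = fun h => pair m (Ad h z).
  by apply/funext => h; rewrite pair_Adst.
by rewrite (mdiff_linear_comp hA u (pair_linearr m) s2) mdiff_Ad Ad_1 (rightMC1 hG).
Qed.

Definition gen (rho : V' * V') (x : V * V) : V' * V' := mdiff KA vO (coA^~ rho) Gg_one x.

Lemma genE rho x : gen rho x = (adst x.1 rho.1 + adst x.2 rho.2, adst x.1 rho.2).
Proof.
case: x => x1 x2; rewrite /gen /Gg_one (mdiff_partial hA vec_atlasP x1 x2 (coA_smooth rho (1%g, 0))).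
have cm (m : V') : msmooth_at AG vV' (fun h => Adst h m) 1%g.
  have c : msmooth_at AG vV' (fun=> m) 1%g by exact: msmooth_at_cst.
  exact: (msmooth_at_Adst hA (msmooth_at_id hA 1%g) c).
have e1 : (fun h => coA (h, 0) rho) = fun h => (Adst h rho.1, Adst h rho.2).
  by apply/funext => h; rewrite /coA /= adst0l addr0.
have la : linear (fun v : V => (adst v rho.2, 0 : V')).
  move=> k v w; rewrite adst_linearl -[RHS]/(_ + _, _ + _); congr (_, _).
  exact: esym (etrans (addr0 _) (scaler0 _ k)).
have e2 : (fun v => coA (1%g, v) rho) = fun v => rho + (adst v rho.2, 0 : V').
  apply/funext => v; rewrite /coA /= !Adst1.
  by rewrite -[RHS]/(rho.1 + _, rho.2 + _) addr0.
have idv : msmooth_at vV vV (fun v => v) 0 by exact: (msmooth_at_id vec_atlasP).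
have cr : msmooth_at vV vO (fun=> rho) 0 by exact: msmooth_at_cst.
have ls : msmooth_at vV vO (fun v : V => (adst v rho.2, 0 : V')) 0.
  exact: (msmooth_at_linear la idv).
rewrite e1 e2 (mdiff_vpair x1 (cm rho.1) (cm rho.2)) !mdiff_Adst.
rewrite (mdiff_D x2 cr ls) mdiff_cst add0r (mdiff_linear_comp vec_atlasP x2 la idv).
by rewrite (mdiff_id vec_atlasP) -[LHS]/(_ + _, _ + _) addr0.
Qed.

Lemma oform_gen rho a b :
  oform rho a b = - (pair (gen rho a).1 b.1 + pair (gen rho a).2 b.2).
Proof.
rewrite oformE genE /= pairDl !pair_adst pairDr; ring.
Qed.

Lemma oformC rho a b : oform rho a b = - oform rho b a.
Proof.
rewrite /oform (bracketC b.1 a.1) !pairDr !pairNr; ring.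
Qed.

Lemma oform_ext rho a b a' b' : gen rho a = gen rho a' -> gen rho b = gen rho b' ->
  oform rho a b = oform rho a' b'.
Proof. by move=> ea eb; rewrite oform_gen ea -oform_gen oformC oform_gen eb -oform_gen -oformC. Qed.

Lemma mdiff_invK x : mdiff KA KA invK Gg_one x = - x.
Proof.
case: x => x1 x2; have ks : msmooth_at KA KA invK (1%g, 0 : V).
  exact: (msmooth_at_invK Gg_atlasP (KA_id _)).
rewrite /Gg_one (mdiff_partial hA vec_atlasP x1 x2 ks).
have e1 : (fun h : G => invK (h, 0)) = fun h => (h^-1%g, 0 : V).
  by apply/funext => h; rewrite /invK /= Ad_0 oppr0.
have e2 : (fun v => invK (1%g, v)) = fun v => (1%g : G, - v).
  by apply/funext => v; rewrite /invK /= invg1 Ad_1.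
have idv : msmooth_at vV vV (fun v => v) 0 by exact: (msmooth_at_id vec_atlasP).
have c0 : msmooth_at AG vV (fun=> 0) 1%g by exact: msmooth_at_cst.
have c1 : msmooth_at vV AG (fun=> 1%g) 0 by exact: msmooth_at_cst.
have iv : msmooth_at AG AG (fun h => h^-1%g) 1%g by exact: inv_smooth.
have ls : msmooth_at vV vV (fun v => - v) 0 by exact: (msmooth_at_linear linear_oppV idv).
transitivity (mdiff AG KA (fun h => (h^-1%g, 0 : V)) 1%g x1 + mdiff vV KA (fun v => (1%g : G, - v)) 0 x2).
  by rewrite -e1 -e2.
rewrite (mdiff_pair x1 iv c0) (mdiff_pair x2 c1 ls) !mdiff_cst (mdiff_inv1 hG).
rewrite (mdiff_linear_comp vec_atlasP x2 linear_oppV idv) (mdiff_id vec_atlasP).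
by rewrite -[LHS]/(_ + _, _ + _) addr0 add0r.
Qed.

(** With Phi a = [coA (invK a) rho], one has Phi (a b) = [coA (invK a)] (Phi b); so only the
    differential at the identity is needed, and inversion contributes the sign. *)
Lemma mdiff_coA_inv rho b x :
  mdiff KA vO (fun a => coA (invK a) rho) b (mdiff KA KA (mulK^~ b) Gg_one x) =
  - gen (coA (invK b) rho) x.
Proof.
have e1 : invK Gg_one = Gg_one by rewrite /invK /Gg_one /= invg1 Ad_0 oppr0.
rewrite -(mdiff_comp_at Gg_atlasP Gg_atlasP (f := mulK^~ b) (g := fun a => coA (invK a) rho)
  x (mul1K b) (mulK_smoothr b Gg_one) (coA_inv_smooth rho b)).
have -> : (fun a => coA (invK (mulK a b)) rho) = fun a => coA (invK a) (coA (invK b) rho).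
  by apply/funext => a; rewrite invKM -coA_mul.
rewrite (mdiff_comp_at Gg_atlasP Gg_atlasP (f := invK) (g := coA^~ (coA (invK b) rho))
  x e1 (msmooth_at_invK Gg_atlasP (KA_id _)) (coA_smooth _ _)) mdiff_invK.
rewrite -/(gen _ _) genE genE /= !adstNl -opprD.
by [].
Qed.

Lemma Gg_second_countable : @second_countable (G * V)%type.
Proof.
apply: second_countable_prod; last exact: second_countable_rV.
by case: hG => -[].
Qed.

Lemma coA_invVK b w : coA (invK (invK b)) (coA (invK b) w) = w.
Proof. by rewrite coA_mul mulKV coA1. Qed.

Lemma coA_invKV b w : coA (invK b) (coA (invK (invK b)) w) = w.
Proof. by rewrite coA_mul mulVK coA1. Qed.

Lemma invKK a : invK (invK a) = a.
Proof. by rewrite -[LHS]mulK1 -(mulVK a) -mulKA mulVK mul1K. Qed.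

Lemma coA_inv_mul rho b a : coA (invK (mulK b a)) rho = coA (invK b) (coA (invK a) rho).
Proof. by rewrite invKM -coA_mul. Qed.

Lemma mulKr_span b w : exists x, w = mdiff KA KA (mulK^~ b) Gg_one x.
Proof.
exists (mdiff KA KA (mulK^~ (invK b)) b w).
have s1 := mulK_smoothr (invK b) b; have s2 := mulK_smoothr b Gg_one.
rewrite -(mdiff_comp_at Gg_atlasP Gg_atlasP (f := mulK^~ (invK b)) (g := mulK^~ b)
  w (mulKV b) s1 s2).
rewrite -{1}[w](mdiff_id Gg_atlasP b); congr (mdiff KA KA _ b w).
by apply/funext => x; rewrite mulKA mulVK mulK1.
Qed.

Lemma gen_N rho x : gen rho (- x) = - gen rho x.
Proof. by rewrite genE genE /= !adstNl -opprD. Qed.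

(** * The reduced two-form *)

Section reduction.
Variables (rho : V' * V') (d : nat) (Q : topologicalType) (AQ : atlas 'rV[R]_d Q).
Variables (pi : G * V -> Q) (iota : Q -> V' * V') (s : Q -> 'rV[R]_d -> G * V).
Hypotheses (AQm : is_manifold AQ) (piS : forall q, exists x, pi x = q)
  (piSub : submersion KA AQ pi) (iotaE : forall x, iota (pi x) = coA (invK x) rho)
  (iotaI : injective iota) (iotaS : immersion AQ vO iota)
  (sP : forall q c, acodom AQ q c ->
     msmooth_at (vec_atlas 'rV[R]_d) KA (s q) c /\ pi (s q c) = apoint AQ q c).
Local Notation vd := (vec_atlas 'rV[R]_d).

Let hQ : is_atlas AQ. Proof. exact: is_manifold_atlas AQm. Qed.
Let pi_smooth b : msmooth_at KA AQ pi b.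
Proof. by case: piSub => /(msmoothP Gg_atlasP hQ). Qed.
Let iota_smooth q : msmooth_at AQ vO iota q.
Proof. by case: iotaS => /(msmoothP hQ vec_atlasP). Qed.

Let diota_pi b x :
  mdiff AQ vO iota (pi b) (mdiff KA AQ pi b (mdiff KA KA (mulK^~ b) Gg_one x)) =
  - gen (iota (pi b)) x.
Proof.
rewrite -(mdiff_comp_at Gg_atlasP hQ (f := pi) (g := iota) _ erefl (pi_smooth b) (iota_smooth _)).
have e : (fun y => iota (pi y)) = fun a => coA (invK a) rho by apply/funext => y; exact: iotaE.
by rewrite e iotaE; exact: mdiff_coA_inv.
Qed.

(** Since pi is a submersion and right translates span the tangent spaces of K, every tangent vector
    of Q comes from some x, and [iota] sends it to minus the generator of x. *)
Lemma range_diota q : range (mdiff AQ vO iota q) = range (gen (iota q)).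
Proof.
have [b <-] := piS q; apply/seteqP; split=> _ [u _ <-].
  have [_ /(_ b u)[w <-]] := piSub; have [x ->] := mulKr_span b w.
  exists (- x) => //; rewrite diota_pi.
  exact: gen_N.
exists (mdiff KA AQ pi b (mdiff KA KA (mulK^~ b) Gg_one (- u))) => //.
by rewrite diota_pi gen_N opprK.
Qed.

Variable A : Q -> 'rV[R]_d -> V * V.
Hypothesis AP : forall q u, mdiff AQ vO iota q u = gen (iota q) (A q u).
Let om q u v := oform (iota q) (A q u) (A q v).

(** A chooses a label for each tangent vector; the value does not depend on the choice. *)
Lemma reduced_formE q u v a b : mdiff AQ vO iota q u = gen (iota q) a ->
  mdiff AQ vO iota q v = gen (iota q) b -> om q u v = oform (iota q) a b.
Proof. by rewrite !AP => ea eb; exact: oform_ext. Qed.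

Let omC q u v : om q u v = - om q v u. Proof. exact: oformC. Qed.

(** The choice A need not be linear. With the label of u fixed, the form is the pairing of that
    label with the differential of [iota] at v, which is linear in v. *)
Let om_linear q u : linear (om q u : _ -> R^o).
Proof.
have e v : om q u v = pair (mdiff AQ vO iota q v).1 (A q u).1 +
    pair (mdiff AQ vO iota q v).2 (A q u).2.
  by rewrite omC /om oform_gen opprK AP.
move=> k v w; rewrite !e mdiff_linear /= !pairDl !pairZl.
by rewrite -[RHS]/(_ * _ + _) mulrDr addrACA.
Qed.

(** All generators are differentials of tangent vectors of Q, so the label of u pairs to zero with
    every b; taking b in either factor shows that its generator vanishes, and [iota] is an
    immersion. *)
Let om_nondeg q u : (forall v, om q u v = 0) -> u = 0.
Proof.
move=> h; have [_ /(_ q)] := iotaS; apply.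
have z b : oform (iota q) (A q u) b = 0.
  have : range (gen (iota q)) (gen (iota q) b) by exists b.
  by rewrite -range_diota => -[v _ ev]; rewrite -(h v) (reduced_formE (AP q u) ev).
have -> : mdiff AQ vO iota q 0 = 0.
  by have := mdiff_linear AQ vO iota q (-1) 0 0; rewrite scaler0 addr0 scaleN1r addNr.
rewrite AP; rewrite [LHS]surjective_pairing; congr (_, _); apply: pair_inj => x.
  have := z (x, 0); rewrite oform_gen /= pair0r addr0 => /eqP.
  by rewrite oppr_eq0 => /eqP ->; rewrite pair0l.
have := z (0, x); rewrite oform_gen /= pair0r add0r => /eqP.
by rewrite oppr_eq0 => /eqP ->; rewrite pair0l.
Qed.

(** Through [iota] o pi the right translates of x and y acquire the labels -x and -y; the signs
    cancel by bilinearity. *)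
Lemma reduced_form_pi b u v :
  om (pi b) (mdiff KA AQ pi b u) (mdiff KA AQ pi b v) = dform1 KA (alpha rho) b u v.
Proof.
have [x ->] := mulKr_span b u; have [y ->] := mulKr_span b v.
have h z : mdiff AQ vO iota (pi b) (mdiff KA AQ pi b (mdiff KA KA (mulK^~ b) Gg_one z)) =
  gen (iota (pi b)) (- z) by rewrite gen_N; exact: diota_pi.
rewrite (reduced_formE (h x) (h y)) dalpha -iotaE.
rewrite !oform_gen !gen_N; case: (gen _ x) => g1 g2.
by rewrite /= !pairNl !pairNr !opprK.
Qed.

(** A potential of the reduced form in the chart at q, obtained from the local section of pi. *)
Let be q (c u : 'rV[R]_d) : R^o := pullback1 vd KA (s q) (alpha rho) c u.

Let near_s q c : acodom AQ q c -> \forall z \near c, msmooth_at vd KA (s q) z.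
Proof.
move=> cc; apply: filterS (open_nbhs_nbhs (conj (acodom_open hQ q) cc)) => z zc.
by have [] := sP zc.
Qed.

Let rep1_vec q c y u : rep1 vd (be q) c y u = be q y u.
Proof. by rewrite /rep1 (mdiff_id vec_atlasP). Qed.

Let be_smooth q c v : acodom AQ q c -> smooth_at ((be q)^~ v) c.
Proof.
move=> cc; have [_ /(_ v) sv] :=
  pullback1_smooth vec_atlasP Gg_atlasP (near_s cc) (alpha_smooth rho (s q c)).
apply: (smooth_at_eq _ sv); apply: near_all => y; exact: rep1_vec.
Qed.

Let rep2_om q c u v : acodom AQ q c ->
  rep2 AQ om q c u v = 'D_u ((be q)^~ v) c - 'D_v ((be q)^~ u) c.
Proof.
move=> cc; have [ss ps] := sP cc.
have dap w : mdiff vd AQ (apoint AQ q) c w = mdiff KA AQ pi (s q c) (mdiff vd KA (s q) c w).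
  rewrite -(mdiff_comp vec_atlasP Gg_atlasP w ss (pi_smooth _)).
  apply: esym; apply: (mdiff_eq vec_atlasP).
    apply: filterS (open_nbhs_nbhs (conj (acodom_open hQ q) cc)) => z zc.
    by have [] := sP zc.
  exact: (msmooth_at_comp vec_atlasP Gg_atlasP ss (pi_smooth _)).
rewrite /rep2 !dap -ps reduced_form_pi.
rewrite -(dform1_pullback vec_atlasP Gg_atlasP u v (near_s cc) (alpha_smooth _ _)).
have e w : (fun y => rep1 vd (pullback1 vd KA (s q) (alpha rho)) c y w : R^o) = (be q)^~ w.
  by apply/funext => y; exact: rep1_vec.
exact: (f_equal2 (fun f g : 'rV[R]_d -> R^o => 'D_u f c - 'D_v g c) (e v) (e u)).
Qed.

Lemma reduced_form_symplectic : Defs.is_symplectic AQ om.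
Proof.
split.
- split; [exact: om_linear|exact: omC|move=> q u v].
  by apply: (exact_smooth hQ (be := be q)) => *; [exact: be_smooth|exact: rep2_om].
- by move=> q u v w; apply: (exact_closed hQ (be := be q)) => *; [exact: be_smooth|exact: rep2_om].
- exact: om_nondeg.
Qed.

End reduction.

Lemma lvl_inj rho : injective (lvl rho).
Proof. by move=> [g x] [h y] [-> _ -> _]. Qed.

(** The projection to the components in G and g is a continuous left inverse, and the differential
    keeps both components of a vector. *)
Lemma lvl_embedding rho : embedding KA TA (lvl rho).
Proof.
have hs : msmooth KA TA (lvl rho).
  by apply/(msmoothP Gg_atlasP TTsG_atlasP) => a; exact: lvl_smooth.
split; [split=> // a u v| exact: lvl_inj |].
  have [_ h] := lvl_diff rho a; have [a2 [a4 ->]] := h u; have [b2 [b4 ->]] := h v.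
  by case: u v => [u1 u2] [v1 v2] /= [-> _ -> _].
move=> U oU; pose f (p : TTsG R n G) : G * V := (p.1.1.1, p.1.2).
exists (f @^-1` U); last by apply/seteqP; split=> -[g x].
apply: open_comp => // p _.
have c1 : {for p, continuous (fun p : TTsG R n G => p.1)} by exact: cvg_fst.
have c2 : {for p.1, continuous (fun p : G * V' * V => p.1)} by exact: cvg_fst.
have c3 : {for p.1.1, continuous (fun p : G * V' => p.1)} by exact: cvg_fst.
have c4 : {for p.1, continuous (fun p : G * V' * V => p.2)} by exact: cvg_snd.
have d1 := continuous_comp (continuous_comp c1 c2) c3.
have d2 := continuous_comp c1 c4.
exact: (cvg_pair d1 d2).
Qed.

(** The isotropy element relating two points of a fibre is x^-1 y. *)
Lemma orbit_map_fibres rho x y : coA (invK x) rho = coA (invK y) rho <->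
  exists2 k, coA k rho = rho & lvl rho y = act (lvl rho x) k.
Proof.
split=> [xy|[k kr]].
  have kr : coA (mulK (invK x) y) rho = rho by rewrite -coA_mul xy coA_mul mulVK coA1.
  by exists (mulK (invK x) y) => //; rewrite lvl_act// -mulKA mulKV mul1K.
rewrite lvl_act// => /lvl_inj ->; rewrite coA_inv_mul.
by have -> : coA (invK k) rho = rho by rewrite -{1}kr coA_mul mulKV coA1.
Qed.

Lemma coadjoint_reduction rho :
  exists (i : G * V -> TTsG R n G) (d : nat) (Q : topologicalType) (AQ : atlas 'rV[R]_d Q)
      (pi : G * V -> Q) (omega : Q -> 'rV[R]_d -> 'rV[R]_d -> R) (iota : Q -> V' * V'),
    let diota := mdiff AQ vO iota in
    [/\ (forall a, (i a).1.1.1 = a.1 /\ (i a).1.2 = a.2) /\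
        is_symplectic_reduction TA KA AQ (dform1 TA theta2)
          act mom rho [set a | coA a rho = rho] i pi omega,
        [/\ immersion AQ vO iota, injective iota & range iota = range (fun a => coA a rho)],
        forall a, iota (pi a) = coA (invK a) rho,
        forall q, range (diota q) = range (gen (iota q)) &
        forall q u v a b, diota q u = gen (iota q) a -> diota q v = gen (iota q) b ->
          omega q u v = oform (iota q) a b].
Proof.
have TL b : linear (coA (invK b)) by exact: coA_linear.
have [d [Q [AQ [pi [iota [s [AQm [piS piSub] [iE iI] iS sP]]]]]]] :=
  equivariant_orbit Gg_atlasP Gg_second_countable mulKA mul1K mulK1 mulVK mulKV mulK_smoothl
    mulK_smoothr (coA_inv_smooth rho) TL (fun a b => coA_inv_mul rho b a) coA_invVK coA_invKV.
have rg := range_diota AQm piS piSub iE iS.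
(* A label for each tangent vector of Q exists because the differentials of [iota] have the
   generators as range. *)
have /choice[A AP] : forall qu : Q * 'rV[R]_d, exists a,
    mdiff AQ vO iota qu.1 qu.2 = gen (iota qu.1) a.
  move=> [q u]; have : range (mdiff AQ vO iota q) (mdiff AQ vO iota q u) by exists u.
  by rewrite rg => -[a _ <-]; exists a.
have AP' q u : mdiff AQ vO iota q u = gen (iota q) (A (q, u)) by exact: (AP (q, u)).
exists (lvl rho), d, Q, AQ, pi,
  (fun q u v => oform (iota q) (A (q, u)) (A (q, v))), iota; split.
- split; first by [].
  split.
  + by split; [exact: lvl_embedding|exact: range_lvl].
  + by move=> p k pr kr; rewrite mom_act pr; exact: kr.
  + split; [exact: piSub|exact: piS|move=> x y].
    apply: iff_trans (orbit_map_fibres rho x y).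
    by split=> [xy|xy]; [rewrite -!iE xy|apply: iI; rewrite !iE].
  + split; first exact: AQm.
    exact: (reduced_form_symplectic AQm piS piSub iE iS sP (fun q u => AP' q u)).
  + move=> x u v; apply: etrans (esym (dtheta2_lvl rho x u v)).
    exact: (reduced_form_pi AQm piSub iE iS (fun q u => AP' q u)).
- split; [exact: iS|exact: iI|].
  apply/seteqP; split=> _ [x _ <-].
    by have [a <-] := piS x; exists (invK a).
  by exists (pi (invK x)) => //; rewrite iE invKK.
- exact: iE.
- exact: rg.
- by move=> q u v a b; exact: (reduced_formE (fun q u => AP' q u)).
Qed.
End coadjoint.

Theorem proposition6p18 (R : realType) (n : nat) (G : topGroupType)
    (AG : atlas 'rV[R]_n G) (hG : is_lie_group AG)
    (theta2 : TTsG R n G -> TTsGvec R n -> R) (htheta2 : is_theta2 AG theta2)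
    (lam mu : 'cV[R]_n) :
  let Omega := dform1 (TTsG_atlas AG) theta2 in
  let J := momentum AG theta2 in
  let rho := (lam, mu) in
  [/\ forall p, TTsG_act AG p Gg_one = p,
      forall p a b, TTsG_act AG (TTsG_act AG p a) b =
                    TTsG_act AG p (Gg_mul AG a b) &
      exists (i : Gg R n G -> TTsG R n G)
             (d : nat) (Q : topologicalType) (AQ : atlas 'rV[R]_d Q)
             (pi : Gg R n G -> Q) (omega : Q -> 'rV[R]_d -> 'rV[R]_d -> R)
             (iota : Q -> 'cV[R]_n * 'cV[R]_n),
        let diota := mdiff AQ (vec_atlas ('cV[R]_n * 'cV[R]_n)%type) iota in
        [/\ (forall a, (i a).1.1.1 = a.1 /\ (i a).1.2 = a.2) /\
            is_symplectic_reduction (TTsG_atlas AG) (Gg_atlas AG) AQ Omega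
              (TTsG_act AG) J rho (coad_isotropy AG rho) i pi omega,
            [/\ immersion AQ (vec_atlas ('cV[R]_n * 'cV[R]_n)%type) iota,
                injective iota & range iota = coad_orbit AG rho],
            forall a, iota (pi a) = coAd AG (Gg_inv AG a) rho,
            forall q, range (diota q) = range (coad_generator AG (iota q)) &
            forall q u v a b,
              diota q u = coad_generator AG (iota q) a ->
              diota q v = coad_generator AG (iota q) b ->
              omega q u v = orbit_form AG (iota q) a b]].
Proof.
split.
(* The [erefl] arguments instantiate the abstract [Ad] and [bracket] by those of G, whereupon the
   copied notions agree with the original ones by conversion. *)
- exact: (act_one hG erefl erefl).
- exact: (act_mulK hG erefl erefl).
- exact: (coadjoint_reduction hG erefl erefl erefl htheta2).
Qed.
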